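(* Let $b\ge 2$ be an integer. Suppose $(n_1,n_2,n_3,\ell_1,\ell_2,\ell_3,d_1,d_2,d_3)$ is a tuple of integers with $$n_1\ge n_2\ge n_3\ge 0,\qquad \ell_3\ge \ell_2\ge \ell_1\ge 1,\qquad d_1,d_2,d_3\in\{0,1,\dots,b-1\},\qquad d_1>0,$$ satisfying $$F_{n_1}+F_{n_2}+F_{n_3}= d_1\frac{b^{\ell_1}-1}{b-1}\,b^{\ell_2+\ell_3}+d_2\frac{b^{\ell_2}-1}{b-1}\,b^{\ell_3}+d_3\frac{b^{\ell_3}-1}{b-1}.$$ Then $n_1<3.09\times 10^{82}\,\log^{11} b$.
   Context: $(F_n)_{n\ge0}$ is the Fibonacci sequence: $F_0=0$, $F_1=1$, $F_{n+2}=F_{n+1}+F_n$. The right-hand side of the equation is the integer whose base-$b$ expansion is the concatenation of the digit $d_1$ repeated $\ell_1$ times, then $d_2$ repeated $\ell_2$ times, then $d_3$ repeated $\ell_3$ times. $\log$ denotes the natural logarithm. *)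

(* Defs.v *)
From Stdlib Require Import Arith Reals.

Fixpoint fib (n : nat) : nat :=
  match n with
  | 0 => 0
  | S m => match m with
           | 0 => 1
           | S k => fib m + fib k
           end
  end.

(* d * (b^l - 1)/(b - 1): the base-b integer consisting of digit d repeated l times.
   The division is exact since (b-1) | (b^l - 1). *)
Definition repdigit (b d l : nat) : nat := d * ((b ^ l - 1) / (b - 1)).

(* Main.v *)
(** Let alpha be the golden ratio.  Keeping j terms on the left-hand side and i blocks of
    digits on the right-hand side, the equation says that x alpha^A and sqrt 5 y b^B are
    close, where the heights of x and y only involve the exponent gaps n_1 - n_j and
    L - e_i already bounded.  A lower bound for
    Lambda = ln x - ln (sqrt 5 y) + A ln alpha - B ln b
    then bounds one further gap, and five such steps bound n_1.

    The lower bound is obtained with interpolation determinants.  At the points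
    X = alpha^s1 b^s2 (x/y)^s3, u = s1 - A s3, v = s2 + B s3, the number v is very close to
    an affine function of ln X and u as soon as Lambda is small, so that a determinant of
    monomials u^i v^j X^m is analytically tiny; being a norm up to a controlled
    denominator, it must vanish.  A zero estimate for the plane translates by the points
    (u, v) forbids the vanishing of all minors, unless q B + p A = r with small
    coefficients.  In that case p Lambda is a form in two logarithms, to which the same
    argument applies without exceptional case. *)

Require Import Defs.

(** The gain is a matter of counting. With degrees up to K in u and v and L = 2 M + 1 powers of X
    there are about K^2 L rows, but once v is replaced by its affine expression in Z = ln X and u,
    each power of Z comes with at most 2 K + 1 powers of u. A surviving product thus carries on
    average about K L / 4 powers of Z per row, while the losses per row are linear: lam, a bound for
    ln |u| and ln |v|, for each degree in u or v, and the height of X for each of its powers. So M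
    proportional to lam suffices. The zero estimate wants more than 2 (K L)^2 points, with ranges
    inversely proportional to the heights. This forces K of order lam^2 h ln b, h being the height
    of x and y, and gives exp(- c lam^3 h ln b). In the exceptional case the two logarithms have
    heights of order lam h and lam ln b, which costs one more factor lam. With lam about log n_1,
    each of the five steps multiplies the known gap by lam^4 ln b, so n_1 is at most of order lam^20
    (ln b)^6; the logarithms of n_1 are then absorbed in n_1^(1/11), whence the eleventh power. *)

Module LinearForms.

From HB Require Import structures.
From mathcomp Require Import all_boot all_order all_algebra all_fingroup.
From mathcomp Require Import boolp classical_sets reals topology normedtype sequences exp.
From mathcomp Require Import ring lra zify.
Set Implicit Arguments. Unset Strict Implicit. Unset Printing Implicit Defensive.
Import Order.TTheory GRing.Theory Num.Theory numFieldNormedType.Exports.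
Local Open Scope ring_scope.

(** * Zero estimates in the plane *)

Section Shift.
Variable R : realFieldType.
Notation PP := {poly {poly R}}.
Implicit Types P Q : PP.

(* In {poly {poly R}} the outer variable is v and the inner one is u. *)
Definition ev2 P (u v : R) : R := P.[v%:P].[u].

Definition sh (g : R * R) P : PP :=
  map_poly (comp_poly ('X + g.1%:P)) P \Po ('X + g.2%:P%:P).

Lemma sh_is_additive g : zmod_morphism (sh g).
Proof. by move=> P Q; rewrite /sh !rmorphB. Qed.
Lemma sh_is_mult g : monoid_morphism (sh g).
Proof. by split; [rewrite /sh !rmorph1 | move=> P Q; rewrite /sh !rmorphM]. Qed.
HB.instance Definition _ g := GRing.isZmodMorphism.Build PP PP (sh g) (sh_is_additive g).
HB.instance Definition _ g := GRing.isMonoidMorphism.Build PP PP (sh g) (sh_is_mult g).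

Lemma shC g (c : {poly R}) : sh g c%:P = (c \Po ('X + g.1%:P))%:P.
Proof. by rewrite /sh map_polyC comp_polyC. Qed.

Lemma shZ g (c : {poly R}) P : sh g (c *: P) = (c \Po ('X + g.1%:P)) *: sh g P.
Proof. by rewrite -!mul_polyC rmorphM /= shC. Qed.

Lemma sh0 P : sh 0 P = P.
Proof.
rewrite /sh /= !polyC0 !addr0 comp_polyXr map_poly_id // => p _.
exact: comp_polyXr.
Qed.

Lemma shX g : sh g 'X = 'X + g.2%:P%:P.
Proof. by rewrite /sh map_polyX comp_polyX. Qed.

Lemma sh_sh g h P : sh g (sh h P) = sh (g + h) P.
Proof.
elim/poly_ind: P => [|P c IH]; first by rewrite !raddf0.
rewrite !rmorphD !rmorphM /= {}IH !shX !rmorphD /= !shX !shC; congr (_ * _ + _).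
  by rewrite comp_polyC -addrA -!polyCD.
by congr _%:P; rewrite -comp_polyA comp_polyD comp_polyX comp_polyC -addrA -polyCD.
Qed.

Lemma ev2_sh g P u v : ev2 (sh g P) u v = ev2 P (u + g.1) (v + g.2).
Proof.
rewrite /ev2; elim/poly_ind: P => [|P c IH]; first by rewrite raddf0 !horner0.
rewrite rmorphD rmorphM /= shX shC !(hornerD, hornerM, hornerX, hornerC) IH.
by rewrite horner_comp !(hornerD, hornerX, hornerC).
Qed.

Lemma size_sh g P : size (sh g P) = size P.
Proof.
rewrite /sh size_comp_poly2; last by rewrite size_XaddC.
rewrite size_map_inj_poly ?raddf0 // => p q /(congr1 (comp_poly ('X - g.1%:P))).
by rewrite -!comp_polyA comp_polyD comp_polyX comp_polyC subrK !comp_polyXr.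
Qed.

Lemma sh_eq0 g P : (sh g P == 0) = (P == 0).
Proof. by rewrite -!size_poly_eq0 size_sh. Qed.

End Shift.

(** * Determinants of polynomial matrices and elimination of v *)

Section DetPoly.
Variable A : comNzRingType.

Lemma size_coef_prod (I : Type) (s : seq I) (p : I -> {poly A}) (d : I -> nat) :
  (forall i, (size (p i) <= (d i).+1)%N) ->
  (size (\prod_(i <- s) p i)%R <= (\sum_(i <- s) d i).+1)%N /\
  (\prod_(i <- s) p i)`_(\sum_(i <- s) d i) = \prod_(i <- s) (p i)`_(d i).
Proof.
move=> hp; elim: s => [|i s [IH1 IH2]].
  by rewrite !big_nil size_poly1 coef1.
rewrite !big_cons; move: IH1 IH2; set q := \prod_(j <- s) p j; set n := (\sum_(j <- s) d j)%N => IH1 IH2; split.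
  apply: (leq_trans (size_polyMleq _ _)).
  move: (hp i) IH1; clearbody n.
  by move: (size (p i)) (size q) (d i) => x y z; lia.
rewrite coefM (bigD1 (inord (d i))) //= inordK; last by rewrite ltnS leq_addr.
rewrite addKn IH2 [X in _ + X]big1 ?addr0 // => j jd.
have [jl|jl|je] := ltngtP j (d i).
- rewrite [q`_(_)]nth_default ?mulr0 //; apply: leq_trans IH1 _.
  by move: jl; clearbody n; move: (d i) (j : nat) => x y; lia.
- by rewrite [(p i)`_j]nth_default ?mul0r // (leq_trans (hp i)).
- by case/eqP: jd; apply: val_inj; rewrite /= inordK // ltnS leq_addr.
Qed.

(** Each term of the determinant takes one entry per column, so the column degrees add up and the
    extreme coefficient comes only from extreme coefficients. *)
Lemma size_coef_det n (M : 'M[{poly A}]_n) (d : 'I_n -> nat) :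
  (forall i j, (size (M i j) <= (d j).+1)%N) ->
  (size (\det M) <= (\sum_j d j).+1)%N /\
  (\det M)`_(\sum_j d j) = \det (\matrix_(i, j) (M i j)`_(d j)).
Proof.
move=> hM.
have key (s : {perm 'I_n}) : (size (\prod_i M i (s i))%R <= (\sum_j d j).+1)%N /\
    (\prod_i M i (s i))`_(\sum_j d j) = \prod_i (M i (s i))`_(d (s i)).
  have -> : (\sum_j d j)%N = (\sum_i d (s i))%N by rewrite (reindex_inj (@perm_inj _ s)).
  exact: (size_coef_prod (index_enum _) (fun i => hM i (s i))).
split.
  apply/leq_sizeP; rewrite /determinant => k hk.
  rewrite coef_sum big1 // => s _.
  have -> : (-1) ^+ s = ((-1) ^+ s)%:P :> {poly A} by rewrite rmorph_sign.
  rewrite coefCM.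
  by rewrite nth_default ?mulr0 // (leq_trans (proj1 (key s))).
rewrite /determinant coef_sum; apply: eq_bigr => s _.
have -> : (-1) ^+ s = ((-1) ^+ s)%:P :> {poly A} by rewrite rmorph_sign.
rewrite coefCM (proj2 (key s)); congr (_ * _).
by apply: eq_bigr => i _; rewrite mxE.
Qed.
End DetPoly.

Lemma poly_wide (A : nzRingType) (p : {poly A}) n :
  (size p <= n)%N -> p = \sum_(i < n) p`_i *: 'X^i.
Proof.
move=> hp; rewrite -poly_def; apply/polyP => i; rewrite coef_poly.
by case: ltnP => // ni; rewrite nth_default // (leq_trans hp).
Qed.

Section Span.
Variable R : realFieldType.
Notation PP := {poly {poly R}}.
Variables (I : finType) (Rg : I -> PP) (i0 : I) (D0 : nat).
Hypothesis size0 : size (Rg i0) = D0.+1.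
Hypothesis sizeg : forall i, (size (Rg i) <= D0.+1)%N.
Variables (c : {poly R}) (Ac : I -> PP).
Hypothesis c0 : c != 0.
Hypothesis Acc : \sum_i Ac i * Rg i = c%:P.

(** Multiply the relation by X^k and divide every coefficient by [Rg i0]: the remainders have degree
    below D0, and all quotients are collected in the coefficient of [Rg i0], which is small as well
    by comparison of degrees. Pseudo-division costs powers of a leading coefficient, absorbed in
    c'. *)
Lemma span_Xk k : (k < D0 + D0)%N -> exists c' (b : I -> PP),
  [/\ c' != 0, forall i, (size (b i) <= D0)%N & c' *: 'X^k = \sum_i b i * Rg i].
Proof.
move=> kD; pose p i := Ac i * 'X^k; pose R0 := Rg i0.
have R00 : R0 != 0 by rewrite -size_poly_eq0 size0.
pose n i := scalp (p i) R0; pose l := lead_coef R0.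
have l0 : l != 0 by rewrite lead_coef_eq0.
have pd i : l ^+ n i *: p i = (p i %/ R0) * R0 + p i %% R0 by exact: Pdiv.Idomain.divp_eq.
have rs i : (size (p i %% R0)%R <= D0)%N by have := ltn_modp (p i) R0; rewrite R00 size0 ltnS.
pose N := (\sum_i n i)%N.
pose Q := \sum_i (l ^+ (N - n i) *: (p i %/ R0)) * Rg i.
pose r i := l ^+ (N - n i) *: (p i %% R0).
have nN i : (n i <= N)%N by rewrite /N (bigD1 i) //= leq_addr.
have E : (l ^+ N * c) *: 'X^k = \sum_i r i * Rg i + Q * R0.
  rewrite -scalerA -[c *: _]mul_polyC -Acc mulr_suml scaler_sumr mulr_suml -big_split /=.
  apply: eq_bigr => i _; rewrite mulrAC -/(p i) -[in LHS](subnK (nN i)) exprD -scalerA.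
  rewrite [l ^+ n i *: _]scalerAl pd /r -!scalerAl -!scalerDr mulrDl addrC.
  by congr (_ *: (_ + _)); rewrite mulrAC.
have sr i : (size (r i) <= D0)%N by apply: leq_trans (size_scale_leq _ _) _.
have sQ : (size Q <= D0)%N.
  have [->|Q0] := eqVneq Q 0; first by rewrite size_poly0.
  have : (size (Q * R0)%R <= D0 + D0)%N.
    have -> : Q * R0 = (l ^+ N * c) *: 'X^k - \sum_i r i * Rg i by rewrite E addrAC subrr add0r.
    apply: leq_trans (size_polyD _ _) _; rewrite geq_max; apply/andP; split.
      by apply: leq_trans (size_scale_leq _ _) _; rewrite size_polyXn.
    rewrite size_polyN; apply: leq_trans (size_sum _ _ _) _.
    apply/bigmax_leqP => i _; apply: leq_trans (size_polyMleq _ _) _.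
    have := sr i; have := sizeg i; move: (size (r i)) (size (Rg i)) => x y; lia.
  by rewrite size_mul // size0; move: (size Q) => x; lia.
exists (l ^+ N * c), (fun i => r i + (if i == i0 then Q else 0)); split.
- by rewrite mulf_neq0 // expf_neq0.
- move=> i; apply: leq_trans (size_polyD _ _) _; rewrite geq_max sr /=.
  by case: ifP => _ //; rewrite size_poly0.
- rewrite E; under [RHS]eq_bigr => i _ do rewrite mulrDl.
  rewrite big_split /=; congr (_ + _).
  by rewrite (bigD1 i0) //= eqxx big1 ?addr0 // => i /negPf ->; rewrite mul0r.
Qed.

Lemma coef_comb (b : I -> PP) k : (forall i, (size (b i) <= D0)%N) ->
  (\sum_i b i * Rg i)`_k =
  \sum_(t : 'I_D0 * I) (b t.2)`_(t.1) * ('X^(t.1) * Rg t.2)`_k.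
Proof.
move=> hb; rewrite coef_sum -(pair_big xpredT xpredT
  (fun (i : 'I_D0) j => (b j)`_i * ('X^i * Rg j)`_k)) exchange_big /=.
apply: eq_bigr => j _; rewrite [b j in LHS](poly_wide (hb j)) mulr_suml coef_sum.
by apply: eq_bigr => i _; rewrite -scalerAl coefZ.
Qed.

(** A matrix of Sylvester type: over R(u) the products X^a Rg i with a < D0 generate all polynomials
    of degree less than 2 D0, so 2 D0 of them have independent coefficient vectors. *)
Lemma span_minor : exists f : 'I_(D0 + D0) -> 'I_D0 * I,
  \det (\matrix_(a, k < D0 + D0) ('X^((f a).1) * Rg (f a).2)`_k) != 0.
Proof.
pose T : finType := ('I_D0 * I)%type.
pose ev (t : 'I_#|{: T}|) : T := enum_val t.
pose N : 'M[{poly R}]_(#|{: T}|, D0 + D0) := \matrix_(t, k)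
  ('X^((ev t).1) * Rg (ev t).2)`_k.
pose tf := @FracField.tofrac {poly R}.
pose NF := map_mx tf N.
have full : row_full NF.
  have h (k : 'I_(D0 + D0)) := span_Xk (ltn_ord k).
  have /choice [cf hc] := h; have /choice [bf hb] := hc.
  apply/row_fullP; exists (\matrix_(k, t)
     (tf ((bf k (ev t).2)`_((ev t).1)) / tf (cf k))).
  apply/matrixP => k k'; rewrite !mxE; have [c'0 bs bE] := hb k.
  under eq_bigr => t _ do rewrite !mxE mulrAC -rmorphM /=.
  rewrite -mulr_suml -rmorph_sum /=.
  rewrite -(big_enum_val (fun t : T => (bf k t.2)`_t.1 * ('X^(t.1) * Rg t.2)`_k')) /=.
  rewrite -coef_comb // -bE coefZ coefXn eq_sym (_ : (k == k' :> nat) = (k == k')) //.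
  case: (eqVneq k k') => [_|kk] /=; last by rewrite mulr0 rmorph0 mul0r.
  by rewrite mulr1 divff // tofrac_eq0.
pose fr := fullrankfun full.
exists (fun a => ev (fr a)).
have := fullrowsub_unit full; rewrite unitmxE unitfE.
have -> : rowsub (fullrankfun full) NF = map_mx tf (rowsub fr N) by apply/matrixP => i j; rewrite !mxE.
rewrite det_map_mx tofrac_eq0; congr (\det _ != 0).
by apply/matrixP => i j; rewrite !mxE.
Qed.
End Span.

Lemma det_Vandermonde_neq0 (F : fieldType) n (a : 'I_n -> F) :
  injective a -> \det (\matrix_(i < n, j < n) a j ^+ i) != 0.
Proof.
move=> inja; have -> : \matrix_(i < n, j < n) a j ^+ i = Vandermonde n (\row_j a j).
  by apply/matrixP => i j; rewrite !mxE.
rewrite det_Vandermonde; apply/prodf_neq0 => i _; apply/prodf_neq0 => j ij.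
by rewrite !mxE subr_eq0; apply/eqP => /inja ji; move: ij; rewrite ji ltnn.
Qed.

Section Mult.
Variable R : fieldType.

Lemma dvdp_det_col n (M : 'M[{poly R}]_n) (p : {poly R}) P : (P <= n)%N ->
  (forall (i j : 'I_n), (j < P)%N -> p %| M i j) -> p ^+ P %| \det M.
Proof.
move=> Pn hM.
pose d := \row_(j < n) (if (j < P)%N then p else 1).
pose M' := \matrix_(i < n, j < n) (if (j < P)%N then M i j %/ p else M i j).
have -> : M = M' *m diag_mx d.
  apply/matrixP => i j; rewrite mul_mx_diag !mxE.
  by case: ifP => jP; rewrite ?mulr1 // divpK // hM.
rewrite det_mulmx det_diag; apply: dvdp_mull.
have -> : \prod_i d 0 i = p ^+ P; last exact: dvdpp.
under eq_bigr => i _ do rewrite mxE.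
by rewrite -big_mkcond -(big_ord_widen n (fun=> p) Pn) prodr_const card_ord.
Qed.

Lemma dvdp_prod_XsubC_exp (us : seq R) P (D : {poly R}) : uniq us ->
  (forall u, u \in us -> ('X - u%:P) ^+ P %| D) -> (\prod_(u <- us) ('X - u%:P)) ^+ P %| D.
Proof.
elim: us => [|u us IH] /=; first by rewrite big_nil expr1n dvd1p.
move=> /andP[uN uq] h; rewrite big_cons exprMn Gauss_dvdp; last first.
  apply/coprimep_expl/coprimep_expr; rewrite coprimep_sym coprimep_XsubC.
  by rewrite root_prod_XsubC.
rewrite h ?mem_head //= IH // => v vus; apply: h.
by rewrite inE vus orbT.
Qed.
End Mult.

Section Count.
Variable R : realFieldType.
Notation PP := {poly {poly R}}.
Variables (I : finType) (Rg : I -> PP) (i0 : I) (D0 Du P2 : nat).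
Hypothesis size0 : size (Rg i0) = D0.+1.
Hypothesis sizeg : forall i, (size (Rg i) <= D0.+1)%N.
Hypothesis sizeu : forall i k, (size ((Rg i)`_k)%R <= Du.+1)%N.
Variables (c : {poly R}) (Ac : I -> PP).
Hypothesis c0 : c != 0.
Hypothesis Acc : \sum_i Ac i * Rg i = c%:P.
Variables (us : seq R) (w : R -> R).
Hypothesis abscissae_uniq : uniq us.
Hypothesis P2D : (P2 <= D0 + D0)%N.
Hypothesis zeros : forall u i j, u \in us -> (j < P2)%N -> ev2 (Rg i) u (w u + j%:R) = 0.

(** The minor of [span_minor] acts as a resultant, of degree at most 2 D0 Du in u. For a fixed
    abscissa u, multiplying it by the constant Vandermonde matrix of the nodes w u + j turns
    coefficients into values; the first P2 columns then vanish at u, so X - u divides the minor P2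
    times. *)
Lemma zero_count : (size us * P2 <= (D0 + D0) * Du)%N.
Proof.
have [f] := span_minor size0 sizeg c0 Acc.
set N := (X in \det X) => dN.
have sN i k : (size (N i k) <= Du.+1)%N.
  by rewrite mxE coefXnM; case: ifP => _; rewrite ?size_poly0.
have [sdet _] := size_coef_det (fun i k => sN i k).
rewrite sum_nat_const card_ord in sdet.
have dv : (\prod_(u <- us) ('X - u%:P)) ^+ P2 %| \det N.
  apply: dvdp_prod_XsubC_exp => // u uus.
  pose nd (j : 'I_(D0 + D0)) : R := w u + j%:R.
  pose C := \matrix_(k < D0 + D0, j < D0 + D0) nd j ^+ k.
  have ndinj : injective nd.
    by move=> i j /addrI /eqP; rewrite eqr_nat => /eqP /val_inj.
  pose CP := map_mx (@polyC R) C.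
  have dC : \det CP = (\det C)%:P by rewrite det_map_mx.
  have := det_Vandermonde_neq0 ndinj; rewrite -/C => dC0.
  have : ('X - u%:P) ^+ P2 %| \det (N *m CP).
    apply: dvdp_det_col => // i j jP; rewrite dvdp_XsubCl rootE mxE.
    have := zeros (f i).2 uus jP; set g := (f i).2; set q := Rg g => hz.
    under eq_bigr => k _ do rewrite !mxE polyC_exp.
    rewrite -horner_coef_wide.
      by rewrite hornerM hornerM -/(ev2 q u (w u + j%:R)) hz mulr0.
    rewrite -/g -/q; have [->|q0] := eqVneq q 0; first by rewrite mulr0 size_poly0.
    rewrite mulrC size_mulXn //; apply: leq_trans (leq_add (leqnn _) (sizeg g)) _.
    by have := ltn_ord (f i).1; lia.
  rewrite det_mulmx dC mulrC mul_polyC dvdpZr //.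
have sz0 : (0 < size ((\prod_(u <- us) ('X - u%:P)) ^+ P2)%R)%N.
  by rewrite size_poly_gt0 expf_neq0 // monic_neq0 // monic_prod_XsubC.
have := leq_trans (dvdp_leq dN dv) sdet; rewrite -(prednK sz0) size_exp size_prod_XsubC /=.
by rewrite ltnS.
Qed.
End Count.

(** * Greatest common divisors and distinct translates *)

Lemma ex_min_size (A : nzSemiRingType) (P : {poly A} -> Prop) :
  (exists f, P f) -> exists f, P f /\ forall g, P g -> (size f <= size g)%N.
Proof.
move=> [f0 Pf0].
have ex : exists n, `[< exists2 f, P f & size f = n >].
  by exists (size f0); apply/asboolP; exists f0.
case: (ex_minnP ex) => n /asboolP[f Pf fn] minn.
exists f; split=> // g Pg; rewrite fn; apply: minn.
by apply/asboolP; exists g.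
Qed.

Section Ideal.
Variable R : realFieldType.
Notation PP := {poly {poly R}}.

(** Over R[u], [%|] allows a nonzero factor in R[u], so it is divisibility in R(u)[v]. A nonzero
    pseudo-remainder by the element of least degree would be a smaller element of the ideal. *)
Lemma ideal_min (I : finType) (Rg : I -> PP) i0 : Rg i0 != 0 ->
  exists G : PP, [/\ G != 0, exists Ac : I -> PP, G = \sum_i Ac i * Rg i
    & forall i, G %| Rg i].
Proof.
move=> R0; pose P (f : PP) := f != 0 /\ exists Ac : I -> PP, f = \sum_i Ac i * Rg i.
have ex : exists f, P f.
  exists (Rg i0); split=> //; exists (fun i => if i == i0 then 1 else 0).
  by rewrite (bigD1 i0) //= eqxx mul1r big1 ?addr0 // => i /negPf ->; rewrite mul0r.
have [G [[G0 [Ac GE]] minG]] := ex_min_size ex.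
exists G; split=> //; first by exists Ac.
move=> i; rewrite /dvdp; apply/negPn/negP => r0.
have : P (Rg i %% G).
  split=> //; exists (fun j => (if j == i then (lead_coef G ^+ scalp (Rg i) G)%:P else 0)
     - (Rg i %/ G) * Ac j).
  under eq_bigr => j _ do rewrite mulrBl -mulrA.
  rewrite sumrB -mulr_sumr -GE (bigD1 i) //= eqxx big1 ?addr0 => [|j /negPf ->]; last by rewrite mul0r.
  by rewrite mul_polyC Pdiv.Idomain.divp_eq addrC addKr.
by move=> /minG; rewrite leqNgt ltn_modp G0.
Qed.

Lemma dvdp_sh g (p q : PP) : p %| q -> sh g p %| sh g q.
Proof.
move=> /Pdiv.Idomain.dvdpP[[c r] /= c0 E]; apply/Pdiv.Idomain.dvdpP.
exists (c \Po ('X + g.1%:P), sh g r) => /=; last by rewrite -shZ E rmorphM.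
by rewrite -polyC_eq0 -shC sh_eq0 polyC_eq0.
Qed.

Lemma eqp_sh g (p q : PP) : p %= q -> sh g p %= sh g q.
Proof. by move=> /andP[h1 h2]; apply/andP; split; apply: dvdp_sh. Qed.

Section Min.
Variables (I : finType) (g : I -> R * R) (R0 : PP).
Hypothesis R00 : R0 != 0.

(** An element of least degree in this class plays the part of an irreducible factor of R0 common to
    all translations. *)
Definition transl (f : PP) := (1 < size f)%N /\ forall i, sh (- g i) f %| R0.

Variable f : PP.
Hypothesis tf : transl f.
Hypothesis minf : forall f', transl f' -> (size f <= size f')%N.
Let fi i := sh (- g i) f.

(** A nonconstant gcd of two translates, moved back by [g i], again satisfies [transl]; minimality
    then makes it associate to both. *)
Lemma transl_coprime i j : ~~ (fi i %= fi j) -> coprimep (fi i) (fi j).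
Proof.
move=> nij; rewrite coprimep_def eqn_leq; apply/andP; split; last first.
  rewrite size_poly_gt0 gcdp_eq0 negb_and -!size_poly_eq0 /fi !size_sh.
  by case: tf => /ltnW; rewrite lt0n => ->.
rewrite leqNgt; apply: contra nij => sE; set E := gcdp _ _ in sE.
have Ei : E %| fi i by rewrite dvdp_gcdl.
have Ej : E %| fi j by rewrite dvdp_gcdr.
have tE : transl (sh (g i) E).
  split; first by rewrite size_sh.
  move=> k; apply: dvdp_trans (proj2 tf k); apply: dvdp_sh.
  by have := dvdp_sh (g i) Ei; rewrite /fi sh_sh subrr sh0.
have := minf tE; rewrite size_sh => hE.
have e k : E %| fi k -> E %= fi k.
  move=> h; have := dvdp_size_eqp h; rewrite eqn_leq dvdp_leq //=; last first.
    by rewrite /fi sh_eq0 -size_poly_gt0; case: tf => /ltnW.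
  by rewrite /fi size_sh hE => <-.
by apply: eqp_trans (e j Ej); rewrite eqp_sym e.
Qed.

(** Pairwise coprime divisors of R0 of positive degree: their product divides R0, so there are at
    most as many as its degree. *)
Lemma transl_card (J : finType) (sel : J -> I) :
  (forall x y, x != y -> ~~ (fi (sel x) %= fi (sel y))) -> (#|J| < size R0)%N.
Proof.
move=> hJ.
have key (s : seq J) : uniq s -> \prod_(x <- s) fi (sel x) %| R0 /\
    (size s < size (\prod_(x <- s) fi (sel x))%R)%N.
  elim: s => [|x s IH] /=; first by rewrite !big_nil dvd1p size_poly1.
  move=> /andP[xs us]; have [h1 h2] := IH us; rewrite !big_cons.
  have cop : coprimep (fi (sel x)) (\prod_(y <- s) fi (sel y)).
    elim: s xs us {IH h1 h2} => [|y s IH]; first by rewrite big_nil coprimep1.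
    rewrite inE negb_or /= => /andP[xy xs] /andP[_ us].
    by rewrite big_cons coprimepMr transl_coprime ?hJ // IH.
  split; first by rewrite Gauss_dvdp // h1 andbT; exact: (proj2 tf).
  have s1 : (1 < size (fi (sel x)))%N by rewrite /fi size_sh; case: tf.
  rewrite size_mul ?size_poly_gt0 -?size_poly_gt0 ?(ltnW s1) //; last exact: leq_ltn_trans h2.
  move: (size (fi (sel x))) (size (\prod_(y <- s) fi (sel y))) s1 h2 => a b; lia.
have [h1 h2] := key _ (enum_uniq J); rewrite -cardE in h2.
exact: leq_trans h2 (dvdp_leq R00 h1).
Qed.
End Min.

Lemma coef_XaddC_exp (A : comNzRingType) (c : A) n :
  [/\ size (('X + c%:P) ^+ n) = n.+1, (('X + c%:P) ^+ n)`_n = 1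
    & (('X + c%:P) ^+ n.+1)`_n = c *+ n.+1].
Proof.
have sz m : size (('X + c%:P) ^+ m) = m.+1.
  by rewrite -[c]opprK polyCN size_exp_XsubC.
have l m : (('X + c%:P) ^+ m)`_m = 1.
  elim: m => [|m IH]; first by rewrite expr0 coef1.
  rewrite exprS mulrDl coefD coefXM /= IH mul_polyC coefZ nth_default ?mulr0 ?addr0 //.
  by rewrite sz.
split=> //; elim: n => [|n IH]; first by rewrite expr1 coefD coefX coefC add0r.
rewrite exprS mulrDl coefD coefXM /= IH mul_polyC coefZ l mulr1.
by rewrite [RHS]mulrSr.
Qed.

Lemma coef_comp_XaddC (A : comNzRingType) (p : {poly A}) (c : A) e :
  size p = e.+2 -> (p \Po ('X + c%:P))`_e.+1 = p`_e.+1 /\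
  (p \Po ('X + c%:P))`_e = p`_e + p`_e.+1 * (c *+ e.+1).
Proof.
move=> sp; rewrite comp_polyE sp !coef_sum.
have t i k : (i < k)%N -> (('X + c%:P) ^+ i)`_k = 0.
  by have [h _ _] := coef_XaddC_exp c i => ik; rewrite nth_default // h.
have [_ h2 h3] := coef_XaddC_exp c e; have [_ h2' _] := coef_XaddC_exp c e.+1.
split; rewrite !big_ord_recr /= !coefZ ?h2 ?h2' ?h3 ?t // big1 ?add0r ?mulr0 ?add0r ?mulr1 //.
- by move=> i _; rewrite coefZ t ?mulr0 // ltnW // ltnS ltn_ord.
- by move=> i _; rewrite coefZ t ?mulr0 // ltn_ord.
Qed.

End Ideal.

(** * Stabilizer of a polynomial under translations *)

Lemma frac_step (F : fieldType) (k1 l1 b k0 l0 : F) : l1 != 0 -> l0 != 0 ->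
  (k1 + l1 * b) * l0 = k0 * l1 -> k1 / l1 = k0 / l0 - b.
Proof.
move=> h1 h0 E; apply: (mulIf h1); apply: (mulIf h0).
rewrite mulrVK ?unitfE // mulrBl mulrBl [_ / _ * _ * _]mulrAC mulrVK ?unitfE // -E.
by rewrite mulrDl [b * _]mulrC addrK.
Qed.

Section Stab.
Variable R : realFieldType.
Notation PP := {poly {poly R}}.
Variables (f : PP) (e : nat).
Hypothesis sf : size f = e.+2.
Let l := f`_e.+1.
Let k := f`_e.
Let s_ (a : R) (p : {poly R}) := p \Po ('X + a%:P).

Lemma size_mapcomp a : size (map_poly (comp_poly ('X + a%:P)) f) = e.+2.
Proof.
rewrite size_map_inj_poly ?raddf0 // => p q /(congr1 (comp_poly ('X - a%:P))).
by rewrite -!comp_polyA comp_polyD comp_polyX comp_polyC subrK !comp_polyXr.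
Qed.

(** The two highest coefficients in v of c1 sh (a, b) f = c2 f, after elimination of c1 and c2. With
    kappa = k / l the relation reads kappa(u + a) = kappa(u) - (e + 1) b. *)
Lemma stab_rel a b : sh (a, b) f %= f ->
  (s_ a k + s_ a l * (b *+ e.+1)%:P) * l = k * s_ a l.
Proof.
move=> /Pdiv.Idomain.eqpP[[c1 c2] /andP[/= c10 c20] E].
have [h1 h2] := coef_comp_XaddC (b%:P : {poly R}) (size_mapcomp a).
have E1 : c1 * s_ a l = c2 * l.
  have := congr1 (fun p : PP => p`_e.+1) E; rewrite !coefZ.
  by rewrite /sh /= h1 coef_map.
have E2 : c1 * (s_ a k + s_ a l * (b *+ e.+1)%:P) = c2 * k.
  have := congr1 (fun p : PP => p`_e) E; rewrite !coefZ.
  by rewrite /sh /= h2 !coef_map polyCMn.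
by apply: (mulfI c10); rewrite mulrA E2 mulrCA E1; ring.
Qed.

Variables (K : fieldType) (tfr : {rmorphism {poly R} -> K}).
Hypothesis tfr_inj : injective tfr.
Lemma tfr_eq0 p : (tfr p == 0) = (p == 0).
Proof. by rewrite -(inj_eq tfr_inj) rmorph0. Qed.

(** This is kappa(u + s) for kappa = k / l, with [K] in the place of R(u). An element of the
    stabilizer changes it by a constant. *)
Let kap (s : R) := tfr (s_ s k) / tfr (s_ s l).

Lemma l_neq0 : l != 0.
Proof. have : lead_coef f != 0 by rewrite lead_coef_eq0 -size_poly_eq0 sf.
by rewrite lead_coefE sf. Qed.

Lemma s_neq0 s : s_ s l != 0.
Proof. by rewrite comp_poly2_eq0 ?l_neq0 // size_XaddC. Qed.

Lemma kap_step a b s : sh (a, b) f %= f ->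
  kap (s + a) = kap s - tfr (b *+ e.+1)%:P.
Proof.
move=> /stab_rel /(congr1 (s_ s)).
have s_s p : s_ s (s_ a p) = s_ (s + a) p.
  by rewrite /s_ -comp_polyA comp_polyD comp_polyX comp_polyC -addrA -polyCD.
have s_M p q : s_ s (p * q) = s_ s p * s_ s q by rewrite /s_ comp_polyM.
have s_D p q : s_ s (p + q) = s_ s p + s_ s q by rewrite /s_ comp_polyD.
have s_C d : s_ s d%:P = d%:P by rewrite /s_ comp_polyC.
rewrite !(s_M, s_D) !s_s s_C => E.
have n1 : tfr (s_ s l) != 0 by rewrite tfr_eq0 s_neq0.
have n2 : tfr (s_ (s + a) l) != 0 by rewrite tfr_eq0 s_neq0.
apply: frac_step => //; have := congr1 tfr E.
by rewrite !(rmorphM, rmorphD).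
Qed.

Lemma kap_steps a b (n : nat) s : sh (a, b) f %= f ->
  kap (s + a *+ n) = kap s - tfr (b *+ e.+1 *+ n)%:P.
Proof.
move=> h; elim: n => [|n IH]; first by rewrite !mulr0n addr0 polyC0 rmorph0 subr0.
by rewrite mulrSr addrA (kap_step _ h) IH [in RHS]mulrSr polyCD rmorphD opprD addrA.
Qed.

Lemma kap_stepz a b (n : int) s : sh (a, b) f %= f ->
  kap (s + a *~ n) = kap s - tfr (b *+ e.+1 *~ n)%:P.
Proof.
move=> h; case: n => n; first exact: kap_steps.
rewrite !NegzE !mulrNz polyCN rmorphN opprK.
have := kap_steps n.+1 (s - a *~ n.+1) h; rewrite subrK => ->.
by rewrite subrK.
Qed.

(** The shift of u by a a' can be made in a' steps of the first translation or in a steps of the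
    second; the two resulting changes of kappa, proportional to a' b and a b', must agree. *)
Lemma stab_line (a a' : int) (b b' : R) :
  sh (a%:~R, b) f %= f -> sh (a'%:~R, b') f %= f -> a'%:~R * b = a%:~R * b'.
Proof.
move=> h h'; have := kap_stepz a 0 h'; have := kap_stepz a' 0 h.
rewrite !add0r -!mulrzA [(a' * a)%R]mulrC => -> /addrI /oppr_inj /tfr_inj /polyC_inj.
rewrite -(mulrzl (b *+ e.+1)) -(mulrzl (b' *+ e.+1)) -(mulr_natr b) -(mulr_natr b') => E.
apply: (mulIf (_ : (e.+1%:R : R) != 0)); first by rewrite pnatr_eq0.
by rewrite -!mulrA.
Qed.

Lemma stab_vertical (b : R) : sh (0, b) f %= f -> b = 0.
Proof.
move=> /(kap_step 0); rewrite addr0 => /eqP; rewrite -subr_eq0 opprD addrA subrr sub0r opprK.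
by rewrite tfr_eq0 polyC_eq0 mulrn_eq0 => /eqP.
Qed.
End Stab.

(** * Lattice points modulo the stabilizer *)

Section Lattice.
Variables (A B D t1 t2 t3 : nat) (St : int -> int -> Prop).
Hypothesis St_line : forall a b a' b', St a b -> St a' b' -> a' * b = a * b'.
Hypothesis St0 : forall b, St 0 b -> b = 0.
Hypothesis fam : forall (J : finType) (s : J -> nat * nat * nat),
  (forall x, [/\ ((s x).1.1 < t1)%N, ((s x).1.2 < t2)%N & ((s x).2 < t3)%N]) ->
  (forall x y, St ((s x).1.1%:Z - (s y).1.1%:Z - A%:Z * ((s x).2%:Z - (s y).2%:Z))
                  ((s x).1.2%:Z - (s y).1.2%:Z + B%:Z * ((s x).2%:Z - (s y).2%:Z)) -> x = y) ->
  (#|J| <= D)%N.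
Hypothesis t12 : (D < t1 * t2)%N.
Hypothesis t23 : (D < t2 * t3)%N.

Lemma dvdz_small (q a : int) : (q %| a)%Z -> `|a| < `|q| -> a = 0.
Proof.
move=> /dvdzP[k ->]; have [->|k0] := eqVneq k 0; first by rewrite mul0r.
rewrite normrM ltNge ler_peMl //.
by move: k0; rewrite -normr_gt0; lia.
Qed.

(** The t1 t2 > D points with s3 = 0 cannot be pairwise inequivalent. Two equivalent ones differ by
    a vector of the stabilizer, not vertical by [St0], and p / q is its slope in lowest terms. *)
Lemma line_eq : exists q p : int, [/\ 0 < q, coprimez p q, q < t1%:Z, `|p| < t2%:Z &
  forall a b, St a b -> q * b = p * a].
Proof.
have t3p : (0 < t3)%N by rewrite lt0n; apply: contraTneq t23 => ->; rewrite muln0.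
have [x [y [hxy St']]] : exists x y : 'I_t1 * 'I_t2, x <> y /\
   St ((x.1 : nat)%:Z - (y.1 : nat)%:Z) ((x.2 : nat)%:Z - (y.2 : nat)%:Z).
  apply: contrapT => H; move: t12; rewrite ltnNge => /negP; apply.
  have := @fam ('I_t1 * 'I_t2)%type (fun x => (x.1 : nat, x.2 : nat, 0%N)).
  rewrite card_prod !card_ord; apply => //= x y; rewrite subrr !mulr0 subr0 addr0 => hS.
  by apply: contrapT => xy; apply: H; exists x, y.
set d1 := _ - _ in St'; set d2 := (x.2 : nat)%:Z - _ in St'.
have d10 : d1 != 0.
  apply/eqP => d10; rewrite d10 in St'; have := St0 St'.
  rewrite /d2 => d20; apply: hxy; case: x y @d1 @d2 d10 d20 {St'} => x1 x2 [y1 y2] /= h1 h2.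
  by congr (_, _); apply: val_inj => /=; lia.
pose r : rat := d2%:~R / d1%:~R.
have E : d2 * denq r = numq r * d1.
  have := divq_num_den r; rewrite {3}/r => /eqP; rewrite eqr_div ?intr_eq0 ?denq_neq0 //.
  by rewrite -!intrM eqr_int => /eqP <-.
have cop : coprimez (numq r) (denq r) by rewrite /coprimez; exact: coprime_num_den.
have q0 : 0 < denq r by exact: denq_gt0.
have qd : (denq r %| d1)%Z.
  rewrite -(Gauss_dvdzr (n := numq r)) 1?coprimez_sym // -E; exact: dvdz_mull.
have pd : (numq r %| d2)%Z by rewrite -(Gauss_dvdzl _ cop) E; exact: dvdz_mulr.
have b1 : `|d1| < t1%:Z by rewrite /d1; have := ltn_ord x.1; have := ltn_ord y.1; lia.
have b2 : `|d2| < t2%:Z by rewrite /d2; have := ltn_ord x.2; have := ltn_ord y.2; lia.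
exists (denq r), (numq r); split=> //.
- apply: le_lt_trans b1; rewrite leNgt; apply/negP => h.
  by move: d10; rewrite (dvdz_small qd) ?eqxx // (gtr0_norm q0).
- apply: le_lt_trans b2; rewrite leNgt; apply/negP => h.
  have d20 := dvdz_small pd h.
  have : numq r * d1 = 0 by rewrite -E d20 mul0r.
  by move=> /eqP; rewrite mulf_eq0 (negPf d10) orbF => /eqP n0; rewrite n0 normr0 d20 in h.
- move=> a b /(St_line St') h; apply: (mulfI d10).
  have -> : d1 * (denq r * b) = denq r * (d1 * b) by ring.
  have -> : d1 * (numq r * a) = (numq r * d1) * a by ring.
  by rewrite -h -E; ring.
Qed.

(** Each bound comes from a sub-box whose points are pairwise inequivalent because its sides are too
    short for the divisibilities imposed by q b = p a: sides q and t2, then t1 and |p|, and a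
    three-dimensional box for r0. *)
Lemma lattice_classes : exists (q : nat) (p r0 : int), [/\ (0 < q)%N,
  q%:Z * B%:Z + p * A%:Z = r0, (q * t2 <= D)%N, (`|p| * t1 <= D)%N & (`|r0| * t3 <= D)%N].
Proof.
have t3p : (0 < t3)%N by rewrite lt0n; apply: contraTneq t23 => ->; rewrite muln0.
have [q' [p [q0' cop qt pt L]]] := line_eq.
have [q qE] : exists q : nat, q' = q%:Z by exists `|q'|%N; lia.
subst q'; exists q, p, (q%:Z * B%:Z + p * A%:Z); split=> //.
- have := @fam ('I_q * 'I_t2)%type (fun x => (x.1 : nat, x.2 : nat, 0%N)).
  rewrite card_prod !card_ord; apply => /=.
    by move=> x; split=> //; have := ltn_ord x.1; lia.
  move=> [x1 x2] [y1 y2] /=; rewrite subrr !mulr0 subr0 addr0 => /L E.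
  have h : (q%:Z %| (x1 : nat)%:Z - (y1 : nat)%:Z)%Z.
    rewrite -(Gauss_dvdzr (n := p)) 1?coprimez_sym // -E; exact: dvdz_mulr.
  have h0 := dvdz_small h; have := ltn_ord x1; have := ltn_ord y1 => hy hx.
  have {}h0 : (x1 : nat)%:Z - (y1 : nat)%:Z = 0 by apply: h0; lia.
  rewrite h0 mulr0 in E; have /eqP := E; rewrite mulf_eq0 => /orP[/eqP|/eqP E2]; first by lia.
  by congr (_, _); apply: val_inj => /=; lia.
- have [->|p0] := eqVneq p 0; first by rewrite absz0.
  have := @fam ('I_(`|p|) * 'I_t1)%type (fun x => (x.2 : nat, x.1 : nat, 0%N)).
  rewrite card_prod !card_ord; apply => /=.
    by move=> x; split=> //; have := ltn_ord x.1; lia.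
  move=> [x1 x2] [y1 y2] /=; rewrite subrr !mulr0 subr0 addr0 => /L E.
  have h : (p %| (x1 : nat)%:Z - (y1 : nat)%:Z)%Z.
    rewrite -(Gauss_dvdzr (n := q)) // E; exact: dvdz_mulr.
  have h0 := dvdz_small h; have := ltn_ord x1; have := ltn_ord y1 => hy hx.
  have {}h0 : (x1 : nat)%:Z - (y1 : nat)%:Z = 0 by apply: h0; lia.
  rewrite h0 mulr0 in E; have /esym/eqP := E; rewrite mulf_eq0 (negPf p0) /= => /eqP E2.
  by congr (_, _); apply: val_inj => /=; lia.
- set r0 := _ + _; have [->|r00] := eqVneq r0 0; first by rewrite absz0.
  pose g := gcdn q `|r0|; pose m := minn t2 (`|r0| %/ g).
  (* For differences x1, x2, x3 of coordinates equivalence reads q x2 + r0 x3 = p x1. As g divides q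
     and r0 and is prime to p, a side g forces x1 = 0; then |r0| / g divides x2, so a side at most
     |r0| / g forces x2 = 0. If the cut at t2 in [m] were effective, t2 t3 would be at most D. *)
  have gq : (g %| q)%N by exact: dvdn_gcdl.
  have gr : (g %| `|r0|)%N by exact: dvdn_gcdr.
  have gp : (0 < g)%N by rewrite gcdn_gt0; lia.
  have gleq : (g <= q)%N by apply: dvdn_leq => //; lia.
  have := @fam ('I_g * 'I_m * 'I_t3)%type (fun x => (x.1.1 : nat, x.1.2 : nat, x.2 : nat)).
  rewrite !card_prod !card_ord => H.
  have {}H : (g * m * t3 <= D)%N.
    apply: H => /=.
      move=> x; split=> //; first by have := ltn_ord x.1.1; lia.
      by have := ltn_ord x.1.2; rewrite /m; lia.
    move=> [[x1 x2] x3] [[y1 y2] y3] /= /L.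
    move=> E; have E' : q%:Z * (x2%:Z - y2%:Z) + r0 * (x3%:Z - y3%:Z) = p * (x1%:Z - y1%:Z).
      by move/eqP: E; rewrite /r0 -subr_eq0 => /eqP E; apply/eqP; rewrite -subr_eq0 -[X in _ == X]E; apply/eqP; ring.
    have gqz : (g%:Z %| q%:Z)%Z by rewrite dvdzE.
    have grz : (g%:Z %| r0)%Z by rewrite dvdzE.
    have h1 : (g%:Z %| x1%:Z - y1%:Z)%Z.
      rewrite -(Gauss_dvdzr (n := p)); last first.
        by rewrite coprimez_sym; apply: coprimez_dvdr cop.
      by rewrite -E'; apply: rpredD; apply: dvdz_mulr.
    have e1 : x1%:Z - y1%:Z = 0.
      by apply: dvdz_small h1 _; have := ltn_ord x1; have := ltn_ord y1; lia.
    rewrite e1 mulr0 in E'.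
    have [q1 q1E] := dvdzP gqz; have [r1 r1E] := dvdzP grz.
    have gz0 : g%:Z != 0 :> int by lia.
    have E2 : q1 * (x2%:Z - y2%:Z) + r1 * (x3%:Z - y3%:Z) = 0.
      by apply: (mulIf gz0); rewrite mul0r -E' [in RHS]q1E r1E; ring.
    have cop1 : coprimez r1 q1.
      rewrite /coprimez; have : gcdz r0 q%:Z = g by rewrite /gcdz /= gcdnC.
      rewrite r1E q1E -mulz_gcdl absz_nat => h; apply/eqP/(mulIf gz0); rewrite mul1r.
      exact: h.
    have h2 : (r1 %| x2%:Z - y2%:Z)%Z.
      rewrite -(Gauss_dvdzr (n := q1)) //; apply/dvdzP; exists (- (x3%:Z - y3%:Z)).
      by move/eqP: E2; rewrite addr_eq0 => /eqP ->; ring.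
    have r1n : `|r1|%N = (`|r0| %/ g)%N by rewrite r1E abszM mulnK.
    have e2 : x2%:Z - y2%:Z = 0.
      by apply: dvdz_small h2 _; have := ltn_ord x2; have := ltn_ord y2; rewrite /m; lia.
    rewrite e2 mulr0 add0r in E2; have r10 : r1 != 0.
      by apply/eqP => r10; rewrite r10 mul0r in r1E; rewrite r1E eqxx in r00.
    have /eqP := E2; rewrite mulf_eq0 (negPf r10) /= => /eqP e3.
    move: e1 e2 e3; clear => e1 e2 e3.
    by congr (_, _, _); apply: val_inj => /=; lia.
  rewrite /m in H; have [h|h] := leqP t2 (`|r0| %/ g).
    move: H; rewrite (minn_idPl h) -mulnA => H; move: t23; rewrite ltnNge => /negP[].
    exact: leq_trans (leq_pmull _ gp) H.
  move: H; rewrite (minn_idPr (ltnW h)) mulnC [(g * _)%N]mulnC divnK //.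
  by rewrite mulnC.
Qed.
End Lattice.

(** * Zeros of a polynomial on a box of points *)

Section Plane.
Variable R : realFieldType.
Notation PP := {poly {poly R}}.

Lemma tofrac_inj (A : idomainType) : injective (@FracField.tofrac A).
Proof. by move=> x y /eqP; rewrite tofrac_eq => /eqP. Qed.

Lemma size_coef_sh g (P : PP) D : (forall k, (size (P`_k)%R <= D.+1)%N) ->
  forall k, (size ((sh g P)`_k)%R <= D.+1)%N.
Proof.
move=> hP k; rewrite /sh comp_polyE coef_sum.
apply: leq_trans (size_sum _ _ _) _; apply/bigmax_leqP => i _.
have -> : 'X + g.2%:P%:P = map_poly (@polyC R) ('X + g.2%:P).
  by rewrite rmorphD /= map_polyX map_polyC.
rewrite -rmorphXn coefZ !coef_map /= mulrC mul_polyC.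
apply: leq_trans (size_scale_leq _ _) _.
by rewrite size_comp_poly2 ?size_XaddC.
Qed.

Variables (P : PP) (A B D t1 t2 t3 p1 p2 p3 : nat) (o1 o2 : R).
Hypothesis P0 : P != 0.
Hypothesis sP : (size P <= D.+1)%N.
Hypothesis sPu : forall k, (size (P`_k)%R <= D.+1)%N.
Hypothesis zeros : forall s1 s2 s3 : nat, (s1 < t1 + p1)%N -> (s2 < t2 + p2)%N ->
  (s3 < t3 + p3)%N ->
  ev2 P (o1 + s1%:R - A%:R * s3%:R) (o2 + s2%:R + B%:R * s3%:R) = 0.
Hypothesis p1A : (p1 <= A)%N.
Hypothesis p20 : (0 < p2)%N.
Hypothesis p13 : (D < p1 * p3)%N.
Hypothesis p123 : (2 * D * D < p1 * p3 * p2)%N.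
Hypothesis t12 : (D < t1 * t2)%N.
Hypothesis t23 : (D < t2 * t3)%N.

(** The sides t + p of the box of zeros are shared: the t part indexes the translates of P, the p
    part is left for their common zeros. These are the abscissae of the latter, distinct because s1
    < p1 <= A. *)
Let us : seq R := [seq o1 + (s1 : nat)%:R - A%:R * (s3 : nat)%:R | s1 <- iota 0 p1, s3 <- iota 0 p3].

Lemma abscissae_uniq : uniq us.
Proof.
apply: allpairs_uniq; rewrite ?iota_uniq // => -[s1 s3] [s1' s3'] /allpairsP[[x y] /= [hx hy [-> ->]]].
move=> /allpairsP[[x' y'] /= [hx' hy' [-> ->]]] {s1 s3 s1' s3'} /=.
rewrite !mem_iota /= !add0n in hx hy hx' hy'.
move=> E; have {}E : (x + A * y' = x' + A * y)%N.
  by apply/eqP; rewrite -(eqr_nat R) !natrD !natrM; apply/eqP; lra.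
have [e|e] : (y = y' \/ y != y')%N by case: eqP => h; [left|right].
  by subst y'; congr (_, _); lia.
by exfalso; move: E hx hx' p1A e; clear; nia.
Qed.

Lemma size_us : size us = (p1 * p3)%N.
Proof. by rewrite size_allpairs !size_iota. Qed.

Let I : finType := ('I_t1 * 'I_t2 * 'I_t3)%type.
Let g (i : I) : R * R :=
  ((i.1.1 : nat)%:R - A%:R * (i.2 : nat)%:R, (i.1.2 : nat)%:R + B%:R * (i.2 : nat)%:R).

Lemma exists_w : exists w : R -> R, forall u (i : I) j, u \in us -> (j < p2)%N ->
  ev2 (sh (g i) P) u (w u + j%:R) = 0.
Proof.
have : forall u, exists w, u \in us -> forall (i : I) j, (j < p2)%N ->
   ev2 (sh (g i) P) u (w + j%:R) = 0.
  move=> u; have [/allpairsP[[x y] /= [hx hy ->]]|] := boolP (u \in us); last by exists 0.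
  exists (o2 + B%:R * y%:R) => _ i j jp; rewrite ev2_sh.
  rewrite !mem_iota /= !add0n in hx hy.
  rewrite -[RHS](@zeros (i.1.1 + x) (i.1.2 + j) (i.2 + y)).
  - by congr (ev2 P _ _); rewrite /= !natrD; ring.
  - by have := ltn_ord i.1.1; lia.
  - by have := ltn_ord i.1.2; lia.
  - by have := ltn_ord i.2; lia.
by move=> /choice[w hw]; exists w => u i j uu jp; apply: hw.
Qed.

(** Otherwise a translate of P would vanish identically on p1 p3 > D vertical lines and be zero. The
    bound lets the p2 nodes above an abscissa fit into the columns of the square minor in
    [zero_count]. *)
Lemma p2_small : (p2 <= (size P).-1 + (size P).-1)%N.
Proof.
have [w hw] := exists_w.
have t1p : (0 < t1)%N by rewrite lt0n; apply: contraTneq t12 => ->; rewrite mul0n.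
have t2p : (0 < t2)%N by rewrite lt0n; apply: contraTneq t23 => ->; rewrite mul0n.
have t3p : (0 < t3)%N by rewrite lt0n; apply: contraTneq t23 => ->; rewrite muln0.
pose i0 : I := (Ordinal t1p, Ordinal t2p, Ordinal t3p).
pose P0' := sh (g i0) P.
have P00 : P0' != 0 by rewrite sh_eq0.
rewrite leqNgt; apply/negP => hp.
case/negP: P00; apply/eqP/polyP => k; rewrite coef0.
have rt u : u \in us -> (P0'`_k).[u] = 0.
  move=> uu; pose Q := map_poly (horner_eval u) P0'.
  have Q0 : Q = 0.
    apply: (@roots_geq_poly_eq0 _ _ [seq w u + (j : nat)%:R | j <- iota 0 p2]).
    - apply/allP => x /mapP[j]; rewrite mem_iota /= add0n => jp ->.
      have := hw u i0 j uu jp; rewrite /ev2 -/P0' -[_.[u]]/(horner_eval u _) -horner_map /=.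
      by rewrite /horner_eval hornerC rootE => ->.
    - by rewrite map_inj_uniq ?iota_uniq // => x y /addrI /eqP; rewrite eqr_nat => /eqP.
    - rewrite size_map size_iota; apply: leq_trans (size_poly _ _) _.
      rewrite size_sh; have : (0 < size P)%N by rewrite size_poly_gt0.
      by move: hp; lia.
  by have := coef_map (horner_eval u) P0' k; rewrite -/Q Q0 coef0 => /esym.
apply: (@roots_geq_poly_eq0 _ _ us) abscissae_uniq _.
  by apply/allP => u /rt h; rewrite rootE h.
rewrite size_us; apply: leq_trans p13; exact: size_coef_sh.
Qed.

(* Let G be a polynomial of least degree in v in the ideal of the translates of P over R(u).
   If G does not involve v, elimination bounds the number of zeros.  Otherwise G divides
   every translate of P, hence has few distinct translates, and the stabilizer of G is
   large while it is contained in a line. *)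
Theorem plane_zero_estimate : exists (q : nat) (p r0 : int), [/\ (0 < q)%N,
  q%:Z * B%:Z + p * A%:Z = r0, (q * t2 <= D)%N, (`|p| * t1 <= D)%N & (`|r0| * t3 <= D)%N].
Proof.
have t1p : (0 < t1)%N by rewrite lt0n; apply: contraTneq t12 => ->; rewrite mul0n.
have t2p : (0 < t2)%N by rewrite lt0n; apply: contraTneq t23 => ->; rewrite mul0n.
have t3p : (0 < t3)%N by rewrite lt0n; apply: contraTneq t23 => ->; rewrite muln0.
pose i0 : I := (Ordinal t1p, Ordinal t2p, Ordinal t3p).
pose Rg i := sh (g i) P.
have P00 : Rg i0 != 0 by rewrite sh_eq0.
have sP0 : (0 < size P)%N by rewrite size_poly_gt0.
have [G [G0 [Ac GE] Gd]] := ideal_min P00.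
have [G1|G1] := leqP (size G) 1.
  have [w hw] := exists_w.
  pose D0 := (size P).-1.
  have GC : G = (G`_0)%:P by exact: size1_polyC.
  have c0 : G`_0 != 0 by apply: contraNneq G0 => h; rewrite GC h.
  have := @zero_count R I Rg i0 D0 D p2 _ _ _ _ _ c0 _ us w abscissae_uniq p2_small _.
  rewrite size_us => H; exfalso.
  have {}H : (p1 * p3 * p2 <= (D0 + D0) * D)%N.
    apply: (H _ _ _ Ac).
    - by rewrite size_sh prednK.
    - by move=> i; rewrite size_sh prednK.
    - by move=> i; apply: size_coef_sh.
    - by rewrite -GE.
    - by move=> u i j uu jp; apply: hw.
  have D0D : (D0 <= D)%N by rewrite /D0; lia.
  by have := leq_trans p123 H; rewrite leqNgt ltnS -mulnA mul2n -addnn -mulnDl leq_mul2r leq_add ?orbT.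
have tG : transl g P G.
  by split=> // i; have := dvdp_sh (- g i) (Gd i); rewrite /Rg sh_sh addNr sh0.
have [f [tf minf]] := ex_min_size (ex_intro _ G tG).
have [e se] : exists e, size f = e.+2 by case: tf => h _; exists (size f).-2; lia.
pose St (a b : int) : Prop := sh (a%:~R, b%:~R) f %= f.
apply: (@lattice_classes A B D t1 t2 t3 St).
- move=> a b a' b' h h'; have := stab_line se (@tofrac_inj _) h h'.
  by rewrite -!intrM => /eqP; rewrite eqr_int => /eqP.
- move=> b /(stab_vertical se (@tofrac_inj _)) /eqP; rewrite intr_eq0 => /eqP //.
- move=> J s sB sSt.
  pose sel (x : J) : I := let: And3 h1 h2 h3 := sB x in (Ordinal h1, Ordinal h2, Ordinal h3).
  have selE x : [/\ (sel x).1.1 = (s x).1.1 :> nat, (sel x).1.2 = (s x).1.2 :> nat & (sel x).2 = (s x).2 :> nat].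
    by rewrite /sel; case: (sB x).
  rewrite -ltnS; apply: leq_trans sP; apply: (transl_card P0 tf minf (sel := sel)) => x y.
  apply: contra_neqN => E; apply: sSt; rewrite /St.
  have := eqp_sh (g (sel x)) E; rewrite !sh_sh subrr sh0 eqp_sym.
  have [x1 x2 x3] := selE x; have [y1 y2 y3] := selE y.
  congr (sh _ f %= f); rewrite /g x1 x2 x3 y1 y2 y3.
  by congr (_, _); rewrite /= !(rmorphB, rmorphD, rmorphM) /= ?natz; ring.
- exact: t12.
- exact: t23.
Qed.
End Plane.

(** The form in which zero estimates are applied: if only the trivial combination of the monomials
    vanishes at all the points, some choice of points gives a nonzero determinant. *)
Lemma minor_exists (F : fieldType) (rT C : finType) (f : rT -> C -> F) :
  (forall w : rT -> F, (forall c, \sum_i w i * f i c = 0) -> forall i, w i = 0) ->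
  exists sel : 'I_#|rT| -> C, \det (\matrix_(i, j < #|rT|) f (enum_val i) (sel j)) != 0.
Proof.
move=> h.
pose N := \matrix_(i < #|rT|, c < #|C|) f (enum_val i) (enum_val c).
have fr : row_free N.
  apply/row_freeP; have /row_freeP // : row_free N.
  rewrite -kermx_eq0; apply/rowV0P => v /sub_kermxP vN.
  apply/rowP => i; rewrite mxE -[i](enum_valK).
  apply: (h (fun x => v 0 (enum_rank x))) => c.
  have := congr1 (fun M : 'M_(1, #|C|) => M 0 (enum_rank c)) vN; rewrite !mxE => E.
  rewrite -[RHS]E (reindex_onto (@enum_val _ _) enum_rank) /=; last by move=> j _; rewrite enum_rankK.
  rewrite (eq_bigl xpredT) => [|j]; last by rewrite enum_valK eqxx.
  by apply: eq_bigr => j _; rewrite enum_valK !mxE enum_rankK.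
have full : row_full N^T by rewrite /row_full mxrank_tr; exact: fr.
exists (fun j => enum_val (fullrankfun full j)).
have := fullrowsub_unit full; rewrite unitmxE unitfE -det_tr.
by congr (\det _ != 0); apply/matrixP => i j; rewrite !mxE.
Qed.

(** * Elimination of X by Casorati determinants *)

Section Inner.
Variable R : realFieldType.
Notation PP := {poly {poly R}}.
Definition innerle d (P : PP) := forall k, (size (P`_k)%R <= d.+1)%N.

Lemma innerleM d e P Q : innerle d P -> innerle e Q -> innerle (d + e) (P * Q).
Proof.
move=> hP hQ k; rewrite coefM; apply: leq_trans (size_sum _ _ _) _.
apply/bigmax_leqP => i _; apply: leq_trans (size_polyMleq _ _) _.
move: (hP i) (hQ (k - i)%N); move: (size _) (size _) => a b; lia.
Qed.

Lemma innerle_sum d (I : Type) (s : seq I) (F : I -> PP) :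
  (forall i, innerle d (F i)) -> innerle d (\sum_(i <- s) F i).
Proof.
move=> h; elim: s => [|i s IH] k; first by rewrite big_nil coef0 size_poly0.
rewrite big_cons coefD; apply: leq_trans (size_polyD _ _) _.
by rewrite geq_max h IH.
Qed.

Lemma innerle_prod d (I : Type) (s : seq I) (F : I -> PP) :
  (forall i, innerle d (F i)) -> innerle (size s * d) (\prod_(i <- s) F i).
Proof.
move=> h; elim: s => [|i s IH].
  by rewrite big_nil => k; rewrite coef1; case: (k == 0%N); rewrite ?size_poly1 ?size_poly0.
by rewrite big_cons /= mulSn; apply: innerleM.
Qed.

Lemma innerle_det d n (M : 'M[PP]_n) : (forall i j, innerle d (M i j)) -> innerle (n * d) (\det M).
Proof.
move=> h; rewrite /determinant; apply: innerle_sum => s.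
rewrite -[(n * d)%N]add0n; apply: innerleM.
  have -> : (-1) ^+ s = ((-1) ^+ s)%:P%:P :> PP by rewrite !rmorph_sign.
  by move=> k; rewrite coefC; case: (k == 0%N); rewrite ?size_poly0 ?size_polyC_leq1.
have := innerle_prod (index_enum 'I_n) (fun i => h i (s i)).
by rewrite [size _](_ : _ = n) // -[RHS](card_ord n) cardT enumT.
Qed.

Lemma lead_sh0 b (P : PP) : lead_coef (sh (0, b) P) = lead_coef P.
Proof.
rewrite /sh lead_coef_comp ?size_XaddC // lead_coefXaddC expr1n mulr1 /= addr0.
congr lead_coef; rewrite map_poly_id // => p _; exact: comp_polyXr.
Qed.

Section Casorati.
Variables (L K1 K2 : nat) (Q : 'I_L -> PP) (xi : R).
Hypothesis xi0 : 0 < xi.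
Hypothesis xi1 : xi != 1.
Hypothesis Qn0 : exists m, Q m != 0.
Hypothesis sQ : forall m, (size (Q m) <= K2.+1)%N.
Hypothesis iQ : forall m, innerle K1 (Q m).

Let J := [pred m | Q m != 0].
Let n := #|J|.
Let e (a : 'I_n) : 'I_L := enum_val a.
Let W : 'M[PP]_n := \matrix_(k, a) (sh (0, (k : nat)%:R) (Q (e a)) * (xi ^+ (k * e a))%:P%:P).

(* A polynomial in X vanishing at X, xi X, xi^2 X, ... makes the matrix W of its shifted
   coefficients singular; det W is not zero because its leading coefficient in v is a
   Vandermonde determinant in the powers of xi. *)
Lemma casorati : exists P : PP, [/\ P != 0, (size P <= (L * K2).+1)%N, innerle (L * K1) P &
  forall u v X, X != 0 ->
    (forall k, (k < L)%N -> \sum_m ev2 (Q m) u (v + k%:R) * (xi ^+ k * X) ^+ m = 0) ->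
    ev2 P u v = 0].
Proof.
have nL : (n <= L)%N by rewrite /n -[X in (_ <= X)%N]card_ord max_card.
have Qe a : Q (e a) != 0 by have := enum_valP a.
pose d (a : 'I_n) := (size (Q (e a))).-1.
have sW i j : (size (W i j) <= (d j).+1)%N.
  rewrite mxE mulrC mul_polyC; apply: leq_trans (size_scale_leq _ _) _.
  by rewrite size_sh /d prednK // size_poly_gt0.
have [s1 s2] := size_coef_det sW.
exists (\det W); split.
- suff : (\det W)`_(\sum_j d j) != 0 by apply: contraNneq => ->; rewrite coef0.
  rewrite s2.
  have -> : \matrix_(i, j) (W i j)`_(d j) =
     map_mx (@polyC R) (\matrix_(i < n, j < n) (xi ^+ e j) ^+ i)
       *m diag_mx (\row_j lead_coef (Q (e j))).
    apply/matrixP => i j; rewrite mul_mx_diag !mxE coefMC -exprM mulnC mulrC.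
    congr (_ * _); rewrite -(lead_sh0 (i : nat)%:R) lead_coefE size_sh.
    by [].
  rewrite det_mulmx det_diag det_map_mx mulf_neq0 //.
    by rewrite polyC_eq0 det_Vandermonde_neq0 // => x y /(ieexprIn xi0 xi1) /val_inj /enum_val_inj.
  by apply/prodf_neq0 => j _; rewrite mxE lead_coef_eq0.
- apply: leq_trans s1 _; rewrite ltnS.
  apply: (@leq_trans (\sum_(j < n) K2)).
    by apply: leq_sum => j _; rewrite /d; have := sQ (e j); lia.
  by rewrite sum_nat_const card_ord leq_mul2r nL orbT.
- move=> k; apply: leq_trans (innerle_det (d := K1) _ k) _.
    move=> i j; rewrite mxE -[K1]addn0; apply: innerleM.
      by move=> k'; apply: size_coef_sh; apply: iQ.
    by move=> k'; rewrite coefC; case: (k' == 0%N); rewrite ?size_poly0 ?size_polyC_leq1.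
  by rewrite ltnS leq_mul2r nL orbT.
- move=> u v X X0 hz.
  pose ev : {rmorphism PP -> R} := horner_eval u \o horner_eval v%:P.
  have -> : ev2 (\det W) u v = \det (map_mx ev W) by rewrite det_map_mx.
  apply/eqP; rewrite -det_tr; apply/det0P; exists (\row_a X ^+ e a).
    have [m0 Qm0] := Qn0.
    have hm0 : m0 \in J by [].
    apply/negP => /eqP /rowP /(_ (enum_rank_in hm0 m0)); rewrite !mxE => /eqP.
    by rewrite expf_eq0 (negPf X0) andbF.
  apply/rowP => k; rewrite !mxE.
  have := hz k (leq_trans (ltn_ord k) nL); rewrite (bigID J) /= [X in _ + X]big1 ?addr0.
    move=> E; rewrite -[RHS]E [RHS](big_enum_val (A := J)) /=.
    apply: eq_bigr => a _; rewrite !mxE /ev /= /horner_eval hornerM hornerM !hornerC.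
    rewrite -/(ev2 _ u v) ev2_sh /= addr0 exprMn -exprM.
    by rewrite mulrC -mulrA.
  by move=> m /negPn /eqP ->; rewrite /ev2 !horner0 mul0r.
Qed.
End Casorati.
End Inner.

Section ZeroEstimates.
Variable R : realFieldType.
Variables (k1 k2 L : nat).
Definition rowT : finType := ('I_k1.+1 * 'I_k2.+1 * 'I_L)%type.
Notation PP := {poly {poly R}}.
Definition rowfun (i : rowT) (u v X : R) := u ^+ i.1.1 * v ^+ i.1.2 * X ^+ i.2.

Definition rowpoly (w : rowT -> R) (m : 'I_L) : PP :=
  \poly_(j < k2.+1) \poly_(i < k1.+1) w (inord i, inord j, m).

Lemma ev2_rowpoly w m u v :
  ev2 (rowpoly w m) u v = \sum_(ij : 'I_k1.+1 * 'I_k2.+1) w (ij, m) * (u ^+ ij.1 * v ^+ ij.2).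
Proof.
rewrite /ev2 horner_poly horner_sum.
transitivity (\sum_(i < k1.+1) \sum_(j < k2.+1) w ((i, j), m) * (u ^+ i * v ^+ j)); last first.
  by rewrite pair_bigA; apply: eq_bigr => -[].
rewrite exchange_big; apply: eq_bigr => j _ /=; rewrite -rmorphXn hornerM hornerC horner_poly mulr_suml.
by apply: eq_bigr => i _; rewrite !inord_val mulrA.
Qed.

Lemma rowfun_sum w u v X :
  \sum_i w i * rowfun i u v X = \sum_m ev2 (rowpoly w m) u v * X ^+ m.
Proof.
transitivity (\sum_(ij : 'I_k1.+1 * 'I_k2.+1) \sum_(m < L) w (ij, m) * rowfun (ij, m) u v X).
  by rewrite pair_bigA; apply: eq_bigr => -[].
rewrite exchange_big; apply: eq_bigr => m _; rewrite ev2_rowpoly mulr_suml.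
by apply: eq_bigr => ij _; rewrite /rowfun /= !mulrA.
Qed.

Lemma rowpoly_eq0 w : (forall m, rowpoly w m = 0) -> forall i, w i = 0.
Proof.
move=> h [[i j] m]; have := congr1 (fun p : PP => p`_j`_i) (h m).
by rewrite !coef_poly !ltn_ord coef_poly ltn_ord !inord_val !coef0.
Qed.

Lemma rowpoly_casorati w xi : 0 < xi -> xi != 1 -> (exists i, w i != 0) ->
  exists P : PP, [/\ P != 0, (size P <= (L * k2).+1)%N, innerle (L * k1) P &
  forall u v X, X != 0 ->
    (forall k, (k < L)%N -> \sum_i w i * rowfun i u (v + k%:R) (xi ^+ k * X) = 0) ->
    ev2 P u v = 0].
Proof.
move=> x0 x1 [i wi].
have [|||P [h1 h2 h3 h4]] := @casorati R L k1 k2 (rowpoly w) xi x0 x1.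
- apply: contrapT => H; case/eqP: wi; apply: rowpoly_eq0 => m; apply: contrapT => Hm.
  by apply: H; exists m; apply/eqP.
- by move=> m; apply: size_poly.
- move=> m k; rewrite coef_poly; case: ifP => _; rewrite ?size_poly0 //; exact: size_poly.
exists P; split=> // u v X X0 hz; apply: (h4 u v X) => // k kL.
by rewrite -rowfun_sum hz.
Qed.
End ZeroEstimates.

Section Zero3.
Variable R : realFieldType.
Variables (k L A B N1 N2 N3 t1 t2 t3 p1 p2 p3 : nat) (o1 o2 xi : R) (X : nat -> nat -> nat -> R).
Hypothesis xi0 : 0 < xi.
Hypothesis xi1 : xi != 1.
Hypothesis X0 : forall s1 s2 s3, X s1 s2 s3 != 0.
Hypothesis X2 : forall s1 s2 s3 j, X s1 (s2 + j)%N s3 = xi ^+ j * X s1 s2 s3.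
Let D := (L * k)%N.
Hypothesis n1 : (t1 + p1 <= N1)%N.
Hypothesis n2 : (t2 + p2 + L <= N2)%N.
Hypothesis n3 : (t3 + p3 <= N3)%N.
Hypothesis p1A : (p1 <= A)%N.
Hypothesis p20 : (0 < p2)%N.
Hypothesis p13 : (D < p1 * p3)%N.
Hypothesis p123 : (2 * D * D < p1 * p3 * p2)%N.
Hypothesis t12 : (D < t1 * t2)%N.
Hypothesis t23 : (D < t2 * t3)%N.

(** A unit step in s2 fixes u, raises v by 1 and multiplies X by xi, as [casorati] demands. This
    consumes L of the N2 values of s2; the remaining box is handed to the plane estimate with D = L
    k. *)
Lemma zero_estimate_three (w : rowT k k L -> R) :
  (forall s1 s2 s3, (s1 < N1)%N -> (s2 < N2)%N -> (s3 < N3)%N ->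
    \sum_i w i * rowfun i (o1 + s1%:R - A%:R * s3%:R) (o2 + s2%:R + B%:R * s3%:R) (X s1 s2 s3) = 0) ->
  (forall i, w i = 0) \/
  exists (q : nat) (p r0 : int), [/\ (0 < q)%N,
  q%:Z * B%:Z + p * A%:Z = r0, (q * t2 <= D)%N, (`|p| * t1 <= D)%N & (`|r0| * t3 <= D)%N].
Proof.
move=> hz; have [h|h] := pselect (forall i, w i = 0); [by left|right].
have {}h : exists i, w i != 0.
  apply: contrapT => H; apply: h => i; apply: contrapT => /eqP Hi.
  by apply: H; exists i.
have [P [h1 h2 h3 h4]] := rowpoly_casorati xi0 xi1 h.
apply: (@plane_zero_estimate R P A B D t1 t2 t3 p1 p2 p3 o1 o2) => //.
move=> s1 s2 s3 b1 b2 b3; apply: (h4 _ _ (X s1 s2 s3)) => // j jL.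
rewrite -X2 -[RHS](hz s1 (s2 + j)%N s3); last 3 first.
- exact: leq_trans b1 n1.
- by move: n2 b2 jL; clear; lia.
- exact: leq_trans b3 n3.
apply: eq_bigr => i _; congr (w i * rowfun i _ _ _).
by rewrite natrD; ring.
Qed.
End Zero3.

Section Zero2.
Variable R : realFieldType.
Variables (k L B N1 N2 : nat) (o2 xi : R) (X : nat -> nat -> R).
Hypothesis xi0 : 0 < xi.
Hypothesis xi1 : xi != 1.
Hypothesis X0 : forall s1 s2, X s1 s2 != 0.
Hypothesis X2 : forall s1 s2 j, X s1 (s2 + j)%N = xi ^+ j * X s1 s2.
Hypothesis N2B : (N2 <= B)%N.
Hypothesis N12 : (L * k < N1 * (N2 - L))%N.

(** With degree 0 in u the polynomial produced by [casorati] depends on v alone, and counting its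
    roots replaces the plane estimate. The ordinates are distinct because s2 < N2 <= B. *)
Lemma zero_estimate_two (w : rowT 0 k L -> R) (u : R) :
  (forall s1 s2, (s1 < N1)%N -> (s2 < N2)%N ->
    \sum_i w i * rowfun i u (o2 + s2%:R - B%:R * s1%:R) (X s1 s2) = 0) ->
  forall i, w i = 0.
Proof.
move=> hz; apply: contrapT => h.
have {}h : exists i, w i != 0.
  apply: contrapT => H; apply: h => i; apply: contrapT => /eqP Hi.
  by apply: H; exists i.
have [P [h1 h2 h3 h4]] := rowpoly_casorati xi0 xi1 h.
case/eqP: h1; apply/polyP => j; rewrite coef0.
have PE : P`_j = ((P`_j)`_0)%:P by apply: size1_polyC; have := h3 j; rewrite muln0.
pose p := map_poly (horner_eval u) P.
have p0 : p = 0.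
  apply: (@roots_geq_poly_eq0 _ _
     [seq o2 + (s2 : nat)%:R - B%:R * (s1 : nat)%:R | s1 <- iota 0 N1, s2 <- iota 0 (N2 - L)]).
  - apply/allP => x /allpairsP[[s1 s2] /= [hx hy ->]].
    rewrite !mem_iota /= !add0n in hx hy.
    rewrite rootE -[X in p.[X]](hornerC _ u) -[X in p.[X]]/(horner_eval u _%:P) horner_map.
    apply/eqP; apply: (h4 _ _ (X s1 s2)) => // i iL.
    rewrite -X2 -[RHS](hz s1 (s2 + i)%N) //; last by lia.
    apply: eq_bigr => r _; congr (w r * rowfun r _ _ _).
    by rewrite natrD; ring.
  - apply: allpairs_uniq; rewrite ?iota_uniq // => -[? ?] [? ?] /allpairsP[[x y] /= [hx hy [-> ->]]].
    move=> /allpairsP[[x' y'] /= [hx' hy' [-> ->]]] /=.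
    rewrite !mem_iota /= !add0n in hx hy hx' hy'.
    move=> E; have {}E : (y + B * x' = y' + B * x)%N.
      by apply/eqP; rewrite -(eqr_nat R) !natrD !natrM; apply/eqP; lra.
    have [e|e] : (x = x' \/ x != x')%N by case: eqP => H; [left|right].
      by subst x'; congr (_, _); lia.
    by exfalso; move: E hy hy' N2B e; clear; nia.
  - rewrite size_allpairs !size_iota; apply: leq_trans (size_poly _ _) _.
    exact: leq_trans h2 N12.
have E : (P`_j).[u] = 0 by have := coef_map (horner_eval u) P j; rewrite -/p p0 coef0 => /esym.
by rewrite PE hornerC in E; rewrite PE E polyC0.
Qed.
End Zero2.

(** * Upper bounds for interpolation determinants *)

Lemma det_sum_expand (A : comNzRingType) r (I : finType) (a : 'I_r -> I -> A) (B : I -> 'I_r -> A) :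
  \det (\matrix_(i, c) \sum_m a i m * B m c) =
  \sum_(f : {ffun 'I_r -> I}) (\prod_i a i (f i)) * \det (\matrix_(i, c) B (f i) c).
Proof.
rewrite /determinant; under [RHS]eq_bigr => f _ do rewrite mulr_sumr.
rewrite exchange_big /=; apply: eq_bigr => s _.
under eq_bigr => i _ do rewrite mxE.
rewrite bigA_distr_bigA mulr_sumr; apply: eq_bigr => f _.
rewrite big_split /= mulrCA; congr (_ * (_ * _)).
by apply: eq_bigr => i _; rewrite mxE.
Qed.

Lemma det_le_prod (R : realDomainType) r (M : 'M[R]_r) (b : 'I_r -> R) :
  (forall i c, `|M i c| <= b i) -> `|\det M| <= r`!%:R * \prod_i b i.
Proof.
move=> h; apply: le_trans (ler_norm_sum _ _ _) _.
apply: (@le_trans _ _ (\sum_(s : {perm 'I_r}) \prod_i b i)).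
  apply: ler_sum => s _; rewrite normrM normrX normrN1 expr1n mul1r normr_prod.
  by apply: ler_prod => i _; rewrite normr_ge0 h.
by rewrite sumr_const card_Sn mulr_natl.
Qed.

Section Weights.
Variables (r q t0 : nat).
Hypothesis qt : (q * t0 <= r)%N.
(** A lower bound for the total weight of r distinct terms: for each threshold t < t0, at most q (t
    + 1) of them have weight at most t. *)
Definition theta := (\sum_(t < t0) (r - q * t.+1))%N.

(** The sum is r t0 - q t0 (t0 + 1) / 2 exactly, and q t0 <= r. *)
Lemma theta_ge : (r * (t0 - 1) <= 2 * theta)%N.
Proof.
rewrite /theta.
have key n : (n <= t0)%N -> (2 * (\sum_(t < n) (r - q * t.+1)) + q * n * n.+1 = 2 * r * n)%N.
  elim: n => [|n IH] nt; first by rewrite big_ord0; lia.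
  have := IH (ltnW nt); rewrite big_ord_recr /=; move: (\sum_(i < n) _)%N => S.
  have : (q * n.+1 <= r)%N by apply: leq_trans qt; rewrite leq_mul2l nt orbT.
  by clear; nia.
have := key t0 (leqnn _); move: (\sum_(t < t0) _)%N => S.
move: qt; clear; case: t0 => [|t]; first by lia.
by rewrite subn1 /=; nia.
Qed.

Variables (I : finType) (om : I -> nat).
Hypothesis om_count : forall t, (t <= t0)%N -> (#|[pred m | om m < t]| <= q * t)%N.

(** A weight is at least the number of thresholds below t0 that it exceeds; the two summations are
    then exchanged. *)
Lemma weight_inj (f : 'I_r -> I) : injective f -> (theta <= \sum_i om (f i))%N.
Proof.
move=> fi; apply: (@leq_trans (\sum_i \sum_(t < t0) (t < om (f i))%N)); last first.
  apply: leq_sum => i _; rewrite -big_mkcond /= sum1_card.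
  rewrite -[X in (_ <= X)%N](card_ord (om (f i))) cardE -(size_map val) cardE -(size_map val (enum 'I_(om (f i)))).
  apply: uniq_leq_size; first by rewrite map_inj_uniq ?enum_uniq //; exact: val_inj.
  move=> x /mapP[t]; rewrite mem_enum => ht ->; apply/mapP.
  by exists (Ordinal ht); rewrite ?mem_enum.
rewrite exchange_big /=; apply: leq_sum => t _.
rewrite -big_mkcond /= sum1_card leq_subLR.
have E : r = (#|[pred i : 'I_r | (om (f i) < t.+1)%N]| + #|[pred i : 'I_r | (t < om (f i))%N]|)%N.
  rewrite -[LHS](card_ord r) -(cardC [pred i : 'I_r | (om (f i) < t.+1)%N]).
  by congr (_ + _)%N; apply: eq_card => i; rewrite !inE ltnS -ltnNge.
rewrite [X in (X <= _)%N]E leq_add2r; apply: leq_trans (om_count (ltn_ord t)).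
rewrite -(card_imset _ fi); apply: subset_leq_card; apply/fintype.subsetP => x /imsetP[i hi ->].
by move: hi; rewrite !inE.
Qed.

Variables (R : realFieldType) (rho : R).
Hypothesis rho1 : 1 <= rho.
Variables (a : 'I_r -> I -> R) (B : I -> 'I_r -> R) (bd : I -> R).
Hypothesis bd0 : forall m, 0 <= bd m.
Hypothesis Bbd : forall m c, `|B m c| <= bd m.

(* This replaces the Schwarz lemma: in the multilinear expansion a choice of terms with a
   repetition contributes zero, so only choices of total weight at least theta survive. *)
Lemma det_weight_bound :
  `|\det (\matrix_(i, c) \sum_m a i m * B m c)| * rho ^+ theta <=
  r`!%:R * \prod_i \sum_m `|a i m| * bd m * rho ^+ om m.
Proof.
have rho0 : 0 <= rho by apply: le_trans rho1.
rewrite det_sum_expand bigA_distr_bigA mulr_sumr.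
apply: le_trans (ler_wpM2r _ (ler_norm_sum _ _ _)) _; first exact: exprn_ge0.
rewrite mulr_suml; apply: ler_sum => f _; rewrite normrM normr_prod.
have [inj|ninj] := boolP (injectiveb f).
  have hw := weight_inj (injectiveP _ inj).
  have hd : `|\det (\matrix_(i, c) B (f i) c)| <= r`!%:R * \prod_i bd (f i).
    by apply: det_le_prod => i c; rewrite mxE.
  rewrite !big_split /= -!mulrA.
  rewrite [X in _ <= X]mulrCA; apply: ler_wpM2l; first by apply: prodr_ge0.
  rewrite [X in _ <= X]mulrA; apply: ler_pM => //; first exact: exprn_ge0.
  by rewrite prodrXr; apply: ler_weXn2l.
have [i [j [ij E]]] : exists i j, i != j /\ f i = f j.
  move: ninj => /injectivePn[i [j ij E]]; by exists i, j.
rewrite (determinant_alternate ij); last by move=> c; rewrite !mxE E.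
rewrite normr0 mulr0 mul0r mulr_ge0 ?prodr_ge0 // => k _.
by rewrite !mulr_ge0 // exprn_ge0.
Qed.
End Weights.

(** * Expansion of the entries in powers of u and ln X *)

Section ExpTrunc.
Local Open Scope classical_set_scope.
Variable R : realType.
Definition expT N (x : R) : R := \sum_(a < N) x ^+ a / a`!%:R.

Lemma expTE N x : expT N x = series (exp_coeff x) N.
Proof. by rewrite /expT /series /= big_mkord. Qed.

Lemma expT_le N x : 0 <= x -> expT N x <= expR x.
Proof.
move=> x0; rewrite expTE; apply: nondecreasing_cvgn_le; last exact: is_cvg_series_exp_coeff.
by apply/nondecreasing_seqP => n; rewrite seriesSr lerDl exp_coeff_ge0.
Qed.

Lemma expT_approx (I : finType) (x e : I -> R) : (forall i, 0 < e i) ->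
  exists N, forall i, `|expR (x i) - expT N (x i)| <= e i.
Proof.
move=> he.
have : \forall N \near \oo, forall i, `|expR (x i) - expT N (x i)| <= e i.
  apply: filter_forall => i.
  have /cvgrPdist_le /(_ _ (he i)) := is_cvg_series_exp_coeff (x i).
  by apply: filterS => N; rewrite expTE.
by move=> [N _ h]; exists N; apply: h => /=.
Qed.
End ExpTrunc.

Lemma sum_supp (R : nmodType) (G : nat -> R) s n : (s <= n)%N ->
  (forall k, (s <= k)%N -> G k = 0) -> \sum_(k < n) G k = \sum_(k < s) G k.
Proof.
move=> sn h; rewrite -(subnKC sn) big_split_ord /= [X in _ + X]big1 ?addr0 // => i _.
by rewrite h // leq_addr.
Qed.

Lemma sum_from (R : nmodType) (F : nat -> R) i q : (i <= q)%N ->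
  (forall k, (k < i)%N -> F k = 0) -> \sum_(k < q) F k = \sum_(k < q - i) F (i + k)%N.
Proof.
move=> iq h; rewrite -[in LHS](subnKC iq) big_split_ord /= big1 ?add0r // => k _.
exact: h.
Qed.

Section LinExpand.
Variable R : fieldType.
Implicit Types u z ka et : R.
(** The coefficient of u^k in u^i ((z - ka u) / et)^j, stripped of its power z^(j - (k - i)). *)
Definition lcoef (i j k : nat) ka et : R :=
  if (i <= k)%N then ('C(j, k - i))%:R * (- ka) ^+ (k - i) * et ^- j else 0.

(** Here q counts the powers of u that may occur. The second alternative serves two logarithms: for
    ka = 0 only u^i survives, and q = 1 suffices there. *)
Lemma lin_expand i j q u z ka et : (i + j < q)%N \/ (ka = 0 /\ (i < q)%N) ->
  \sum_(k < q) u ^+ k * (lcoef i j k ka et * z ^+ (j - (k - i))) =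
  u ^+ i * ((z - ka * u) / et) ^+ j.
Proof.
move=> hq; have iq : (i <= q)%N by case: hq => [|[_]]; lia.
pose G k' := u ^+ (i + k') * (('C(j, k'))%:R * (- ka) ^+ k' * et ^- j * z ^+ (j - k')).
transitivity (\sum_(k' < q - i) G k').
  rewrite (sum_from (F := fun k => u ^+ k * (lcoef i j k ka et * z ^+ (j - (k - i)))) iq); last first.
    by move=> k ki; rewrite /lcoef leqNgt ki mul0r mulr0.
  by apply: eq_bigr => k _; rewrite /lcoef leq_addr addKn.
transitivity (\sum_(k' < j.+1) G k').
  case: hq => [hq|[ka0 hq]].
    apply: sum_supp => [|k jk]; first by lia.
    by rewrite /G bin_small ?mul0r ?mulr0 // .
  have G0 k : (1 <= k)%N -> G k = 0.
    by move=> k0; rewrite /G ka0 oppr0 expr0n gtn_eqF // mulr0 !mul0r mulr0.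
  by rewrite (@sum_supp _ G 1) ?subn_gt0 // (@sum_supp _ G 1 j.+1).
rewrite exprMn exprVn exprDn mulr_suml mulr_sumr; apply: eq_bigr => k _.
rewrite /G exprD -mulNr exprMn -mulr_natr; ring.
Qed.
End LinExpand.

Section Entries.
Variable R : realType.
Variables (k1 k2 Mh q t0 : nat).
Let L := (2 * Mh).+1.
Let T := rowT k1 k2 L.
Let r := #|T|.
Definition mexp (i : T) : R := (i.2 : nat)%:R - Mh%:R.
Variables (u v Z : 'I_r -> R) (U V Zm ka et de rho : R).
Hypothesis uU : forall c, `|u c| <= U.
Hypothesis vV : forall c, `|v c| <= V.
Hypothesis ZZ : forall c, `|Z c| <= Zm.
Hypothesis vZ : forall c, `|v c - (Z c - ka * u c) / et| <= de.
Hypothesis rho1 : 1 <= rho.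
Hypothesis U1 : 1 <= U.
Hypothesis V1 : 1 <= V.
Hypothesis VZ : (rho * Zm + `|ka| * U) / `|et| <= V.
Hypothesis hq : (k1 + k2 < q)%N \/ (ka = 0 /\ (k1 < q)%N).
Hypothesis qt : (q * t0 <= r)%N.
Hypothesis deS : k2%:R * de * rho ^+ t0 <= 1 / 2.

Let M := \matrix_(i < r, c < r)
  (u c ^+ (enum_val i).1.1 * v c ^+ (enum_val i).1.2 * expR (mexp (enum_val i) * Z c)).
(** Majorant of row i with Z enlarged to the radius rho Zm. By [VZ] the same V bounds both v and the
    enlarged affine expression that approximates it. *)
Let Phi (i : T) := U ^+ i.1.1 * V ^+ i.1.2 * expR (`|mexp i| * (rho * Zm)).
Let vt c := (Z c - ka * u c) / et.

Lemma Zm_ge0 (c : 'I_r) : 0 <= Zm. Proof. exact: le_trans (ZZ c). Qed.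

Lemma vt_le c : `|vt c| <= V.
Proof.
apply: le_trans VZ; rewrite /vt normrM normfV ler_wpM2r ?invr_ge0 //.
apply: le_trans (ler_normB _ _) _; rewrite normrM lerD //.
  by apply: le_trans (ZZ c) _; rewrite ler_peMl // (Zm_ge0 c).
exact: ler_wpM2l.
Qed.

Lemma pow_diff n c : (n <= k2)%N -> `|v c ^+ n - vt c ^+ n| <= k2%:R * de * V ^+ n.
Proof.
move=> nk; have de0 : 0 <= de by apply: le_trans (vZ c).
have V0 : 0 <= V by apply: le_trans V1.
suff : `|v c ^+ n - vt c ^+ n| <= n%:R * de * V ^+ n.
  move=> /le_trans; apply; rewrite ler_wpM2r ?exprn_ge0 // ler_wpM2r // ler_nat //.
elim: n {nk} => [|n IH]; first by rewrite !expr0 subrr normr0 !mul0r.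
have -> : v c ^+ n.+1 - vt c ^+ n.+1 = v c * (v c ^+ n - vt c ^+ n) + (v c - vt c) * vt c ^+ n.
  by rewrite !exprS; ring.
apply: le_trans (ler_normD _ _) _; rewrite !normrM normrX.
have h1 : `|v c| * `|v c ^+ n - vt c ^+ n| <= V * (n%:R * de * V ^+ n) by apply: ler_pM.
have h2 : `|v c - vt c| * `|vt c| ^+ n <= de * V ^+ n.
  apply: ler_pM => //; first exact: exprn_ge0.
  by apply: lerXn2r; rewrite ?nnegrE // vt_le.
apply: le_trans (lerD h1 h2) _; rewrite exprS -natr1.
have : 0 <= de * V ^+ n * (V - 1) by rewrite !mulr_ge0 ?exprn_ge0 // subr_ge0.
by move: (V ^+ n) => W; nra.
Qed.

Lemma Phi_ge1 (c : 'I_r) i : 1 <= Phi i.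
Proof.
rewrite /Phi -[1]mulr1 -[1 * 1]mulr1; apply: ler_pM => //; rewrite ?mul1r ?mulr1 //.
  by rewrite mulr_ege1 ?exprn_ege1.
by rewrite -expR0 ler_expR !mulr_ge0 // ?(Zm_ge0 c) // (le_trans _ rho1).
Qed.

Definition expP N (m : R) : {poly R} := \poly_(a < N) (m ^+ a / a`!%:R).

Lemma expP_horner N m x : (expP N m).[x] = expT N (m * x).
Proof.
by rewrite horner_poly; apply: eq_bigr => a _; rewrite exprMn mulrAC.
Qed.

(** The coefficient of u^k in row i, as a polynomial in Z, once v is replaced by [vt] and the
    exponential is truncated. *)
Definition rpoly N (i : T) (k : nat) : {poly R} :=
  lcoef i.1.1 i.1.2 k ka et *: ('X^(i.1.2 - (k - i.1.1)) * expP N (mexp i)).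

Lemma size_rpoly N i k : (size (rpoly N i k) <= k2 + N)%N.
Proof.
apply: leq_trans (size_scale_leq _ _) _; apply: leq_trans (size_polyMleq _ _) _.
rewrite size_polyXn /=; have h1 := ltn_ord i.1.2.
have h2 : (size (expP N (mexp i)) <= N)%N by exact: size_poly.
move: h1 h2; move: (size (expP _ _)) (nat_of_ord i.1.2) (nat_of_ord i.1.1) => x y z; lia.
Qed.

Lemma rpoly_sum N i c :
  \sum_(k < q) u c ^+ k * (rpoly N i k).[Z c] =
  u c ^+ i.1.1 * vt c ^+ i.1.2 * expT N (mexp i * Z c).
Proof.
have hq' : (i.1.1 + i.1.2 < q)%N \/ (ka = 0 /\ (i.1.1 < q)%N).
  have := ltn_ord i.1.1; have := ltn_ord i.1.2; case: hq => [h|[e h]] h1 h2; [left|right]; try split=> //; lia.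
rewrite /vt -(lin_expand (u c) (Z c) et hq') mulr_suml; apply: eq_bigr => k _.
by rewrite hornerZ hornerM hornerXn expP_horner !mulrA.
Qed.

(** Absolute values amount to replacing - ka by |ka| and et by |et|, so [lin_expand] itself sums the
    majorants, at u = U and z = rho Zm. *)
Lemma rpoly_maj N i : 0 <= Zm ->
  \sum_(k < q) U ^+ k * (\sum_(a < k2 + N) `|(rpoly N i k)`_a| * (rho * Zm) ^+ a) <= Phi i.
Proof.
move=> Zm0; have x0 : 0 <= rho * Zm by rewrite mulr_ge0 // (le_trans _ rho1).
have hq' : (i.1.1 + i.1.2 < q)%N \/ (- `|ka| = 0 /\ (i.1.1 < q)%N).
  have := ltn_ord i.1.1; have := ltn_ord i.1.2; case: hq => [h|[e h]] h1 h2; [left|right; rewrite e normr0 oppr0]; try split=> //; lia.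
have key k : \sum_(a < k2 + N) `|(rpoly N i k)`_a| * (rho * Zm) ^+ a <=
   lcoef i.1.1 i.1.2 k (- `|ka|) `|et| * (rho * Zm) ^+ (i.1.2 - (k - i.1.1)) * expR (`|mexp i| * (rho * Zm)).
  set x := rho * Zm; set n := (i.1.2 - (k - i.1.1))%N.
  have nk : (n <= k2)%N by rewrite /n; have := ltn_ord i.1.2; lia.
  set lc := lcoef _ _ _ _ _.
  have lcE : lc = `|lcoef i.1.1 i.1.2 k ka et|.
    rewrite /lc /lcoef; case: ifP => _; rewrite ?normr0 //.
    by rewrite !normrM normfV !normrX normrN normr_nat opprK.
  pose F a := `|(rpoly N i k)`_a| * x ^+ a.
  have FE a : F (n + a)%N = lc * x ^+ n * (`|(expP N (mexp i))`_a| * x ^+ a).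
    rewrite /F /rpoly coefZ coefXnM ltnNge leq_addr /= addKn normrM -lcE exprD.
    by rewrite -!mulrA; congr (_ * _); rewrite mulrCA.
  rewrite -/(F _) (sum_from (F := F) (i := n)); last 2 first.
  - by rewrite (leq_trans nk) // leq_addr.
  - by move=> a an; rewrite /F /rpoly coefZ coefXnM an mulr0 normr0 mul0r.
  rewrite (eq_bigr _ (fun (a : 'I_(k2 + N - n)) _ => FE a)) -mulr_sumr ler_wpM2l //.
    by rewrite mulr_ge0 ?exprn_ge0 // lcE.
  rewrite (sum_supp (G := fun a => `|(expP N (mexp i))`_a| * x ^+ a) (s := N)); last 2 first.
  - by lia.
  - by move=> a Na; rewrite coef_poly ltnNge Na /= normr0 mul0r.
  apply: le_trans (expT_le N _); last by rewrite mulr_ge0.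
  apply: ler_sum => a _; rewrite coef_poly ltn_ord [(_ * x) ^+ _]exprMn normrM normfV normrX normr_nat.
  by rewrite mulrAC.
apply: (@le_trans _ _ (\sum_(k < q) U ^+ k * (lcoef i.1.1 i.1.2 k (- `|ka|) `|et| * (rho * Zm) ^+ (i.1.2 - (k - i.1.1))) * expR (`|mexp i| * (rho * Zm)))).
  by apply: ler_sum => k _; rewrite -mulrA ler_wpM2l ?exprn_ge0 // (le_trans _ U1).
rewrite -mulr_suml (lin_expand U (rho * Zm) _ hq') /Phi ler_wpM2r ?expR_ge0 //.
have U0 : 0 <= U by rewrite (le_trans _ U1).
rewrite ler_wpM2l ?exprn_ge0 // mulNr opprK; apply: lerXn2r; rewrite ?nnegrE //.
- by rewrite divr_ge0 // addr_ge0 // mulr_ge0.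
- by rewrite (le_trans _ V1).
Qed.

Lemma r_gt0 : (0 < r)%N.
Proof. by apply/card_gt0P; exists (ord0, ord0, ord0). Qed.

Lemma count_le N t : (\sum_(a < N) (a < t)%N <= t)%N.
Proof.
rewrite -big_mkcond /= sum1_card cardE -(size_map val) -[X in (_ <= X)%N](size_iota 0).
apply: uniq_leq_size; first by rewrite map_inj_uniq ?enum_uniq //; exact: val_inj.
by move=> x /mapP[a]; rewrite mem_enum mem_iota add0n => ha ->.
Qed.

(** The factor 2 counts the polynomial part of a row and its error term; each contributes at most
    Phi after being weighted by rho. *)
Theorem det_entries_bound :
  `|\det M| * rho ^+ theta r q t0 <= r`!%:R * \prod_(i < r) (2 * Phi (enum_val i)).
Proof.
pose ev (i : 'I_r) : T := enum_val i.
pose c0 : 'I_r := Ordinal r_gt0.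
have Zm0 : 0 <= Zm := Zm_ge0 c0.
have rho0 : 0 < rho by apply: lt_le_trans rho1.
have U0 : 0 < U by apply: lt_le_trans U1.
have V0 : 0 < V by apply: lt_le_trans V1.
(* Of the admissible error rho^(- t0), half is spent on truncating the exponential and, by [deS],
   half on replacing v by [vt]. *)
pose e (x : 'I_r * 'I_r) := 1 / 2 * rho ^- t0 / (U ^+ (ev x.1).1.1 * V ^+ (ev x.1).1.2).
have e0 x : 0 < e x by rewrite /e !(divr_gt0, mulr_gt0, exprn_gt0, invr_gt0).
have [N hN] := expT_approx (fun x : 'I_r * 'I_r => mexp (ev x.1) * Z x.2) e0.
(* The left summand indexes the monomials u^k Z^b, of which at most q t have weight below t; the
   right one holds the error of each row, of weight t0. *)
pose I : finType := (('I_q * 'I_(k2 + N)) + 'I_r)%type.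
pose a (i : 'I_r) (m : I) : R := match m with
  | inl ka => (rpoly N (ev i) ka.1)`_ka.2 | inr i' => (i == i')%:R end.
pose B (m : I) (c : 'I_r) : R := match m with
  | inl ka => u c ^+ ka.1 * Z c ^+ ka.2
  | inr i' => M i' c - u c ^+ (ev i').1.1 * vt c ^+ (ev i').1.2 * expT N (mexp (ev i') * Z c) end.
pose bd (m : I) : R := match m with
  | inl ka => U ^+ ka.1 * Zm ^+ ka.2 | inr i' => Phi (ev i') * rho ^- t0 end.
pose om (m : I) : nat := match m with inl ka => minn ka.2 t0 | inr _ => t0 end.
have ME : M = \matrix_(i, c) \sum_m a i m * B m c.
  apply/matrixP => i c; rewrite [RHS]mxE big_sumType /= -[X in X + _](pair_bigA _
     (fun (k : 'I_q) (b : 'I_(k2 + N)) => (rpoly N (ev i) k)`_b * (u c ^+ k * Z c ^+ b))) /=.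
  rewrite [X in _ + X](bigD1 i) //= eqxx mul1r [X in _ + (_ + X)]big1 ?addr0 => [|j /negPf ji]; last first.
    by rewrite eq_sym ji mul0r.
  rewrite -rpoly_sum addrC; apply/eqP; rewrite -subr_eq; apply/eqP; congr (_ - _).
  apply: eq_bigr => k _; rewrite (horner_coef_wide _ (size_rpoly N (ev i) k)) mulr_sumr.
  by apply: eq_bigr => b _; rewrite mulrCA.
have Pg i : 1 <= Phi i := Phi_ge1 c0 i.
have Pg0 i : 0 <= Phi i by apply: le_trans (Pg i).
have bd0 m : 0 <= bd m.
  by case: m => [[k b]|i] /=; rewrite mulr_ge0 ?exprn_ge0 ?invr_ge0 ?exprn_ge0 // ltW.
have Bbd m c : `|B m c| <= bd m.
  case: m => [[k b]|i] /=.
    rewrite normrM !normrX; apply: ler_pM; rewrite ?exprn_ge0 //.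
      by apply: lerXn2r; rewrite ?nnegrE // ltW.
    by apply: lerXn2r; rewrite ?nnegrE.
  set i1 := (ev i).1.1; set i2 := (ev i).1.2; set mz := mexp (ev i) * Z c.
  have -> : M i c - u c ^+ i1 * vt c ^+ i2 * expT N mz =
     u c ^+ i1 * (v c ^+ i2 - vt c ^+ i2) * expR mz + u c ^+ i1 * vt c ^+ i2 * (expR mz - expT N mz).
    rewrite mxE -/(ev i) -/i1 -/i2 -/mz.
    by move: (u c ^+ i1) (v c ^+ i2) (vt c ^+ i2) (expR mz) (expT N mz); clear => *; ring.
  apply: le_trans (ler_normD _ _) _.
  have hU : `|u c ^+ i1| <= U ^+ i1 by rewrite normrX; apply: lerXn2r; rewrite ?nnegrE // ltW.
  have hV : `|vt c ^+ i2| <= V ^+ i2.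
    by rewrite normrX; apply: lerXn2r; rewrite ?nnegrE ?vt_le // ltW.
  have h1 : `|u c ^+ i1 * (v c ^+ i2 - vt c ^+ i2) * expR mz| <= Phi (ev i) * (k2%:R * de).
    rewrite !normrM (ger0_norm (expR_ge0 _)).
    have -> : Phi (ev i) * (k2%:R * de) = U ^+ i1 * (k2%:R * de * V ^+ i2) * expR (`|mexp (ev i)| * (rho * Zm)).
      rewrite /Phi -/i1 -/i2.
      by move: (U ^+ i1) (V ^+ i2) (expR _) (k2%:R * de); clear => *; ring.
    apply: ler_pM; rewrite ?mulr_ge0 ?expR_ge0 //.
      apply: ler_pM => //; apply: pow_diff; rewrite -ltnS; exact: ltn_ord.
    rewrite ler_expR /mz; apply: le_trans (ler_norm _) _; rewrite normrM ler_wpM2l //.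
    by apply: le_trans (ZZ c) _; rewrite ler_peMl.
  have h2 : `|u c ^+ i1 * vt c ^+ i2 * (expR mz - expT N mz)| <= 1 / 2 * rho ^- t0.
    have := hN (i, c); rewrite /e /= -/i1 -/i2 -/mz => h.
    rewrite !normrM; apply: (@le_trans _ _ (U ^+ i1 * V ^+ i2 * (1 / 2 * rho ^- t0 / (U ^+ i1 * V ^+ i2)))).
      by apply: ler_pM => //; rewrite ?mulr_ge0 //; apply: ler_pM.
    by rewrite mulrCA mulfV ?mulr1 // mulf_neq0 // expf_neq0 // gt_eqF.
  apply: le_trans (lerD h1 h2) _.
  have hr : 0 < rho ^- t0 by rewrite invr_gt0 exprn_gt0.
  have h3 : k2%:R * de <= 1 / 2 * rho ^- t0 by rewrite ler_pdivlMr ?exprn_gt0.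
  have := Pg (ev i); move: h3 hr; move: (k2%:R * de) (rho ^- t0) (Phi _) => x y z h4 h5 h6; nra.
have cnt t : (t <= t0)%N -> (#|[pred m | om m < t]%N| <= q * t)%N.
  move=> tt; rewrite -sum1_card big_mkcond big_sumType /= [X in (_ + X)%N]big1 ?addn0; last first.
    by move=> i _; rewrite inE /= ltnNge tt.
  rewrite -(pair_bigA _ (fun (k : 'I_q) (b : 'I_(k2 + N)) => if (inl (k, b) : I) \in [pred m | om m < t]%N then 1%N else 0%N)) /=.
  rewrite -[X in (_ <= X * _)%N](card_ord q) -sum_nat_const; apply: leq_sum => k _.
  apply: leq_trans (count_le (k2 + N) t); apply: leq_sum => b _.
  by rewrite inE /= gtn_min [(t0 < t)%N]ltnNge tt orbF; case: ltnP.
have := @det_weight_bound r q t0 I om cnt R rho rho1 a B bd bd0 Bbd; rewrite -ME => /le_trans; apply.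
rewrite ler_wpM2l //; apply: ler_prod => i _; apply/andP; split.
  by apply: sumr_ge0 => m _; rewrite !mulr_ge0 ?exprn_ge0 // ltW.
rewrite big_sumType /= mulr_natl mulr2n; apply: lerD.
  apply: le_trans (rpoly_maj N (ev i) Zm0).
  rewrite -(pair_bigA _ (fun (k : 'I_q) (b : 'I_(k2 + N)) => `|(rpoly N (ev i) k)`_b| * (U ^+ k * Zm ^+ b) * rho ^+ minn b t0)) /=.
  apply: ler_sum => k _; rewrite mulr_sumr; apply: ler_sum => b _.
  rewrite exprMn [X in _ <= X]mulrCA -mulrA ler_wpM2l // -mulrA ler_wpM2l ?exprn_ge0 ?(ltW U0) //.
  rewrite mulrC ler_wpM2r ?exprn_ge0 //; apply: ler_weXn2l => //; exact: geq_minl.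
rewrite (bigD1 i) //= eqxx normr1 mul1r big1 ?addr0 => [|j /negPf ji]; last first.
  by rewrite eq_sym ji normr0 !mul0r.
by rewrite mulrVK // unitfE expf_neq0 // gt_eqF.
Qed.
End Entries.

(** * Arithmetic of the ring generated by the golden ratio *)

(** The 5-adic valuation would be even on the left and odd on the right. *)
Lemma sqr_eq_5sqr (x y : nat) : (x ^ 2 = 5 * y ^ 2)%N -> y = 0%N.
Proof.
move=> E; case: (posnP y) => // y0.
have x0 : (0 < x)%N by rewrite lt0n; apply/eqP => xx; move: E; rewrite xx; nia.
have := congr1 (logn 5) E; rewrite lognM ?expn_gt0 ?y0 // !lognX (@logn_prime 5 5) //=.
by move: (logn 5 x) (logn 5 y) => a b; lia.
Qed.

Section Golden.
Variable R : rcfType.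
Definition alpha : R := (1 + Num.sqrt 5) / 2.
Definition beta : R := (1 - Num.sqrt 5) / 2.

Lemma sqrt5_sq : Num.sqrt 5 ^+ 2 = 5 :> R.
Proof. by rewrite sqr_sqrtr. Qed.

Lemma alphaD : alpha + beta = 1. Proof. by rewrite /alpha /beta; field. Qed.
(** Elements of Z[alpha] are represented by integer polynomials, so that conjugation is evaluation
    at beta and commutes with determinants. *)
Definition ev (x : R) (p : {poly int}) : R := (map_poly intr p).[x].

Lemma ev_nmod x : zmod_morphism (ev x).
Proof. by move=> p q; rewrite /ev rmorphB hornerD hornerN. Qed.
Lemma ev_mon x : monoid_morphism (ev x).
Proof. by split; rewrite /ev ?rmorph1 ?hornerC // => p q; rewrite rmorphM hornerM. Qed.
HB.instance Definition _ x := GRing.isZmodMorphism.Build {poly int} R (ev x) (ev_nmod x).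
HB.instance Definition _ x := GRing.isMonoidMorphism.Build {poly int} R (ev x) (ev_mon x).

Lemma evX x : ev x 'X = x. Proof. by rewrite /ev map_polyX hornerX. Qed.
Lemma evC x c : ev x c%:P = c%:~R. Proof. by rewrite /ev map_polyC hornerC. Qed.

Definition minp : {poly int} := 'X^2 - 'X - 1.

Lemma size_minp : size minp = 3.
Proof.
rewrite /minp -addrA size_polyDl size_polyXn // size_polyDl ?size_polyN ?size_polyX //.
by rewrite size_poly1.
Qed.

Lemma minp_monic : minp \is monic.
Proof. by rewrite monicE lead_coefE size_minp /minp !coefB coefXn coefX coef1. Qed.

Lemma ev_minp x : x ^+ 2 - x - 1 = 0 -> ev x minp = 0.
Proof. by rewrite /minp !rmorphB rmorphXn rmorph1 /= evX. Qed.

Lemma alpha_eq : alpha ^+ 2 - alpha - 1 = 0.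
Proof. by have := sqrt5_sq; rewrite /alpha => h; nra. Qed.
Lemma beta_eq : beta ^+ 2 - beta - 1 = 0.
Proof. by have := sqrt5_sq; rewrite /beta => h; nra. Qed.

(* The product is the norm of a nonzero element of Z[alpha], i.e. a nonzero integer. *)
Lemma norm_lower (p : {poly int}) : (ev alpha p != 0) || (ev beta p != 0) -> 1 <= `|ev alpha p| * `|ev beta p|.
Proof.
pose r := Pdiv.Ring.rmodp p minp.
have E x : x ^+ 2 - x - 1 = 0 -> ev x p = (r`_0)%:~R + (r`_1)%:~R * x.
  move=> hx; rewrite [p in LHS](Pdiv.RingMonic.rdivp_eq minp_monic) rmorphD rmorphM /=.
  rewrite ev_minp // mulr0 add0r -/r.
  have sr : (size r <= 2)%N.
    by have := Pdiv.Ring.ltn_rmodpN0 p (monic_neq0 minp_monic); rewrite size_minp ltnS.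
  rewrite /ev (horner_coef_wide (n := 2)) ?(leq_trans (size_poly _ _)) //.
  by rewrite !big_ord_recr big_ord0 /= !coef_map add0r expr0 mulr1 expr1.
rewrite (E _ alpha_eq) (E _ beta_eq) -normrM {E}.
move: (r`_0) (r`_1); rewrite -/int => a b nz; change int in a; change int in b.
have -> : (a%:~R + b%:~R * alpha) * (a%:~R + b%:~R * beta) = (a ^+ 2 + a * b - b ^+ 2)%:~R :> R.
  rewrite rmorphB rmorphD !rmorphXn rmorphM /=.
  have -> : beta = 1 - alpha by rewrite -alphaD addrC addKr.
  have h : alpha ^+ 2 = alpha + 1 by have := alpha_eq; move: (alpha ^+ 2) => x h; lra.
  by ring: h.
rewrite -intr_norm -[1]/(1%:~R) ler_int -gtz0_ge1 normr_gt0.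
apply: contraTneq nz => n0.
have b0 : b = 0.
  (* Four times the norm form a^2 + a b - b^2 is (2 a + b)^2 - 5 b^2. *)
  have e5 : (2 * a + b) ^+ 2 = 5 * b ^+ 2.
    by move: n0; rewrite !expr2; nia.
  have := congr1 absz e5; rewrite abszM !abszX => /sqr_eq_5sqr /eqP.
  by rewrite absz_eq0 => /eqP.
have a0 : a = 0.
  by move: n0; rewrite b0 mulr0 expr0n addr0 subr0 => /eqP; rewrite sqrf_eq0 => /eqP.
by rewrite a0 b0 !mul0r addr0 eqxx.
Qed.
End Golden.

(** * Vanishing of the interpolation determinant *)

Lemma ler_eq (R : numDomainType) (a b : R) : a = b -> a <= b.
Proof. by move=> ->. Qed.

Lemma sum_pair_fst (I J : finType) (F : I -> nat) :
  (\sum_(p : I * J) F p.1 = #|J| * \sum_i F i)%N.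
Proof.
rewrite -(pair_bigA _ (fun i (_ : J) => F i)) /= big_distrr /=.
by apply: eq_bigr => i _; rewrite sum_nat_const.
Qed.

Lemma sum_pair_snd (I J : finType) (F : J -> nat) :
  (\sum_(p : I * J) F p.2 = #|I| * \sum_j F j)%N.
Proof. by rewrite -(pair_bigA _ (fun (_ : I) j => F j)) /= sum_nat_const. Qed.

Lemma gauss_sum n : (2 * \sum_(i < n.+1) i = n * n.+1)%N.
Proof.
elim: n => [|n IH]; first by rewrite big_ord_recr big_ord0.
by rewrite big_ord_recr /= mulnDr IH; nia.
Qed.

Lemma sum_dist n : (\sum_(i < (2 * n).+1) `|(i : nat)%:Z - n%:Z| = n * n.+1)%N.
Proof.
rewrite (_ : (2 * n).+1 = n + n.+1)%N; last by lia.
rewrite big_split_ord /=.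
have e1 : (\sum_(i < n) `|(i : nat)%:Z - n%:Z| = \sum_(i < n.+1) i)%N.
  rewrite (reindex_inj rev_ord_inj) big_ord_recl /= add0n; apply: eq_bigr => i _ /=.
  by rewrite /bump /=; have := ltn_ord i; lia.
have e2 : (\sum_(i < n.+1) `|(n + i)%N%:Z - n%:Z| = \sum_(i < n.+1) i)%N.
  by apply: eq_bigr => i _; lia.
by rewrite e1 e2 addnn -mul2n gauss_sum.
Qed.

Lemma fact_le_exp n m : (n <= m -> n`! <= m ^ n)%N.
Proof.
elim: n => [|n IH] nm; first by rewrite expn0.
by rewrite factS expnS leq_mul // IH // ltnW.
Qed.

Section Vanish.
Variable R : realType.
Notation al := (@alpha R).
Notation be := (@beta R).
Variables (k1 k2 Mh q t0 : nat).
Let L := (2 * Mh).+1.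
Let T := rowT k1 k2 L.
Let r := #|T|.
Variables (x y : 'I_3 -> {poly int}) (Tb : 'I_3 -> nat) (H G : 'I_3 -> R).
Hypothesis x0 : forall l, 0 < ev al (x l).
Hypothesis y0 : forall l, 0 < ev al (y l).
Hypothesis xH : forall l, ev al (x l) <= expR (H l).
Hypothesis yH : forall l, ev al (y l) <= expR (H l).
Hypothesis xHb : forall l, `|ev be (x l)| <= expR (H l).
Hypothesis yHb : forall l, `|ev be (y l)| <= expR (H l).
Definition lg l : R := ln (ev al (x l)) - ln (ev al (y l)).
Hypothesis H0 : forall l, 0 <= H l.
Hypothesis gG : forall l, `|lg l| <= G l.
Variables (s : 'I_r -> 'I_3 -> int) (u v : 'I_r -> int).
Hypothesis sT : forall c l, (`|s c l| <= Tb l)%N.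
Variables (U V lam ka et de : R).
Hypothesis uU : forall c, `|u c|%:~R <= U.
Hypothesis vV : forall c, `|v c|%:~R <= V.
Hypothesis U1 : 1 <= U.
Hypothesis V1 : 1 <= V.
Hypothesis Ul : U <= expR lam.
Hypothesis Vl : V <= expR lam.
Definition logX (c : 'I_r) : R := \sum_l (s c l)%:~R * lg l.
Definition Zmax : R := \sum_l (Tb l)%:R * G l.
Hypothesis vZ : forall c, `|(v c)%:~R - (logX c - ka * (u c)%:~R) / et| <= de.
Hypothesis VZ : (expR 2 * Zmax + `|ka| * U) / `|et| <= V.
Hypothesis hq : (k1 + k2 < q)%N \/ (ka = 0 /\ (k1 < q)%N).
Hypothesis qt : (q * t0 <= r)%N.
Hypothesis deS : k2%:R * de * expR 2 ^+ t0 <= 1 / 2.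
(** Cost of one power of X: e^2 G for the enlarged radius, and 4 H as 2 H for the denominators plus
    2 H for the conjugates. *)
Definition Ccost : R := \sum_l (Tb l)%:R * (expR 2 * G l + 4 * H l).
Hypothesis cost : 2 * ln r%:R + 1 + lam * (k1 + k2)%:R + (Mh.+1)%:R / 2 * Ccost < t0%:R - 1.

(* Using X^(m - Mh) instead of X^m multiplies each column by a power of X and halves the
   denominators. *)
Let m_ (i : T) : int := (i.2 : nat)%:Z - Mh%:Z.
(** The integer |m| n + m a is nonnegative when |a| <= n; [absz] only makes it a natural number.
    With these exponents (x / y)^(m a) is multiplied by (x y)^(|m| n) and becomes integral. *)
Definition xexp (m : int) (n : nat) (a : int) : nat := absz ((absz m)%:Z * n%:Z + m * a).
Definition xpol (i : T) (c : 'I_r) : {poly int} :=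
  (u c ^+ i.1.1 * v c ^+ i.1.2)%:P *
  \prod_l (x l ^+ xexp (m_ i) (Tb l) (s c l) * y l ^+ xexp (m_ i) (Tb l) (- s c l)).

Lemma xexpE (m : int) c l :
  (xexp m (Tb l) (s c l))%:Z = (absz m)%:Z * (Tb l)%:Z + m * s c l /\
  (xexp m (Tb l) (- s c l))%:Z = (absz m)%:Z * (Tb l)%:Z - m * s c l.
Proof.
have := sT c l; rewrite /xexp mulrN; move: (s c l) (Tb l) => a b ab.
have h : `|m * a| <= (absz m)%:Z * b%:Z by rewrite normrM; nia.
by move: h; move: (m * a) ((absz m)%:Z * b%:Z) => p q'; lia.
Qed.

Lemma xexp_sum (m : int) c l :
  (xexp m (Tb l) (s c l) + xexp m (Tb l) (- s c l) = 2 * absz m * Tb l)%N.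
Proof.
have [h1 h2] := xexpE m c l; apply/eqP; rewrite -eqz_nat PoszD h1 h2 !PoszM; apply/eqP; ring.
Qed.

Let HT : R := \sum_l (Tb l)%:R * H l.

Lemma ev_be_xpol i c : `|ev be (xpol i c)| <= U ^+ i.1.1 * V ^+ i.1.2 * expR (2 * `|mexp R i| * HT).
Proof.
rewrite /xpol rmorphM /= evC rmorph_prod /= normrM; apply: ler_pM => //.
  have hu : `|(u c)%:~R : R| <= U by rewrite -intr_norm.
  have hv : `|(v c)%:~R : R| <= V by rewrite -intr_norm.
  have U0 : 0 <= U by rewrite (le_trans _ U1).
  have V0 : 0 <= V by rewrite (le_trans _ V1).
  rewrite rmorphM !rmorphXn /= normrM !normrX; apply: ler_pM; rewrite ?exprn_ge0 //.
    by apply: lerXn2r; rewrite ?nnegrE.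
  by apply: lerXn2r; rewrite ?nnegrE.
rewrite normr_prod mulr_sumr expR_sum; apply: ler_prod => l _; rewrite normr_ge0 /=.
rewrite rmorphM !rmorphXn /= normrM !normrX.
apply: (@le_trans _ _ (expR (H l) ^+ (2 * absz (m_ i) * Tb l)%N)).
  by rewrite -(xexp_sum _ c) exprD; apply: ler_pM; rewrite ?exprn_ge0 //;
    apply: lerXn2r; rewrite ?nnegrE ?expR_ge0.
rewrite -expRM_natl ler_expR; apply: ler_eq; rewrite !natrM natr_absz /mexp /m_.
rewrite (_ : `|(i.2 : nat)%:R - Mh%:R| = `|(i.2 : nat)%:Z - Mh%:Z|%:~R :> R); last first.
  by rewrite intr_norm rmorphB.
by move: (`|_|%:~R) => w; ring.
Qed.

(** Denominator of row i. It does not depend on the column, so it leaves the determinant as a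
    factor. *)
Let cc (i : T) : R := \prod_l (ev al (x l) * ev al (y l)) ^+ (absz (m_ i) * Tb l)%N.

Lemma cc_gt0 i : 0 < cc i.
Proof. by apply: prodr_gt0 => l _; rewrite exprn_gt0 // mulr_gt0. Qed.

Lemma cc_le i : cc i <= expR (2 * `|mexp R i| * HT).
Proof.
rewrite mulr_sumr expR_sum; apply: ler_prod => l _.
rewrite exprn_ge0 ?mulr_ge0 ?(ltW (x0 l)) ?(ltW (y0 l)) //=.
apply: (@le_trans _ _ ((expR (H l) * expR (H l)) ^+ (absz (m_ i) * Tb l)%N)).
  apply: lerXn2r; rewrite ?nnegrE ?mulr_ge0 ?expR_ge0 ?(ltW (x0 l)) ?(ltW (y0 l)) //.
  by apply: ler_pM; rewrite ?(ltW (x0 l)) ?(ltW (y0 l)).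
rewrite -expRD -expRM_natl ler_expR; apply: ler_eq; rewrite !natrM natr_absz /mexp /m_.
rewrite (_ : `|(i.2 : nat)%:R - Mh%:R| = `|(i.2 : nat)%:Z - Mh%:Z|%:~R :> R); last first.
  by rewrite intr_norm rmorphB.
by move: (`|_|%:~R) => w; ring.
Qed.

Lemma ev_al_xpol i c : ev al (xpol i c) =
  cc i * ((u c)%:~R ^+ i.1.1 * (v c)%:~R ^+ i.1.2 * expR (mexp R i * logX c)).
Proof.
rewrite /xpol rmorphM /= evC rmorph_prod /= rmorphM !rmorphXn /= mulrCA; congr (_ * _).
rewrite mulr_sumr expR_sum /cc -big_split /=; apply: eq_bigr => l _.
rewrite rmorphM !rmorphXn /= /lg.
have hx : ev al (x l) = expR (ln (ev al (x l))) by rewrite lnK // posrE.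
have hy : ev al (y l) = expR (ln (ev al (y l))) by rewrite lnK // posrE.
move: hx hy; move: (ln (ev al (x l))) (ln (ev al (y l))) => lx ly -> ->.
rewrite -!expRM_natl -!expRD -expRM_natl -expRD; congr expR.
have [h1 h2] := xexpE (m_ i) c l.
have e1 : (xexp (m_ i) (Tb l) (s c l))%:R = (absz (m_ i) * Tb l)%:R + (m_ i)%:~R * (s c l)%:~R :> R.
  by rewrite -[LHS]/((xexp (m_ i) (Tb l) (s c l))%:Z%:~R) h1 rmorphD !rmorphM /= ?natrM.
have e2 : (xexp (m_ i) (Tb l) (- s c l))%:R = (absz (m_ i) * Tb l)%:R - (m_ i)%:~R * (s c l)%:~R :> R.
  by rewrite -[LHS]/((xexp (m_ i) (Tb l) (- s c l))%:Z%:~R) h2 rmorphB !rmorphM /= ?natrM.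
rewrite e1 e2 /mexp (_ : (i.2 : nat)%:R - Mh%:R = (m_ i)%:~R); last by rewrite rmorphB.
by ring.
Qed.

Lemma card_r : r = (k1.+1 * k2.+1 * L)%N.
Proof. by rewrite /r /T !card_prod !card_ord. Qed.

Lemma sum_i1 : (2 * \sum_(i : T) i.1.1 = r * k1)%N.
Proof.
rewrite (sum_pair_fst _ (fun p : 'I_k1.+1 * 'I_k2.+1 => p.1 : nat)).
rewrite (sum_pair_fst _ (fun i : 'I_k1.+1 => i : nat)) !card_ord card_r.
by have := gauss_sum k1; move: (\sum_(_ < _) _)%N => S; nia.
Qed.

Lemma sum_i2 : (2 * \sum_(i : T) i.1.2 = r * k2)%N.
Proof.
rewrite (sum_pair_fst _ (fun p : 'I_k1.+1 * 'I_k2.+1 => p.2 : nat)).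
rewrite (sum_pair_snd _ (fun i : 'I_k2.+1 => i : nat)) !card_ord card_r.
by have := gauss_sum k2; move: (\sum_(_ < _) _)%N => S; nia.
Qed.

Lemma sum_m : (2 * \sum_(i : T) absz (m_ i) <= r * Mh.+1)%N.
Proof.
rewrite (sum_pair_snd _ (fun i : 'I_L => absz ((i : nat)%:Z - Mh%:Z))) sum_dist card_prod !card_ord card_r /L.
by move: (k1.+1 * k2.+1)%N => S; nia.
Qed.

Lemma mexpE i : `|mexp R i| = (absz (m_ i))%:R.
Proof. by rewrite natr_absz intr_norm rmorphB. Qed.

Lemma logX_le c : `|logX c| <= Zmax.
Proof.
apply: le_trans (ler_norm_sum _ _ _) _; apply: ler_sum => l _; rewrite normrM.
apply: ler_pM => //; rewrite -intr_norm -natr_absz ler_nat; exact: sT.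
Qed.

Let ev_row (i : 'I_r) : T := enum_val i.
Let M := \matrix_(i < r, c < r)
  ((u c)%:~R ^+ (enum_val i).1.1 * (v c)%:~R ^+ (enum_val i).1.2 * expR (mexp R (enum_val i) * logX c)).

Lemma CcostE : Ccost = expR 2 * Zmax + 4 * HT.
Proof.
rewrite /Ccost /Zmax /HT !mulr_sumr -big_split /=; apply: eq_bigr => l _.
by move: (expR 2) => e; ring.
Qed.

Lemma Ccost_ge0 : 0 <= Ccost.
Proof.
apply: sumr_ge0 => l _; rewrite mulr_ge0 // addr_ge0 ?mulr_ge0 ?expR_ge0 //.
exact: le_trans (gG l).
Qed.

(** Were it nonzero, the cleared determinant would have norm at least 1, while its value at alpha is
    analytically small and its conjugate trivially bounded. Taking logarithms and averaging over the
    r rows, where the mean exponents are k1 / 2, k2 / 2 and at most (Mh + 1) / 2, contradicts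
    [cost]. *)
Lemma det_interpolation_eq0 : \det M = 0.
Proof.
apply/eqP/negPn/negP => dM.
pose X := \matrix_(i < r, c < r) xpol (enum_val i) c.
have dal : ev al (\det X) = (\prod_i cc (ev_row i)) * \det M.
  have -> : ev al (\det X) = \det (map_mx (ev al) X) by rewrite det_map_mx.
  have -> : map_mx (ev al) X = diag_mx (\row_i cc (ev_row i)) *m M.
    by apply/matrixP => i c; rewrite mul_diag_mx !mxE ev_al_xpol.
  rewrite det_mulmx det_diag; congr (_ * _).
  by apply: eq_bigr => i _; rewrite mxE.
have cc0 : 0 < \prod_i cc (ev_row i) by apply: prodr_gt0 => i _; apply: cc_gt0.
have dal0 : ev al (\det X) != 0 by rewrite dal mulf_neq0 // gt_eqF.
have nl : 1 <= `|ev al (\det X)| * `|ev be (\det X)| by apply: norm_lower; rewrite dal0.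
have dbe : `|ev be (\det X)| <= r`!%:R * \prod_(i < r)
    (U ^+ (ev_row i).1.1 * V ^+ (ev_row i).1.2 * expR (2 * `|mexp R (ev_row i)| * HT)).
  have -> : ev be (\det X) = \det (map_mx (ev be) X) by rewrite det_map_mx.
  by apply: det_le_prod => i c; rewrite !mxE; apply: ev_be_xpol.
have rho1 : 1 <= expR 2 :> R by have := expR_ge1Dx (2 : R); lra.
have hu c : `|(u c)%:~R : R| <= U by rewrite -intr_norm.
have hv c : `|(v c)%:~R : R| <= V by rewrite -intr_norm.
have dM' := det_entries_bound hu hv logX_le vZ rho1 U1 V1 VZ hq qt deS.
rewrite -/r -/M in dM'.
(* The 1 covers the factor 2 in front of Phi, as 2 <= e; lam occurs twice, for alpha and for
   beta. *)
pose E (i : 'I_r) : R := 1 + 2 * lam * ((ev_row i).1.1 + (ev_row i).1.2)%:R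
   + `|mexp R (ev_row i)| * Ccost.
have U0 : 0 < U by rewrite (lt_le_trans _ U1).
have V0 : 0 < V by rewrite (lt_le_trans _ V1).
have key : expR 2 ^+ theta r q t0 <= (r`!)%:R ^+ 2 * \prod_i expR (E i).
  have -> : (r`!)%:R ^+ 2 * \prod_i expR (E i) = (r`!)%:R * \prod_i (2 * (U ^+ (ev_row i).1.1 * V ^+ (ev_row i).1.2 *
      expR (`|mexp R (ev_row i)| * (expR 2 * Zmax)))) *
    ((r`!)%:R * \prod_i (expR (E i) / (2 * (U ^+ (ev_row i).1.1 * V ^+ (ev_row i).1.2 *
      expR (`|mexp R (ev_row i)| * (expR 2 * Zmax)))))).
    rewrite mulrACA -expr2 -big_split /=; congr (_ * _); apply: eq_bigr => i _.
    by rewrite mulrC divfK // !mulf_neq0 ?pnatr_eq0 ?expf_neq0 ?gt_eqF ?expR_gt0.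
  set P1 := _ * \prod_i (2 * _) in dM' *.
  have P10 : 0 <= P1 by apply: le_trans dM'; rewrite mulr_ge0 // exprn_ge0 // expR_ge0.
  apply: (@le_trans _ _ (P1 * ((\prod_i cc (ev_row i)) * `|ev be (\det X)|))).
    have nl' : 1 <= `|\det M| * ((\prod_i cc (ev_row i)) * `|ev be (\det X)|).
      by rewrite mulrA [`|\det M| * _]mulrC -{1}(gtr0_norm cc0) -normrM -dal.
    apply: (@le_trans _ _ (`|\det M| * expR 2 ^+ theta r q t0 * ((\prod_i cc (ev_row i)) * `|ev be (\det X)|))).
      by rewrite mulrAC ler_peMl // exprn_ge0 // expR_ge0.
    by rewrite ler_wpM2r // mulr_ge0 // ltW.
  rewrite ler_wpM2l //; apply: (@le_trans _ _ ((\prod_i cc (ev_row i)) * (r`!%:R * \prod_(i < r)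
    (U ^+ (ev_row i).1.1 * V ^+ (ev_row i).1.2 * expR (2 * `|mexp R (ev_row i)| * HT))))).
    by rewrite ler_wpM2l // ltW.
  rewrite mulrCA ler_wpM2l // -big_split /=; apply: ler_prod => i _.
  rewrite /E; move: (ev_row i) => j.
  have UU : 0 < U ^+ j.1.1 by rewrite exprn_gt0 // (lt_le_trans _ U1).
  have VV : 0 < V ^+ j.1.2 by rewrite exprn_gt0 // (lt_le_trans _ V1).
  apply/andP; split; first by rewrite !mulr_ge0 ?expR_ge0 ?(ltW (cc_gt0 j)) ?(ltW UU) ?(ltW VV).
  rewrite ler_pdivlMr; last by rewrite !mulr_gt0 ?expR_gt0.
  have hU : U ^+ j.1.1 <= expR (lam * (j.1.1 : nat)%:R).
    by rewrite expRM_natr; apply: lerXn2r; rewrite ?nnegrE ?expR_ge0 // (le_trans _ U1).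
  have hV : V ^+ j.1.2 <= expR (lam * (j.1.2 : nat)%:R).
    by rewrite expRM_natr; apply: lerXn2r; rewrite ?nnegrE ?expR_ge0 // (le_trans _ V1).
  have h2 : 2 <= expR 1 :> R by have := expR_ge1Dx (1 : R); lra.
  have hc := cc_le j.
  apply: (@le_trans _ _ (expR (2 * `|mexp R j| * HT) * (expR (lam * (j.1.1 : nat)%:R) * expR (lam * (j.1.2 : nat)%:R) * expR (2 * `|mexp R j| * HT))
      * (expR 1 * (expR (lam * (j.1.1 : nat)%:R) * expR (lam * (j.1.2 : nat)%:R) * expR (`|mexp R j| * (expR 2 * Zmax)))))).
    have UV : U ^+ j.1.1 * V ^+ j.1.2 <= expR (lam * (j.1.1 : nat)%:R) * expR (lam * (j.1.2 : nat)%:R).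
      by apply: ler_pM => //; apply: ltW.
    have UV0 : 0 <= U ^+ j.1.1 * V ^+ j.1.2 by rewrite mulr_ge0 // ltW.
    have UU0 := ltW UU; have VV0 := ltW VV; have cc0' := ltW (cc_gt0 j).
    apply: ler_pM; rewrite ?mulr_ge0 ?expR_ge0 //.
      apply: ler_pM; rewrite ?mulr_ge0 ?expR_ge0 //.
      by rewrite ler_wpM2r ?expR_ge0.
    apply: ler_pM; rewrite ?mulr_ge0 ?expR_ge0 //.
    by rewrite ler_wpM2r ?expR_ge0.
  rewrite -!expRD ler_expR; apply: ler_eq; rewrite CcostE natrD; ring.
have r0 : (0 < r)%N := r_gt0 k1 k2 Mh.
have rR : 0 < r%:R :> R by rewrite ltr0n.
have fact_le : (r`!)%:R <= expR (r%:R * ln r%:R) :> R.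
  rewrite expRM_natl lnK ?posrE // -natrX ler_nat; exact: fact_le_exp.
have sE : \sum_i E i <= r%:R * (1 + lam * (k1 + k2)%:R + Mh.+1%:R / 2 * Ccost).
  have sumE (F : T -> R) : \sum_(i < r) F (ev_row i) = \sum_t F t.
    rewrite [RHS](reindex_onto (@enum_val _ _) enum_rank) /=; last by move=> t _; rewrite enum_rankK.
    by apply: eq_bigl => j; rewrite enum_valK eqxx.
  rewrite (sumE (fun t : T => 1 + 2 * lam * (t.1.1 + t.1.2)%:R + `|mexp R t| * Ccost)).
  rewrite !big_split /= sumr_const -mulr_suml -mulr_sumr.
  have h1 : 2 * (\sum_(t : T) ((t.1.1 : nat) + t.1.2)%:R) = r%:R * (k1 + k2)%:R :> R.
    rewrite -natr_sum -!natrM; congr (_%:R); rewrite big_split /= mulnDr sum_i1 sum_i2.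
    by rewrite mulnDr.
  have h2 : \sum_(t : T) `|mexp R t| <= r%:R * (Mh.+1%:R / 2).
    under eq_bigr => t _ do rewrite mexpE.
    rewrite -natr_sum mulrA ler_pdivlMr // mulrC -!natrM ler_nat; exact: sum_m.
  have h3 : (\sum_(t : T) `|mexp R t|) * Ccost <= r%:R * (Mh.+1%:R / 2) * Ccost.
    by rewrite ler_wpM2r // Ccost_ge0.
  rewrite -[#|_|]/r [2 * lam * _](_ : _ = lam * (r%:R * (k1 + k2)%:R)); last by rewrite -h1; ring.
  apply: le_trans (lerD (lexx _) h3) _; apply: ler_eq; ring.
have th : r%:R * (t0%:R - 1) <= 2 * (theta r q t0)%:R :> R.
  have := theta_ge qt; rewrite -(ler_nat R) !natrM; apply: le_trans.
  by rewrite ler_wpM2l // lerBlDr natr1 ler_nat subn1 leqSpred.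
move: key; rewrite -expRM_natl -expR_sum => key.
have {}key : expR ((theta r q t0)%:R * 2) <= expR (2 * (r%:R * ln r%:R) + \sum_i E i) :> R.
  apply: le_trans key _; rewrite expRD ler_wpM2r ?expR_ge0 // expRM_natl.
  by apply: lerXn2r; rewrite ?nnegrE ?expR_ge0.
rewrite ler_expR in key.
have : r%:R * (t0%:R - 1) <= r%:R * (2 * ln r%:R + 1 + lam * (k1 + k2)%:R + Mh.+1%:R / 2 * Ccost).
  apply: le_trans th _; rewrite mulrC; apply: le_trans key _.
  by apply: le_trans (lerD (lexx _) sE) _; rewrite le_eqVlt; apply/orP; left; apply/eqP; ring.
by rewrite ler_pM2l // leNgt cost.
Qed.

Theorem det_rowfun_eq0 :
  \det (\matrix_(i < r, c < r) rowfun (enum_val i : T) (u c)%:~R (v c)%:~R (expR (logX c))) = 0.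
Proof.
have -> : \matrix_(i < r, c < r) rowfun (enum_val i : T) (u c)%:~R (v c)%:~R (expR (logX c)) =
   M *m diag_mx (\row_c expR (Mh%:R * logX c)).
  apply/matrixP => i c; rewrite mul_mx_diag !mxE /rowfun -!mulrA; congr (_ * (_ * _)).
  by rewrite -expRM_natl -expRD /mexp; congr expR; ring.
by rewrite det_mulmx det_interpolation_eq0 mul0r.
Qed.
End Vanish.

(** * Linear forms in three and in two logarithms *)

Definition tri (X : Type) (a b c : X) (l : 'I_3) : X :=
  match val l with 0 => a | 1 => b | _ => c end.

Lemma tri_forall (P : 'I_3 -> Prop) :
  P ord0 -> P (Ordinal (isT : (1 < 3)%N)) -> P (Ordinal (isT : (2 < 3)%N)) -> forall l, P l.
Proof.
move=> h0 h1 h2 [[|[|[|l]]] hl] //.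
- by rewrite (_ : Ordinal hl = ord0) //; apply: val_inj.
- by rewrite (_ : Ordinal hl = Ordinal (isT : (1 < 3)%N)) //; apply: val_inj.
- by rewrite (_ : Ordinal hl = Ordinal (isT : (2 < 3)%N)) //; apply: val_inj.
Qed.

Lemma tri_sum (V : nmodType) (F : 'I_3 -> V) :
  \sum_l F l = F ord0 + F (Ordinal (isT : (1 < 3)%N)) + F (Ordinal (isT : (2 < 3)%N)).
Proof.
rewrite !big_ord_recl big_ord0 addr0 addrA; congr (_ + F _ + F _); exact: val_inj.
Qed.

Lemma absz_center (n T : nat) : (n < 2 * T)%N -> (`|n%:Z - T%:Z| <= T)%N.
Proof. by lia. Qed.

Lemma absz_comb (i j : int) (A T T' : nat) : (`|i| <= T)%N -> (`|j| <= T')%N ->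
  (absz (i + A%:Z * j)%R <= T + A * T')%N.
Proof.
move=> hi hj; have h : (absz (A%:Z * j)%R <= A * T')%N by rewrite abszM absz_nat leq_mul2l hj orbT.
by move: h; move: (A%:Z * j) (A * T')%N => m n; lia.
Qed.

Section LogForms.
Variable R : realType.
Notation al := (@alpha R).
Notation be := (@beta R).

Lemma alpha_gt1 : 1 < al.
Proof.
have h : Num.sqrt 5 ^+ 2 = 5 :> R := sqrt5_sq R.
have : 0 <= Num.sqrt 5 :> R by exact: sqrtr_ge0.
by rewrite /alpha => h0; nra.
Qed.

Lemma beta_le1 : `|be| <= 1.
Proof.
have h : Num.sqrt 5 ^+ 2 = 5 :> R := sqrt5_sq R.
have : 0 <= Num.sqrt 5 :> R by exact: sqrtr_ge0.
by rewrite /beta => h0; rewrite ler_norml; apply/andP; split; nra.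
Qed.

Lemma alpha_gt0 : 0 < al. Proof. exact: lt_trans alpha_gt1. Qed.
Lemma ln_alpha_gt0 : 0 < ln al. Proof. exact: ln_gt0 alpha_gt1. Qed.

Section Three.
Variables (b A B k Mh t0 T1 T2 T3 t1 t2 t3 p1 p2 p3 : nat) (x y : {poly int}) (h g U V lam : R).
Let a := ln al.
Let lb : R := ln b%:R.
Hypothesis b2 : (2 <= b)%N.
Hypothesis x0 : 0 < ev al x.
Hypothesis y0 : 0 < ev al y.
Hypothesis xh : ev al x <= expR h.
Hypothesis yh : ev al y <= expR h.
Hypothesis xhb : `|ev be x| <= expR h.
Hypothesis yhb : `|ev be y| <= expR h.
Hypothesis h0 : 0 <= h.
Let lga := ln (ev al x) - ln (ev al y).
Hypothesis lg_g : `|lga| <= g.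
Let Lam := lga + A%:R * a - B%:R * lb.
Let L := (2 * Mh).+1.
Let r := #|rowT k k L|.
Hypothesis U1 : 1 <= U.
Hypothesis V1 : 1 <= V.
Hypothesis Ul : U <= expR lam.
Hypothesis Vl : V <= expR lam.
Hypothesis uU : T1%:R + A%:R * T3%:R <= U.
Hypothesis vV : T2%:R + B%:R * T3%:R <= V.
Hypothesis VZ : (expR 2 * (T1%:R * a + T2%:R * lb + T3%:R * g) + a * U) / lb <= V.
Hypothesis qt : ((2 * k).+1 * t0 <= r)%N.
Hypothesis deS : k%:R * (T3%:R * `|Lam| / lb) * expR 2 ^+ t0 <= 1 / 2.
Hypothesis cost : 2 * ln r%:R + 1 + lam * (k + k)%:R + Mh.+1%:R / 2 *
  (T1%:R * (expR 2 * a + 4 * a) + T2%:R * (expR 2 * lb + 4 * lb) + T3%:R * (expR 2 * g + 4 * h))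
  < t0%:R - 1.
Hypothesis n1 : (t1 + p1 <= 2 * T1)%N.
Hypothesis n2 : (t2 + p2 + L <= 2 * T2)%N.
Hypothesis n3 : (t3 + p3 <= 2 * T3)%N.
Hypothesis p1A : (p1 <= A)%N.
Hypothesis p20 : (0 < p2)%N.
Hypothesis p13 : (L * k < p1 * p3)%N.
Hypothesis p123 : (2 * (L * k) * (L * k) < p1 * p3 * p2)%N.
Hypothesis t12 : (L * k < t1 * t2)%N.
Hypothesis t23 : (L * k < t2 * t3)%N.

(** With centred exponents ln X - u ln alpha - v ln b = s3 Lambda, so v differs from an affine
    function of ln X and u by at most T3 |Lambda| / ln b. The numbers alpha and b enter as quotients
    with denominator 1. *)
Theorem three_log_alternative : exists (q : nat) (p r0 : int), [/\ (0 < q)%N,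
  q%:Z * B%:Z + p * A%:Z = r0, (q * t2 <= L * k)%N, (`|p| * t1 <= L * k)%N
  & (`|r0| * t3 <= L * k)%N].
Proof.
have a0 : 0 < a by exact: ln_alpha_gt0.
have b1 : (1 : R) < b%:R by rewrite ltr1n.
have lb0 : 0 < lb by exact: ln_gt0.
pose xx := tri ('X : {poly int}) (b%:Z)%:P x.
pose yy := tri (1 : {poly int}) 1 y.
pose Tb := tri T1 T2 T3.
pose HH := tri a lb h.
pose GG := tri a lb g.
pose C : finType := ('I_(2 * T1) * 'I_(2 * T2) * 'I_(2 * T3))%type.
pose sc (c : C) : 'I_3 -> int := tri ((c.1.1 : nat)%:Z - T1%:Z) ((c.1.2 : nat)%:Z - T2%:Z) ((c.2 : nat)%:Z - T3%:Z).
pose uc (c : C) : int := (c.1.1 : nat)%:Z - T1%:Z - A%:Z * ((c.2 : nat)%:Z - T3%:Z).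
pose vc (c : C) : int := (c.1.2 : nat)%:Z - T2%:Z + B%:Z * ((c.2 : nat)%:Z - T3%:Z).
pose lX (s1 s2 s3 : nat) : R := (s1%:R - T1%:R) * a + (s2%:R - T2%:R) * lb + (s3%:R - T3%:R) * lga.
pose lXc (c : C) : R := lX c.1.1 c.1.2 c.2.
apply: contrapT => nd.
have [sel] : exists sel : 'I_r -> C, \det (\matrix_(i, j < r)
    rowfun (enum_val i : rowT k k L) (uc (sel j))%:~R (vc (sel j))%:~R (expR (lXc (sel j)))) != 0.
  apply: (@minor_exists R (rowT k k L) C (fun i c => rowfun i (uc c)%:~R (vc c)%:~R (expR (lXc c)))).
  move=> w hw.
  pose X s1 s2 s3 := expR (lX s1 s2 s3).
  have hb0 : (0 : R) < b%:R by apply: lt_trans b1.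
  have hb1 : (b%:R : R) != 1 by rewrite gt_eqF.
  have hX0 s1 s2 s3 : X s1 s2 s3 != 0 by rewrite gt_eqF ?expR_gt0.
  have hX2 s1 s2 s3 j : X s1 (s2 + j)%N s3 = b%:R ^+ j * X s1 s2 s3.
    rewrite /X -[b%:R](lnK (x := b%:R)) ?posrE // -/lb.
    by rewrite -expRM_natl -expRD; congr expR; rewrite /lX natrD; ring.
  case: (@zero_estimate_three R k L A B (2 * T1) (2 * T2) (2 * T3) t1 t2 t3 p1 p2 p3
    (- T1%:R + A%:R * T3%:R) (- T2%:R - B%:R * T3%:R) b%:R X
    hb0 hb1 hX0 hX2 n1 n2 n3 p1A p20 p13 p123 t12 t23 w) => [s1 s2 s3 hs1 hs2 hs3|//|/nd //].
  rewrite -[RHS](hw (Ordinal hs1, Ordinal hs2, Ordinal hs3)).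
  apply: eq_bigr => i _; congr (w i * rowfun i _ _ _).
    by rewrite /uc /= !(rmorphB, rmorphM) /=; ring.
  by rewrite /vc /= !(rmorphB, rmorphD, rmorphM) /=; ring.
case/eqP.
have lgE l : lg R xx yy l = tri a lb lga l.
  apply: (tri_forall (P := fun l => lg R xx yy l = tri a lb lga l)) => //; rewrite /lg /xx /yy /tri /=.
  - by rewrite evX rmorph1 ln1 subr0.
  - by rewrite evC rmorph1 ln1 subr0.
have XE c : @logX R k k Mh xx yy (fun c => sc (sel c)) c = lXc (sel c).
  by rewrite /logX tri_sum !lgE /sc /tri /= !rmorphB.
have ZE : Zmax Tb GG = T1%:R * a + T2%:R * lb + T3%:R * g by rewrite /Zmax tri_sum.
have CE : Ccost Tb HH GG = T1%:R * (expR 2 * a + 4 * a) + T2%:R * (expR 2 * lb + 4 * lb) + T3%:R * (expR 2 * g + 4 * h).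
  by rewrite /Ccost tri_sum.
have b_e : b%:R <= expR lb :> R by rewrite lnK // posrE (lt_trans _ b1).
have ea : al = expR a by rewrite lnK // posrE alpha_gt0.
have sT c l : (`|sc c l| <= Tb l)%N.
  move: l; apply: (tri_forall (P := fun l => (`|sc c l| <= Tb l)%N)); rewrite /sc /Tb /tri /=.
  - exact: absz_center (ltn_ord c.1.1).
  - exact: absz_center (ltn_ord c.1.2).
  - exact: absz_center (ltn_ord c.2).
have absR (n : int) m : (`|n| <= m)%N -> `|n|%:~R <= m%:R :> R.
  by move=> nm; rewrite -natr_absz ler_nat.
have := @det_rowfun_eq0 R k k Mh (2 * k).+1 t0 xx yy Tb HH GG _ _ _ _ _ _ _ _
  (fun c => sc (sel c)) (fun c => uc (sel c)) (fun c => vc (sel c)) _ U V lam a lb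
  (T3%:R * `|Lam| / lb) _ _ U1 V1 Ul Vl _ _ _ qt deS _.
rewrite -/L -/r => H.
under [X in \det X]eq_mx => i j do rewrite -XE.
apply: H.
- by apply: tri_forall; rewrite /xx /tri /= ?evX ?evC ?ltr0z //; [exact: alpha_gt0 | exact: ltnW].
- by apply: tri_forall; rewrite /yy /tri /= ?rmorph1.
- by apply: tri_forall; rewrite /xx /HH /tri /= ?evX ?evC // ea.
- apply: tri_forall; rewrite /yy /HH /tri /= ?rmorph1 // -expR0 ler_expR; exact: ltW.
- apply: tri_forall; rewrite /xx /HH /tri /= ?evX ?evC //.
    apply: le_trans beta_le1 _; rewrite -expR0 ler_expR; exact: ltW.
  by rewrite ger0_norm // ler0z.
- apply: tri_forall; rewrite /yy /HH /tri /= ?rmorph1 ?normr1 //; rewrite -expR0 ler_expR; exact: ltW.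
- apply: tri_forall; rewrite /HH /tri /= //; exact: ltW.
- move=> l; rewrite lgE; move: l; apply: tri_forall; rewrite /GG /tri /=.
  + by rewrite gtr0_norm.
  + by rewrite gtr0_norm.
  + exact: lg_g.
- by move=> c l; apply: sT.
- move=> c; apply: le_trans uU; rewrite -natrM -natrD; apply: absR.
  rewrite /uc -mulrN; apply: absz_comb; first exact: absz_center (ltn_ord _).
  by rewrite abszN; exact: absz_center (ltn_ord _).
- move=> c; apply: le_trans vV; rewrite -natrM -natrD; apply: absR.
  by rewrite /vc; apply: absz_comb; exact: absz_center (ltn_ord _).
- move=> c; rewrite XE /lXc /lX /uc /vc.
  have h3 : (`|(sel c).2%:Z - T3%:Z| <= T3)%N := absz_center (ltn_ord _).
  have {}h3 := absR _ _ h3; rewrite intr_norm rmorphB /= in h3.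
  rewrite (_ : _ - _ = - (((sel c).2%:R - T3%:R) * Lam / lb)); last first.
    by rewrite /Lam !(rmorphB, rmorphD, rmorphM) /=; field; rewrite gt_eqF.
  rewrite normrN !normrM normfV (gtr0_norm lb0) ler_wpM2r ?invr_ge0 ?(ltW lb0) //.
  by rewrite ler_wpM2r.
- by rewrite ZE gtr0_norm // gtr0_norm.
- by left; rewrite addnn -mul2n.
- by rewrite CE.
Qed.
End Three.

Section Two.
Variables (B k Mh t0 T1 T2 : nat) (x1 y1 x2 y2 : {poly int}) (h1 h2 V lam : R).
Hypothesis x10 : 0 < ev al x1.
Hypothesis y10 : 0 < ev al y1.
Hypothesis x20 : 0 < ev al x2.
Hypothesis y20 : 0 < ev al y2.
Hypothesis x1h : ev al x1 <= expR h1.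
Hypothesis y1h : ev al y1 <= expR h1.
Hypothesis x2h : ev al x2 <= expR h2.
Hypothesis y2h : ev al y2 <= expR h2.
Hypothesis x1hb : `|ev be x1| <= expR h1.
Hypothesis y1hb : `|ev be y1| <= expR h1.
Hypothesis x2hb : `|ev be x2| <= expR h2.
Hypothesis y2hb : `|ev be y2| <= expR h2.
Hypothesis h10 : 0 <= h1.
Hypothesis h20 : 0 <= h2.
Let g1 := ln (ev al x1) - ln (ev al y1).
Let g2 := ln (ev al x2) - ln (ev al y2).
Hypothesis g20 : g2 != 0.
Let Lam := g1 + B%:R * g2.
Let L := (2 * Mh).+1.
Let r := #|rowT 0 k L|.
Hypothesis V1 : 1 <= V.
Hypothesis Vl : V <= expR lam.
Hypothesis lam0 : 0 <= lam.
Hypothesis vV : T2%:R + B%:R * T1%:R <= V.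
Hypothesis VZ : (expR 2 * (T1%:R * `|g1| + T2%:R * `|g2|)) / `|g2| <= V.
Hypothesis qt : (t0 <= r)%N.
Hypothesis deS : k%:R * (T1%:R * `|Lam| / `|g2|) * expR 2 ^+ t0 <= 1 / 2.
Hypothesis cost : 2 * ln r%:R + 1 + lam * k%:R + Mh.+1%:R / 2 *
  (T1%:R * (expR 2 * `|g1| + 4 * h1) + T2%:R * (expR 2 * `|g2| + 4 * h2)) < t0%:R - 1.
Hypothesis NB : (2 * T2 <= B)%N.
Hypothesis N12 : (L * k < 2 * T1 * (2 * T2 - L))%N.

(** Here ln X = s1 g1 + s2 g2 and v = s2 - B s1, so that ln X - v g2 = s1 Lambda. The third
    logarithm is that of 1, with range 0, and u = 0. *)
Theorem two_log_contradiction : False.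
Proof.
pose xx := tri x1 x2 1.
pose yy := tri y1 y2 1.
pose Tb := tri T1 T2 0%N.
pose HH := tri h1 h2 0.
pose GG := tri `|g1| `|g2| 0.
pose C : finType := ('I_(2 * T1) * 'I_(2 * T2))%type.
pose sc (c : C) : 'I_3 -> int := tri ((c.1 : nat)%:Z - T1%:Z) ((c.2 : nat)%:Z - T2%:Z) 0.
pose vc (c : C) : int := (c.2 : nat)%:Z - T2%:Z - B%:Z * ((c.1 : nat)%:Z - T1%:Z).
pose lX (s1 s2 : nat) : R := (s1%:R - T1%:R) * g1 + (s2%:R - T2%:R) * g2.
pose lXc (c : C) : R := lX c.1 c.2.
have [sel] : exists sel : 'I_r -> C, \det (\matrix_(i, j < r)
    rowfun (enum_val i : rowT 0 k L) (0 : int)%:~R (vc (sel j))%:~R (expR (lXc (sel j)))) != 0.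
  apply: (@minor_exists R (rowT 0 k L) C (fun i c => rowfun i (0 : int)%:~R (vc c)%:~R (expR (lXc c)))).
  move=> w hw.
  pose X s1 s2 := expR (lX s1 s2).
  have hb0 : 0 < expR g2 by exact: expR_gt0.
  have hb1 : expR g2 != 1 by rewrite -expR0 (inj_eq (@expR_inj _)).
  have hX0 s1 s2 : X s1 s2 != 0 by rewrite gt_eqF ?expR_gt0.
  have hX2 s1 s2 j : X s1 (s2 + j)%N = expR g2 ^+ j * X s1 s2.
    by rewrite /X -expRM_natl -expRD; congr expR; rewrite /lX natrD; ring.
  apply: (@zero_estimate_two R k L B (2 * T1) (2 * T2) (- T2%:R + B%:R * T1%:R) (expR g2) X
    hb0 hb1 hX0 hX2 NB N12 w (0 : int)%:~R) => s1 s2 hs1 hs2.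
  rewrite -[RHS](hw (Ordinal hs1, Ordinal hs2)).
  apply: eq_bigr => i _; congr (w i * rowfun i _ _ _).
  by rewrite /vc /= !(rmorphB, rmorphM) /=; ring.
case/eqP.
have lgE l : lg R xx yy l = tri g1 g2 0 l.
  apply: (tri_forall (P := fun l => lg R xx yy l = tri g1 g2 0 l)) => //; rewrite /lg /xx /yy /tri /=.
  by rewrite rmorph1 ln1 subr0.
have XE c : @logX R 0 k Mh xx yy (fun c => sc (sel c)) c = lXc (sel c).
  by rewrite /logX tri_sum !lgE /sc /tri /= !rmorphB /= mul0r addr0.
have ZE : Zmax Tb GG = T1%:R * `|g1| + T2%:R * `|g2| by rewrite /Zmax tri_sum /tri /= mul0r addr0.
have CE : Ccost Tb HH GG = T1%:R * (expR 2 * `|g1| + 4 * h1) + T2%:R * (expR 2 * `|g2| + 4 * h2).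
  by rewrite /Ccost tri_sum /tri /= mul0r addr0.
have sT c l : (`|sc c l| <= Tb l)%N.
  move: l; apply: (tri_forall (P := fun l => (`|sc c l| <= Tb l)%N)); rewrite /sc /Tb /tri //=.
  - exact: absz_center (ltn_ord c.1).
  - exact: absz_center (ltn_ord c.2).
have absR (n : int) m : (`|n| <= m)%N -> `|n|%:~R <= m%:R :> R.
  by move=> nm; rewrite -natr_absz ler_nat.
have := @det_rowfun_eq0 R 0 k Mh 1 t0 xx yy Tb HH GG _ _ _ _ _ _ _ _
  (fun c => sc (sel c)) (fun c => 0) (fun c => vc (sel c)) _ 1 V lam 0 g2
  (T1%:R * `|Lam| / `|g2|) _ _ _ V1 _ Vl _ _ _ _ deS _.
rewrite -/L -/r => H.
under [X in \det X]eq_mx => i j do rewrite -XE.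
apply: H.
- by apply: tri_forall; rewrite /xx /tri /= ?rmorph1.
- by apply: tri_forall; rewrite /yy /tri /= ?rmorph1.
- by apply: tri_forall; rewrite /xx /HH /tri /= ?rmorph1 ?expR0.
- by apply: tri_forall; rewrite /yy /HH /tri /= ?rmorph1 ?expR0.
- by apply: tri_forall; rewrite /xx /HH /tri /= ?rmorph1 ?expR0 ?normr1.
- by apply: tri_forall; rewrite /yy /HH /tri /= ?rmorph1 ?expR0 ?normr1.
- by apply: tri_forall; rewrite /HH /tri.
- by move=> l; rewrite lgE; move: l; apply: tri_forall; rewrite /GG /tri /= ?normr0.
- by move=> c l; apply: sT.
- by move=> c; rewrite normr0.
- move=> c; apply: le_trans vV; rewrite -natrM -natrD; apply: absR.
  rewrite /vc -mulrN; apply: absz_comb; first exact: absz_center (ltn_ord _).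
  by rewrite abszN; exact: absz_center (ltn_ord _).
- by [].
- by rewrite -expR0 ler_expR.
- move=> c; rewrite XE /lXc /lX /vc mul0r subr0.
  have h3 : (`|(sel c).1%:Z - T1%:Z| <= T1)%N := absz_center (ltn_ord _).
  have {}h3 := absR _ _ h3; rewrite intr_norm rmorphB /= in h3.
  rewrite (_ : _ - _ = - (((sel c).1%:R - T1%:R) * Lam / g2)); last first.
    by rewrite /Lam !(rmorphB, rmorphD, rmorphM) /=; field.
  by rewrite normrN !normrM normfV ler_wpM2r ?invr_ge0 // ler_wpM2r.
- by rewrite ZE normr0 mul0r addr0.
- by right.
- by rewrite mul1n.
- by rewrite CE add0n.
Qed.
End Two.
End LogForms.

(** * Choice of the parameters *)

Section Num.
Variable R : realType.

Lemma nat_floor (z : R) : 0 <= z -> exists n : nat, n%:R <= z /\ z < n%:R + 1.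
Proof.
move=> z0; exists (Num.truncn z); have := truncn_itv z0 => /andP[h1 h2].
by rewrite natr1.
Qed.

Lemma nat_ceil (z : R) : 0 <= z -> exists n : nat, z <= n%:R /\ n%:R < z + 1.
Proof.
move=> z0; have [n [h1 h2]] := nat_floor z0.
have [e|e] := eqVneq z n%:R; first by exists n; rewrite -e lexx ltrDl.
exists n.+1; rewrite -natr1; split; first exact: ltW.
by rewrite ltrD2r lt_neqAle eq_sym e.
Qed.

Lemma expR_small (x c : R) : 0 <= c -> 1 <= c * (1 - x) -> expR x <= c.
Proof.
move=> c0 h; rewrite -[x in expR x]opprK expRN -[leLHS]mul1r ler_pdivrMr ?expR_gt0 //.
by apply: le_trans h _; rewrite ler_wpM2l // expR_ge1Dx.
Qed.

Lemma expR_sqr_le (x c d : R) : expR x <= c -> c * c <= d -> expR (x + x) <= d.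
Proof.
move=> h1 h2; rewrite expRD; apply: le_trans h2.
by apply: ler_pM; rewrite ?expR_ge0.
Qed.

(** The bound 96/95 for e^(1/96) is cubed, then squared six times, with rational rounding after each
    operation; the numerical bounds below are obtained in the same way. *)
Lemma expR2_le : expR 2 <= 15 / 2 :> R.
Proof.
have h0 : expR (1 / 96) <= 96 / 95 :> R.
  by apply: expR_small; lra.
have {}h0 : expR (1 / 32) <= 1 + 399 / (125 * 100) :> R.
  rewrite (_ : 1 / 32 = 1 / 96 * 3%:R); last by lra.
  rewrite expRM_natr; apply: le_trans (_ : (96 / 95) ^+ 3 <= _); last by lra.
  by apply: lerXn2r => //; rewrite nnegrE ?expR_ge0 //; lra.
have {}h0 := expR_sqr_le (d := 1 + 3243 / (50 * 1000)) h0 ltac:(lra).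
have {}h0 := expR_sqr_le (d := 1134 / 1000) h0 ltac:(lra).
have {}h0 := expR_sqr_le (d := 1286 / 1000) h0 ltac:(lra).
have {}h0 := expR_sqr_le (d := 8269 / 5000) h0 ltac:(lra).
have {}h0 := expR_sqr_le (d := 2 + 7351 / (100 * 100)) h0 ltac:(lra).
have {}h0 := expR_sqr_le (d := 15 / 2) h0 ltac:(lra).
by apply: le_trans h0; rewrite ler_expR; lra.
Qed.

Lemma expR_sqr_ge (x c d : R) : c <= expR x -> 0 <= c -> d <= c * c -> d <= expR (x + x).
Proof. by move=> h1 c0 h2; rewrite expRD; apply: le_trans h2 _; apply: ler_pM. Qed.

Lemma ln_alpha_le : ln (@alpha R) <= 1 / 2.
Proof.
rewrite -ler_expR lnK ?posrE ?alpha_gt0 //.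
have h0 : 33 / 32 <= expR (1 / 32) :> R.
  by apply: le_trans (expR_ge1Dx _); lra.
have {}h0 := expR_sqr_ge (d := 1063 / 1000) h0 ltac:(lra) ltac:(lra).
have {}h0 := expR_sqr_ge (d := 1129 / 1000) h0 ltac:(lra) ltac:(lra).
have {}h0 := expR_sqr_ge (d := 1274 / 1000) h0 ltac:(lra) ltac:(lra).
have {}h0 := expR_sqr_ge (d := 1623 / 1000) h0 ltac:(lra) ltac:(lra).
have h : Num.sqrt 5 <= 2245 / 1000 :> R.
  by rewrite -(ler_sqr (x := Num.sqrt 5)) ?nnegrE ?sqrtr_ge0 ?sqrt5_sq; lra.
apply: le_trans (_ : 1623 / 1000 <= _); first by rewrite /alpha; lra.
by apply: le_trans h0 _; rewrite ler_expR; lra.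
Qed.

Lemma ln_alpha_ge : 4 / 10 <= ln (@alpha R).
Proof.
rewrite -ler_expR lnK ?posrE ?alpha_gt0 //.
have h0 : expR (1 / 10) <= (1112 / 1000) :> R.
  by apply: expR_small; lra.
have {}h0 := expR_sqr_le (d := (1237 / 1000)) h0 ltac:(lra).
have {}h0 := expR_sqr_le (d := (1531 / 1000)) h0 ltac:(lra).
have h : (22 / 10) <= Num.sqrt 5 :> R.
  by rewrite -(ler_sqr (y := Num.sqrt 5)) ?nnegrE ?sqrtr_ge0 ?sqrt5_sq; lra.
apply: le_trans (_ : (1531 / 1000) <= _); last by rewrite /alpha; lra.
by apply: le_trans h0; rewrite ler_expR; lra.
Qed.

Lemma ln2_ge : (68 / 100) <= ln 2 :> R.
Proof.
rewrite -ler_expR lnK ?posrE //.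
have h0 : expR (17 / 800) <= 5109 / 5000 :> R.
  by apply: expR_small; lra.
have {}h0 := expR_sqr_le (d := 10441 / (100 * 100)) h0 ltac:(lra).
have {}h0 := expR_sqr_le (d := 5451 / 5000) h0 ltac:(lra).
have {}h0 := expR_sqr_le (d := 5943 / 5000) h0 ltac:(lra).
have {}h0 := expR_sqr_le (d := 1766 / 1250) h0 ltac:(lra).
have {}h0 := expR_sqr_le (d := 2) h0 ltac:(lra).
by apply: le_trans h0; rewrite ler_expR; lra.
Qed.
End Num.

Lemma subr_mul_ge0 (R : realFieldType) (a b c d : R) : a <= b -> c <= d -> 0 <= (b - a) * (d - c).
Proof. by move=> h1 h2; rewrite mulr_ge0 // subr_ge0. Qed.

Section Num3.
Variable R : realFieldType.

(** Q is the unit in which K is measured. Against it lam, lam lb and lam h are negligible, which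
    absorbs the rounding of K, M and of the ranges T1, T2, T3. *)
Lemma Q_bounds (lam lb h : R) (Q := 10 ^+ 6 * (lam * lam * (lb * h))) :
  200 <= lam -> 17 / 25 <= lb -> lb <= h ->
  [/\ 9 * 10 ^+ 7 * lam <= Q, 13 * 10 ^+ 7 * (lam * lb) <= Q
    & 13 * 10 ^+ 7 * (lam * h) <= Q].
Proof.
move=> h1 h2 h3; have h4 := le_trans h2 h3.
have ll : 200 * lam <= lam * lam by have := subr_mul_ge0 h1 h1; lra.
have lh0 : 46 / 100 <= lb * h by have := subr_mul_ge0 h2 h4; lra.
have lh1 : 17 / 25 * lb <= lb * h by have := subr_mul_ge0 h2 h4; lra.
have lh2 : 17 / 25 * h <= lb * h by have := subr_mul_ge0 h2 h4; lra.
have c0 : 0 <= 200 * lam by lra.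
rewrite /Q; split.
- have := ler_pM c0 _ ll lh0; move=> /(_ ltac:(lra)); lra.
- have p0 : 0 <= lam * lb by rewrite mulr_ge0 //; lra.
  have := ler_pM c0 _ ll lh1; move=> /(_ ltac:(lra)); lra.
- have p0 : 0 <= lam * h by rewrite mulr_ge0 //; lra.
  have := ler_pM c0 _ ll lh2; move=> /(_ ltac:(lra)); lra.
Qed.

(** Z is the left side of [VZ]; adding it to V makes that hypothesis immediate. The terms A T3 and B
    T3 dominate, with T3 of order K / h, that is 10^6 D. *)
Lemma three_log_sizes (lam lb h Q K T1 T2 T3 A B n E a : R) (D := lam * lam * lb) :
  200 <= lam -> 17 / 25 <= lb -> lb <= h -> Q = 10 ^+ 6 * (D * h) ->
  K <= 30 * Q + 1 -> 19 * T1 <= K -> 38 * (T2 * lb) <= K -> 38 * (T3 * h) <= K ->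
  0 <= T1 -> 0 <= T2 -> 0 <= T3 ->
  A <= n -> B <= n -> 100 * Q <= n -> 0 <= A -> 0 <= B -> E <= 15 / 2 -> 0 <= E -> 0 <= a -> a <= 1 / 2 ->
  let U := 1 + T1 + A * T3 in
  let Z := (E * (T1 * a + T2 * lb + T3 * h) + a * U) / lb in
  [/\ 0 <= Z, U <= 4 * 10 ^+ 6 * (D * n) & 1 + T2 + B * T3 + Z <= 4 * 10 ^+ 6 * (D * n)].
Proof.
move=> h1 h2 h3 QE kQ t1 t2 t3 t10 t20 t30 An Bn Qn A0 B0 E15 E0 a0 a1 U Z.
have hh := le_trans h2 h3.
have D1 : 10 ^+ 4 <= D.
  have ll := ler_pM (ltac:(lra) : 0 <= 200) (ltac:(lra) : 0 <= 200 :> R) h1 h1.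
  have := ler_pM (ltac:(lra) : 0 <= 200 * 200) (ltac:(lra) : 0 <= 17 / 25 :> R) ll h2.
  by rewrite /D; lra.
have Q1 : 10 ^+ 9 <= Q.
  have := ler_pM (ltac:(lra) : 0 <= 10 ^+ 4) (ltac:(lra) : 0 <= 17 / 25 :> R) D1 hh.
  by rewrite QE; lra.
have n0 : 10 ^+ 11 <= n by clear - Qn Q1; lra.
have T1n : T1 <= 17 / 1000 * n by clear - t1 kQ Qn Q1; lra.
have t2' : T2 * lb <= 81 / 100 * Q by clear - t2 kQ Q1; lra.
have t3' : T3 * h <= 81 / 100 * Q by clear - t3 kQ Q1; lra.
have T2n : T2 <= 17 / 1000 * n.
  have : T2 * (17 / 25) <= T2 * lb by rewrite ler_wpM2l.
  by clear - Qn t2' Q1; lra.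
have T3D : T3 <= 81 * 10 ^+ 4 * D.
  have h0 : 0 < h by clear - hh; lra.
  by rewrite -(ler_pM2r h0); clear - t3' QE; rewrite QE in t3'; lra.
have AT : A * T3 <= 81 * 10 ^+ 4 * (D * n).
  have := ler_pM A0 t30 An T3D; clear; lra.
have BT : B * T3 <= 81 * 10 ^+ 4 * (D * n).
  have := ler_pM B0 t30 Bn T3D; clear; lra.
have Dn : 10 ^+ 4 * n <= D * n by rewrite ler_wpM2r //; clear -n0; lra.
have UU : U <= 82 * 10 ^+ 4 * (D * n).
  by rewrite /U; clear - T1n AT Dn n0; lra.
have U0 : 0 <= U by rewrite /U; have := mulr_ge0 A0 t30; clear - t10; lra.
have lb0 : 0 < lb by clear - h2; lra.
have T1a : T1 * a <= 81 / 100 * Q.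
  have : T1 * a <= T1 * (1 / 2) by rewrite ler_wpM2l.
  by clear - t1 kQ Q1; lra.
have S0 : 0 <= T1 * a + T2 * lb + T3 * h.
  by rewrite !addr_ge0 // mulr_ge0 // ltW //; clear - hh; lra.
have SQ : E * (T1 * a + T2 * lb + T3 * h) <= 19 * Q.
  have := ler_pM E0 S0 E15 (lexx _); clear - T1a t2' t3' Q1; lra.
have aU : a * U <= 41 * 10 ^+ 4 * (D * n).
  have : a * U <= 1 / 2 * U by rewrite ler_wpM2r.
  by clear - UU; lra.
have Z0 : 0 <= Z.
  by rewrite /Z; apply: divr_ge0; [apply: addr_ge0; apply: mulr_ge0 | exact: ltW].
have ZZ : Z <= 82 * 10 ^+ 4 * (D * n).
  rewrite /Z ler_pdivrMr //.
  have : 82 * 10 ^+ 4 * (D * n) * (17 / 25) <= 82 * 10 ^+ 4 * (D * n) * lb.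
    by rewrite ler_wpM2l //; clear - Dn n0; lra.
  by clear - SQ aU Qn Dn n0 Q1; lra.
split => //; first by clear - UU Dn n0; lra.
by clear - T2n BT ZZ Dn n0; lra.
Qed.
(** Each range times its logarithm is at most K / 38, the first because ln alpha <= 1/2, and e^2 + 4
    <= 23/2. The margin of 7/38 lam K, with lam >= 200, pays for all terms of lower order. *)
Lemma three_log_cost (lam lb h Q K M T1 T2 T3 t0 E a lr : R) :
  200 <= lam -> 10 ^+ 9 <= Q -> 9 * 10 ^+ 7 * lam <= Q -> 30 * Q <= K ->
  4 * lam <= M -> M <= 4 * lam + 1 -> 2 * lr <= 6 * K + 10 ->
  (K + 1) * (2 * M + 1) <= 2 * t0 + 1 ->
  19 * T1 <= K -> 38 * (T2 * lb) <= K -> 38 * (T3 * h) <= K ->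
  0 <= T1 -> 0 <= T2 * lb -> 0 <= T3 * h -> E <= 15 / 2 -> 0 <= E -> 0 <= a -> a <= 1 / 2 ->
  2 * lr + 1 + lam * (K + K) + (M + 1) / 2 * (T1 * (E * a + 4 * a) + T2 * (E * lb + 4 * lb)
    + T3 * (E * h + 4 * h)) < t0 - 1.
Proof.
move=> l2 Q9 Ql KQ M4 M5 hlr ht t1 t2 t3 t10 t20 t30 E15 E0 a0 a1.
have T1a : T1 * a <= 1 / 38 * K.
  have : T1 * a <= T1 * (1 / 2) by rewrite ler_wpM2l.
  by clear - t1; lra.
have S0 : 0 <= T1 * a + T2 * lb + T3 * h by rewrite !addr_ge0 // mulr_ge0.
have -> : T1 * (E * a + 4 * a) + T2 * (E * lb + 4 * lb) + T3 * (E * h + 4 * h)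
   = (E + 4) * (T1 * a + T2 * lb + T3 * h) by ring.
have S1 : (E + 4) * (T1 * a + T2 * lb + T3 * h) <= 23 / 2 * (3 / 38 * K).
  by apply: ler_pM => //; clear - E0 E15 T1a t2 t3; lra.
have S2 : (M + 1) / 2 * ((E + 4) * (T1 * a + T2 * lb + T3 * h)) <= (2 * lam + 1) * (23 / 2 * (3 / 38 * K)).
  apply: ler_pM => //; first by clear - M4 l2; lra.
    by apply: mulr_ge0 => //; clear - E0; lra.
  by clear - M5; lra.
have K0 : 0 <= K by clear - KQ Q9; lra.
have S3 : (K + 1) * (8 * lam + 1) <= (K + 1) * (2 * M + 1).
  by apply: ler_wpM2l; clear - K0 M4; lra.
have S4 : 200 * K <= lam * K by rewrite ler_wpM2r.
by clear - l2 KQ Q9 Ql hlr ht S2 S3 S4; lra.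
Qed.

(** Each side 2 T is split into t, about 3 T / 2, and p, about T / 2, where p2 gives up L values.
    The larger share goes to t because the coefficients in the alternative are at most D / t. *)
Lemma three_log_counts (lam lb h Q K L T1 T2 T3 p1 p2 p3 t1 t2 t3 : R) :
  200 <= lam -> 17 / 25 <= lb -> lb <= h -> 10 ^+ 9 <= Q ->
  13 * 10 ^+ 7 * (lam * lb) <= Q -> 13 * 10 ^+ 7 * (lam * h) <= Q ->
  30 * Q <= K -> L <= 8 * lam + 3 ->
  K <= 19 * T1 + 19 -> K <= 38 * (T2 * lb) + 38 * lb -> K <= 38 * (T3 * h) + 38 * h ->
  T1 - 1 <= 2 * p1 -> T2 - 1 - 2 * L <= 2 * p2 -> T3 - 1 <= 2 * p3 ->
  3 * T1 <= 2 * t1 -> 3 * T2 <= 2 * t2 -> 3 * T3 <= 2 * t3 ->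
  [/\ 99 / 100 * K <= 38 * p1, 99 / 100 * K <= 76 * (p2 * lb) & 99 / 100 * K <= 76 * (p3 * h)] /\
  [/\ 2997 / 1000 * K <= 38 * t1, 2997 / 1000 * K <= 76 * (t2 * lb) & 2997 / 1000 * K <= 76 * (t3 * h)].
Proof.
move=> l2 h2 h3 Q9 Qlb Qh KQ L8 T1u T2u T3u e1 e2 e3 f1 f2 f3.
have hh := le_trans h2 h3.
have lb0 : 0 <= lb by clear - h2; lra.
have h0 : 0 <= h by clear - hh; lra.
have llb : 200 * lb <= lam * lb by rewrite ler_wpM2r.
have lh : 200 * h <= lam * h by rewrite ler_wpM2r.
have e2' : (T2 - 1 - 2 * L) * lb <= 2 * p2 * lb by rewrite ler_wpM2r.
have e3' : (T3 - 1) * h <= 2 * p3 * h by rewrite ler_wpM2r.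
have f2' : 3 * T2 * lb <= 2 * t2 * lb by rewrite ler_wpM2r.
have f3' : 3 * T3 * h <= 2 * t3 * h by rewrite ler_wpM2r.
have Llb : L * lb <= (8 * lam + 3) * lb by rewrite ler_wpM2r.
split; split.
- by clear - Q9 KQ T1u e1; lra.
- by clear - e2' Llb Qlb KQ T2u llb lb0; lra.
- by clear - e3' Qh KQ T3u lh h0; lra.
- by clear - Q9 KQ T1u f1; lra.
- by clear - f2' Qlb KQ T2u llb lb0; lra.
- by clear - f3' Qh KQ T3u lh h0; lra.
Qed.

Lemma three_log_conditions (lam lb h K L p1 p2 p3 t1 t2 t3 : R) (Q := 10 ^+ 6 * (lam * lam * (lb * h))) :
  200 <= lam -> 17 / 25 <= lb -> lb <= h -> 10 ^+ 9 <= Q ->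
  13 * 10 ^+ 7 * (lam * h) <= Q ->
  30 * Q <= K -> L <= 8 * lam + 3 -> 0 < L ->
  [/\ 99 / 100 * K <= 38 * p1, 99 / 100 * K <= 76 * (p2 * lb) & 99 / 100 * K <= 76 * (p3 * h)] ->
  [/\ 2997 / 1000 * K <= 38 * t1, 2997 / 1000 * K <= 76 * (t2 * lb) & 2997 / 1000 * K <= 76 * (t3 * h)] ->
  [/\ L * K < p1 * p3, 2 * (L * K) * (L * K) < p1 * p3 * p2, L * K < t1 * t2 & L * K < t2 * t3].
Proof.
move=> l2 h2 h3 Q9 Qh KQ L8 L0 [e1 e2 e3] [f1 f2 f3].
have hh := le_trans h2 h3.
have lb0 : 0 < lb by clear - h2; lra.
have h0 : 0 < h by clear - hh; lra.
have lam0 : 0 < lam by clear - l2; lra.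
have L8' : L <= 1603 / 200 * lam by clear - L8 l2; lra.
have K0 : 0 < K by clear - KQ Q9; lra.
have c0 : 0 <= 99 / 100 * K by clear - K0; lra.
have d0 : 0 <= 2997 / 1000 * K by clear - K0; lra.
have lh0 : 0 < lam * h by rewrite mulr_gt0.
have Lh : L * h <= 1603 / 200 * (lam * h) by rewrite mulrA ler_wpM2r // ltW.
have LhK : L * h * K <= 1603 / 200 * (lam * h) * K by rewrite ler_wpM2r // ltW.
have KK : 39 * 10 ^+ 8 * (lam * h) * K <= K * K.
  by rewrite ler_wpM2r ?(ltW K0) //; clear - Qh KQ; lra.
have lhK : 0 < lam * h * K by rewrite mulr_gt0.
have E1 := ler_pM c0 c0 e1 e3.
have F1 := ler_pM d0 d0 f1 f2.
have F2 := ler_pM d0 d0 f2 f3.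
have C1 : L * K < p1 * p3.
  by rewrite -(ltr_pM2r h0); clear - E1 LhK KK lhK; lra.
split => //.
- have cc0 : 0 <= 99 / 100 * K * (99 / 100 * K) by rewrite mulr_ge0.
  have E2 := ler_pM cc0 c0 E1 e2.
  have lbh0 : 0 < lb * h by rewrite mulr_gt0.
  rewrite -(ltr_pM2r lbh0).
  have LL : L * L <= 1603 / 200 * lam * (1603 / 200 * lam) by apply: ler_pM => //; exact: ltW.
  have LL2 : L * L * (lb * h * (K * K)) <= 1603 / 200 * lam * (1603 / 200 * lam) * (lb * h * (K * K)).
    by rewrite ler_wpM2r // ?mulr_ge0 // ltW.
  have KKK : 30 * Q * (K * K) <= K * (K * K) by rewrite ler_wpM2r // mulr_ge0 // ltW.
  have P0 : 0 < K * (K * K) by rewrite !mulr_gt0.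
  rewrite /Q in KKK.
  by clear - LL2 KKK P0 E2; lra.
- rewrite -(ltr_pM2r lb0).
  have Llb : L * K * lb <= L * K * h.
    by rewrite ler_wpM2l // mulr_ge0 // ltW.
  by clear - F1 Llb LhK KK lhK; lra.
- have lbh0 : 0 < lb * h by rewrite mulr_gt0.
  rewrite -(ltr_pM2r lbh0).
  have LL2 : L * (lb * h * K) <= 1603 / 200 * lam * (lb * h * K).
    by rewrite ler_wpM2r // ?mulr_ge0 // ltW.
  have KKK : 30 * Q * K <= K * K by rewrite ler_wpM2r // ltW.
  have ll : 200 * lam * (lb * h * K) <= lam * lam * (lb * h * K).
    by rewrite ler_wpM2r // ?mulr_ge0 // ?ler_wpM2r // ltW.
  have P0 : 0 < K * K by rewrite !mulr_gt0.
  rewrite /Q in KKK.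
  by clear - LL2 KKK P0 F2 ll; lra.
Qed.

(** The number 204 is 76 * 8.015 / 2.997 rounded up, 8.015 lam being a bound for L. Taking c = 1/2
    in the first coordinate gives the 102 lam for p. *)
Lemma ratio_bound (L K q t c lam s : R) : 200 <= lam -> L <= 8 * lam + 3 -> 0 < K -> 0 <= q -> 0 <= c ->
  2997 / 1000 * K <= 76 * (t * c) -> q * t <= L * K -> q <= 204 * lam * c.
Proof.
move=> l2 L8 K0 q0 c0 ht hq; rewrite -(ler_pM2r K0).
have := ler_wpM2l q0 ht; have := ler_wpM2r c0 hq.
have LK : L * (K * c) <= 1603 / 200 * lam * (K * c).
  by rewrite ler_wpM2r ?mulr_ge0 ?(ltW K0) //; clear - L8 l2; lra.
have P0 : 0 <= lam * (K * c) by rewrite !mulr_ge0 ?(ltW K0) //; clear - l2; lra.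
by clear - LK P0; lra.
Qed.
End Num3.

Lemma half_leS T : (T <= 2 * T./2 + 1)%N. Proof. by lia. Qed.
Lemma half_subS T L : (T <= 2 * (T./2 - L) + 1 + 2 * L)%N. Proof. by lia. Qed.
Lemma double_half_le T : (2 * T./2 <= T)%N. Proof. by lia. Qed.
Lemma half_three T : (3 * T <= 2 * (2 * T - T./2))%N. Proof. by lia. Qed.
Lemma half_split T : (2 * T - T./2 + T./2 <= 2 * T)%N. Proof. by lia. Qed.
Lemma half_split_sub T L : (0 < T./2 - L)%N -> (2 * T - T./2 + (T./2 - L) + L <= 2 * T)%N.
Proof. by lia. Qed.

Lemma odd_mul_half k t0 L : (2 * t0 <= k.+1 * L -> (2 * k).+1 * t0 <= k.+1 * (k.+1 * L))%N.
Proof.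
move=> h; apply: leq_trans (_ : k.+1 * (2 * t0) <= _)%N; last by rewrite leq_mul2l h.
by rewrite mulnA leq_mul2r mulnC; apply/orP; right; lia.
Qed.

Section Params3.
Variable R : realType.
Notation al := (@alpha R).
Notation be := (@beta R).

Lemma ln_natS_le n : ln (n.+1%:R : R) <= n%:R.
Proof.
rewrite -natr1 addrC; apply: le_ln1Dx.
by apply: lt_le_trans (ler0n _ _); rewrite ltrN10.
Qed.

Lemma natR_le_exp n : n%:R <= expR n%:R :> R.
Proof. by apply: le_trans (expR_ge1Dx _); rewrite lerDr. Qed.

Lemma perturbation_small (K S D t : R) (t0 : nat) : 0 <= D -> S <= expR (- t) ->
  0 <= S -> 0 <= K -> K <= expR K -> D <= 1 / 2 * K -> 2 * t0%:R + 2 * K <= t ->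
  K * (D * S) * expR 2 ^+ t0 <= 1 / 2.
Proof.
move=> D0 St S0 K0 Ke DK ht.
have e1 : K * (D * S) <= expR K * (1 / 2 * expR K * expR (- t)).
  apply: ler_pM => //; first by rewrite mulr_ge0.
  apply: ler_pM => //; apply: le_trans DK _.
  by rewrite ler_wpM2l //; lra.
apply: le_trans (_ : expR K * (1 / 2 * expR K * expR (- t)) * expR 2 ^+ t0 <= _).
  by rewrite ler_wpM2r // exprn_ge0 // expR_ge0.
have -> : expR 2 ^+ t0 = expR (t0%:R * 2) :> R by rewrite -expRM_natl.
rewrite [leLHS](_ : _ = 1 / 2 * (expR K * expR K * expR (- t) * expR (t0%:R * 2))); last by ring.
rewrite -!expRD -[leRHS]mulr1 ler_wpM2l //; first lra.
by rewrite -[leRHS]expR0 ler_expR; lra.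
Qed.

(* M is about 4 lam, K about 30 Q, and the ranges T1, T2, T3 of the points are K/19,
   K/(38 lb), K/(38 h).  The two competing constraints are the cost, where
   2 lam K + (69/38) lam K has to stay below 4 lam K, and the zero estimate, where
   30 * 10^6 / (38 * 76 * 76) has to exceed 2 * 8^2. *)
Theorem three_log_params (b A B n : nat) (x y : {poly int}) (h lam : R)
    (a := ln al) (lb := ln b%:R : R) (lga := ln (ev al x) - ln (ev al y))
    (Lam := lga + A%:R * a - B%:R * lb) (Q := 10 ^+ 6 * (lam * lam * (lb * h))) :
  (2 <= b)%N -> 0 < ev al x -> 0 < ev al y -> ev al x <= expR h -> ev al y <= expR h ->
  `|ev be x| <= expR h -> `|ev be y| <= expR h -> `|lga| <= h -> 200 <= lam -> lb <= h ->
  100 * Q <= A%:R -> 100 * Q <= B%:R -> (A <= n)%N -> (B <= n)%N ->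
  4 * 10 ^+ 6 * (lam * lam * lb * n%:R) <= expR lam ->
  `|Lam| <= expR (- (23 / 10 * (lam * lam) * Q)) ->
  exists (q : nat) (p r0 : int), [/\ (0 < q)%N,
  q%:Z * B%:Z + p * A%:Z = r0, q%:R <= 204 * lam * lb, `|p|%:~R <= 102 * lam
  & `|r0|%:~R <= 204 * lam * h].
Proof.
move=> b2 x0 y0 xh yh xhb yhb lg_h lam200 lbh QA QB An Bn nlam Lam_small.
have lb68 : 17 / 25 <= lb.
  apply: le_trans (_ : ln 2 <= _); first by apply: le_trans (ln2_ge R); clear; lra.
  by rewrite ler_ln ?posrE ?ltr0n ?ler_nat //; exact: leq_trans b2.
have h68 := le_trans lb68 lbh.
have lb0 : 0 < lb by clear - lb68; lra.
have h0 : 0 < h by clear - h68; lra.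
have [Q1 Q2 Q3] := Q_bounds lam200 lb68 lbh; rewrite -/Q in Q1 Q2 Q3.
have Q9 : 10 ^+ 9 <= Q by clear - Q1 lam200; lra.
have [Mh [M4 M5]] := @nat_ceil R (4 * lam) ltac:(clear - lam200; lra).
have [k [KQ kQ]] := @nat_ceil R (30 * Q) ltac:(clear - Q9; lra).
have {}kQ := ltW kQ; have {}M5 := ltW M5.
have K0 : 0 <= k%:R :> R by exact: ler0n.
pose L := (2 * Mh).+1.
have LE : L%:R = 2 * Mh%:R + 1 :> R by rewrite /L -natr1 natrM.
have L8 : L%:R <= 8 * lam + 3 by rewrite LE; clear - M5; lra.
(* Nearly the largest t0 allowed by (2 k + 1) t0 <= (k + 1)^2 L. *)
pose t0 := (k.+1 * L)./2.
have [T1 [T1l T1u]] := @nat_floor R (k%:R / 19) ltac:(clear - K0; lra).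
have [T2 [T2l T2u]] := @nat_floor R (k%:R / (38 * lb)) ltac:(by rewrite divr_ge0 // mulr_ge0 // ltW).
have [T3 [T3l T3u]] := @nat_floor R (k%:R / (38 * h)) ltac:(by rewrite divr_ge0 // mulr_ge0 // ltW).
have T1l' : 19 * T1%:R <= k%:R :> R by clear - T1l; lra.
have T1u' : k%:R <= 19 * T1%:R + 19 :> R by clear - T1u; lra.
have T2l' : 38 * (T2%:R * lb) <= k%:R :> R.
  by move: T2l; rewrite ler_pdivlMr ?mulr_gt0 //; clear; lra.
have T2u' : k%:R <= 38 * (T2%:R * lb) + 38 * lb.
  by move: T2u; rewrite ltr_pdivrMr ?mulr_gt0 //; clear; lra.
have T3l' : 38 * (T3%:R * h) <= k%:R :> R.
  by move: T3l; rewrite ler_pdivlMr ?mulr_gt0 //; clear; lra.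
have T3u' : k%:R <= 38 * (T3%:R * h) + 38 * h.
  by move: T3u; rewrite ltr_pdivrMr ?mulr_gt0 //; clear; lra.
clear T1l T1u T2l T2u T3l T3u.
pose p1 := T1./2; pose p2 := (T2./2 - L)%N; pose p3 := T3./2.
pose t1 := (2 * T1 - T1./2)%N; pose t2 := (2 * T2 - T2./2)%N; pose t3 := (2 * T3 - T3./2)%N.
have toR (u v : nat) : (u <= v)%N -> u%:R <= v%:R :> R by rewrite ler_nat.
have e1 : T1%:R - 1 <= 2 * p1%:R :> R.
  have /toR := half_leS T1 : (T1 <= 2 * p1 + 1)%N.
  by rewrite natrD natrM; clear; lra.
have e2 : T2%:R - 1 - 2 * L%:R <= 2 * p2%:R :> R.
  have /toR := half_subS T2 L : (T2 <= 2 * p2 + 1 + 2 * L)%N.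
  by rewrite !natrD !natrM; clear; lra.
have e3 : T3%:R - 1 <= 2 * p3%:R :> R.
  have /toR := half_leS T3 : (T3 <= 2 * p3 + 1)%N.
  by rewrite natrD natrM; clear; lra.
have tt (T : nat) : 3 * T%:R <= 2 * (2 * T - T./2)%N%:R :> R by rewrite -!natrM ler_nat half_three.
have [H1 H2] := three_log_counts lam200 lb68 lbh Q9 Q2 Q3 KQ L8 T1u' T2u' T3u' e1 e2 e3 (tt T1) (tt T2) (tt T3).
rewrite -/t1 -/t2 -/t3 in H2.
have L0 : 0 < L%:R :> R by rewrite ltr0n.
have [C1 C2 C3 C4] := three_log_conditions lam200 lb68 lbh Q9 Q3 KQ L8 L0 H1 H2.
have Kp : 0 < k%:R :> R by clear - KQ Q9; lra.
have An' := toR _ _ An; have Bn' := toR _ _ Bn.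
have a0 : 0 < a := ln_alpha_gt0 R.
have Qn := le_trans QA An'.
have [U1 U2 U3] := @three_log_sizes _ lam lb h Q k%:R T1%:R T2%:R T3%:R A%:R B%:R n%:R (expR 2) a
  lam200 lb68 lbh (ltac:(rewrite /Q; ring)) kQ T1l' T2l' T3l' (ler0n _ _) (ler0n _ _) (ler0n _ _)
  An' Bn' Qn (ler0n _ _) (ler0n _ _) (expR2_le R) (expR_ge0 _) (ltW a0) (ln_alpha_le R).
set U := 1 + T1%:R + A%:R * T3%:R in U1 U2 U3.
set Z := _ / lb in U1 U3.
case: (@three_log_alternative R b A B k Mh t0 T1 T2 T3 t1 t2 t3 p1 p2 p3 x y h h U
  (1 + T2%:R + B%:R * T3%:R + Z) lam b2 x0 y0 xh yh xhb yhb (ltW h0) lg_h).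
- by rewrite /U -addrA lerDl addr_ge0 // mulr_ge0.
- by rewrite -!addrA lerDl !addr_ge0 // mulr_ge0.
- exact: le_trans U2 nlam.
- exact: le_trans U3 nlam.
- by rewrite /U -addrA lerDr.
- by clear - U1; lra.
- by rewrite -[X in X <= _]add0r lerD2r addr_ge0 ?addr_ge0 // mulr_ge0.
- rewrite !card_prod !card_ord -/L -mulnA.
  by apply: odd_mul_half; exact: double_half_le.
- rewrite -/a -/lb -/lga -/Lam.
  rewrite [T3%:R * _ / lb]mulrAC.
  apply: (perturbation_small (t := 23 / 10 * (lam * lam) * Q)) => //.
  + by rewrite divr_ge0 // ltW.
  + exact: natR_le_exp.
  + rewrite ler_pdivrMr // -(ler_pM2r h0).
    have : 46 / 100 * k%:R <= lb * h * k%:R.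
      rewrite ler_wpM2r //.
      by have := subr_mul_ge0 lb68 h68; clear - lb68 h68; lra.
    by clear - T3l' K0; lra.
  + have /toR := double_half_le _ : (2 * t0 <= k.+1 * L)%N.
    rewrite !natrM -natr1 => ht0.
    have s1 : (k%:R + 1) * L%:R <= 3001 / 100 * Q * (8 * lam + 3).
      by apply: ler_pM => //; clear - kQ Q9 K0; lra.
    have s2 : 200 * (lam * Q) <= lam * lam * Q.
      by rewrite mulrA ler_wpM2r // ?ler_wpM2r //; clear - Q9 lam200; lra.
    have s3 : 200 * Q <= lam * Q by rewrite ler_wpM2r //; clear - Q9; lra.
    by clear - ht0 s1 s2 s3 kQ Q9; lra.
- rewrite -[Mh.+1%:R]natr1 natrD.
  apply: (@three_log_cost _ lam lb h Q k%:R Mh%:R) => //.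
  + rewrite !card_prod !card_ord -/L !natrM !lnM ?posrE ?mulr_gt0 ?ltr0n //.
    have := ln_natS_le k; have := ln_natS_le (2 * Mh); rewrite -/L natrM.
    by clear - M5 KQ Q1 Q9; lra.
  + have /toR := half_leS _ : (k.+1 * L <= 2 * t0 + 1)%N.
    by rewrite natrD !natrM -natr1 LE.
  + by rewrite mulr_ge0 // ltW.
  + by rewrite mulr_ge0 // ltW.
  + exact: expR2_le.
  + exact: expR_ge0.
  + exact: ltW.
  + exact: ln_alpha_le.
- exact: half_split.
- have : (0 < p2)%N.
    rewrite -(ltr0n R) -(pmulr_lgt0 _ lb0).
    by case: H1 => _ H1 _; clear - H1 Kp; lra.
  exact: half_split_sub.
- exact: half_split.
- rewrite -(ler_nat R); apply: le_trans QA.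
  have : 2 * p1%:R <= T1%:R :> R by rewrite -natrM ler_nat double_half_le.
  by clear - T1l' kQ Q9; lra.
- rewrite -(ltr0n R) -(pmulr_lgt0 _ lb0).
  by case: H1 => _ H1 _; clear - H1 Kp; lra.
- by rewrite -(ltr_nat R) !natrM.
- by rewrite -(ltr_nat R) !natrM.
- by rewrite -(ltr_nat R) !natrM.
- by rewrite -(ltr_nat R) !natrM.
move=> q [p [r0 [q0 E hq hp hr]]]; exists q, p, r0; case: H2 => G1 G2 G3; split => //.
- apply: (@ratio_bound _ L%:R k%:R q%:R t2%:R) => //; first exact: ltW.
  by move/toR: hq; rewrite !natrM.
- rewrite -[leRHS]mulr1 (_ : 102 * lam * 1 = 204 * lam * (1 / 2)); last by clear; lra.
  apply: (@ratio_bound _ L%:R k%:R _ t1%:R) => //; first by clear; lra.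
    by clear - G1; lra.
  by move/toR: hp; rewrite !natrM natr_absz.
- apply: (@ratio_bound _ L%:R k%:R _ t3%:R) => //; first exact: ltW.
  by move/toR: hr; rewrite !natrM natr_absz.
Qed.
End Params3.

Section Num2.
Variable R : realFieldType.

(** The product T1 T2 is about K^2 / (2449 * 431 lam^2 lb h), so 4 T1 T2 > 2 lam K asks for K above
    0.528 lam Q; hence 55/100. *)
Lemma two_log_counts (lam lb h K L T1 T2 : R) (Q := 10 ^+ 6 * (lam * lam * (lb * h))) :
  200 <= lam -> 0 < lb -> 0 < h -> 10 ^+ 9 <= Q ->
  13 * 10 ^+ 7 * (lam * lb) <= Q -> 13 * 10 ^+ 7 * (lam * h) <= Q ->
  55 / 100 * (lam * Q) <= K -> L <= 2 * lam + 3 ->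
  K <= 2449 * (T1 * (lam * h)) + 2449 * (lam * h) ->
  K <= 431 * (T2 * (lam * lb)) + 431 * (lam * lb) ->
  L * K < 2 * T1 * (2 * T2 - L) /\ 0 < 2 * T2 - L.
Proof.
move=> l2 lb0 h0 Q9 Qlb Qh KQ L2 T1u T2u.
have lam0 : 0 < lam by clear - l2; lra.
have lh0 : 0 < lam * h by rewrite mulr_gt0.
have llb0 : 0 < lam * lb by rewrite mulr_gt0.
have lQ : 200 * Q <= lam * Q by rewrite ler_wpM2r //; clear - Q9; lra.
have K0 : 0 < K by clear - KQ lQ Q9; lra.
have e1 : 999 / 1000 * K <= 2449 * (T1 * (lam * h)) by clear - T1u Qh KQ lQ Q9 lh0; lra.
have Llb : L * (lam * lb) <= (2 * lam + 3) * (lam * lb) by rewrite ler_wpM2r // ltW.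
have llQ : lam * (13 * 10 ^+ 7 * (lam * lb)) <= lam * Q by rewrite ler_wpM2l // ltW.
have ll : 200 * (lam * lb) <= lam * (lam * lb) by rewrite ler_wpM2r // ltW.
have e2 : 1998 / 1000 * K <= 431 * ((2 * T2 - L) * (lam * lb)).
  by clear - T2u Llb llQ KQ lQ Q9 llb0 ll; lra.
have c0 : 0 <= 999 / 1000 * K by clear - K0; lra.
have d0 : 0 <= 1998 / 1000 * K by clear - K0; lra.
have E := ler_pM c0 d0 e1 e2.
split; last first.
  rewrite -(pmulr_lgt0 _ llb0); clear - e2 K0; lra.
have z0 : 0 < lam * h * (lam * lb) by rewrite mulr_gt0.
rewrite -(ltr_pM2r z0).
have L2' : L <= 403 / 200 * lam by clear - L2 l2; lra.
have F1 : L * (K * (lam * h * (lam * lb))) <= 403 / 200 * lam * (K * (lam * h * (lam * lb))).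
  by rewrite ler_wpM2r // ltW // mulr_gt0.
have F2 : 55 / 100 * (lam * Q) * K <= K * K by rewrite ler_wpM2r // ltW.
have P0 : 0 < K * K by rewrite mulr_gt0.
rewrite /Q in F2.
by clear - E F1 F2 P0; lra.
Qed.

(** The divisors 2449 and 431 slightly exceed 2346 = (15/2 + 4) * 204 and 408 = 4 * 102, the term
    with [a2] <= 1 being negligible. Each logarithm then costs less than lam K / 2, which keeps the
    total below the 2 lam K of t0. *)
Lemma two_log_cost (lam lb h Q K M T1 T2 t0 E a1 a2 lr : R) :
  200 <= lam -> 136 <= lam * lb -> 0 < h -> 10 ^+ 9 <= Q -> 9 * 10 ^+ 7 * lam <= Q ->
  55 / 100 * (lam * Q) <= K ->
  lam <= M -> M <= lam + 1 -> 2 * lr <= 2 * K + 4 * M ->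
  (K + 1) * (2 * M + 1) = t0 ->
  2449 * (T1 * (lam * h)) <= K -> 431 * (T2 * (lam * lb)) <= K ->
  0 <= T1 -> 0 <= T2 -> E <= 15 / 2 -> 0 <= E -> a1 <= 204 * lam * h -> a2 <= 1 -> 0 <= a1 -> 0 <= a2 ->
  2 * lr + 1 + lam * K + (M + 1) / 2 * (T1 * (E * a1 + 4 * (204 * lam * h))
    + T2 * (E * a2 + 4 * (102 * lam * lb))) < t0 - 1.
Proof.
move=> l2 llb h0 Q9 Ql KQ M1 M2 hlr ht t1 t2 T10 T20 E15 E0 h1 h2 a10 a20.
have lam0 : 0 < lam by clear - l2; lra.
have lQ : 200 * Q <= lam * Q by rewrite ler_wpM2r //; clear - Q9; lra.
have K0 : 0 <= K by clear - KQ lQ Q9; lra.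
have Ea1 : E * a1 <= 15 / 2 * (204 * lam * h) by apply: ler_pM.
have Ea2 : E * a2 <= 15 / 2 * 1 by apply: ler_pM.
have S1 : T1 * (E * a1 + 4 * (204 * lam * h)) <= 2346 / 2449 * K.
  have : T1 * (E * a1 + 4 * (204 * lam * h)) <= T1 * (2346 * (lam * h)).
    by rewrite ler_wpM2l //; clear - Ea1; lra.
  by clear - t1; lra.
have S2 : T2 * (E * a2 + 4 * (102 * lam * lb)) <= 4081 / 4310 * K.
  have : T2 * (E * a2 + 4 * (102 * lam * lb)) <= T2 * (4081 / 10 * (lam * lb)).
    by rewrite ler_wpM2l //; clear - Ea2 llb; lra.
  by clear - t2; lra.
have S3 : (M + 1) / 2 * (T1 * (E * a1 + 4 * (204 * lam * h)) + T2 * (E * a2 + 4 * (102 * lam * lb)))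
   <= (lam + 2) / 2 * (2346 / 2449 * K + 4081 / 4310 * K).
  apply: ler_pM.
  - by clear - M1 l2; lra.
  - apply: addr_ge0; apply: mulr_ge0 => //.
      have : 0 <= lam * h by rewrite mulr_ge0 // ltW.
      by have := mulr_ge0 E0 a10; clear; lra.
    by have := mulr_ge0 E0 a20; clear - llb; lra.
  - by clear - M2; lra.
  - by clear - S1 S2; lra.
have S4 : (K + 1) * (2 * lam + 1) <= (K + 1) * (2 * M + 1).
  by apply: ler_wpM2l; clear - K0 M1; lra.
have S5 : 200 * K <= lam * K by rewrite ler_wpM2r.
by clear - l2 KQ Q9 Ql lQ hlr ht S3 S4 S5 M2; lra.
Qed.

Lemma two_log_sizes (lam lb h Q K T1 T2 B n E a1 a2 : R) (D := lam * lam * lb) :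
  200 <= lam -> 136 <= lam * lb -> 17 / 25 <= lb -> lb <= h -> Q = 10 ^+ 6 * (D * h) -> 10 ^+ 9 <= Q ->
  K <= 55 / 100 * (lam * Q) + 1 -> 2449 * (T1 * (lam * h)) <= K -> 431 * (T2 * (lam * lb)) <= K ->
  0 <= T1 -> 0 <= T2 -> 0 <= B -> B <= n -> 100 * Q <= n -> E <= 15 / 2 -> 0 <= E ->
  0 <= a1 -> 0 < a2 -> a1 <= (B + 1) * a2 ->
  1 + T2 + B * T1 + E * (T1 * a1 + T2 * a2) / a2 <= 4 * 10 ^+ 6 * (D * n) /\ 2 * T2 <= 100 * Q.
Proof.
move=> l2 llb h2 h3 QE Q9 kQ t1 t2 T10 T20 B0 Bn Qn E15 E0 a10 a20 a1B.
have lam0 : 0 < lam by clear - l2; lra.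
have h0 : 0 < h by clear - h2 h3; lra.
have lQ : 200 * Q <= lam * Q by rewrite ler_wpM2r //; clear - Q9; lra.
have D1 : 10 ^+ 4 <= D.
  have c1 : 0 <= 200 :> R by []. have c2 : 0 <= 136 :> R by [].
  by rewrite /D -mulrA; have := ler_pM c1 c2 l2 llb; clear; lra.
clearbody D.
have kQ' : K <= 56 / 100 * (lam * Q) by clear - kQ lQ Q9; lra.
have T1D : T1 <= 300 * D.
  have z0 : 0 < lam * h by rewrite mulr_gt0.
  rewrite -(ler_pM2r z0); move: t1 kQ'; rewrite QE => t1 kQ'.
  have p0 : 0 < lam * (D * h) by rewrite !mulr_gt0 //; clear - D1; lra.
  by have := le_trans t1 kQ'; clear - p0; lra.
have T2Q : T2 <= Q.
  have z0 : 0 < lam by [].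
  rewrite -(ler_pM2r z0).
  have : T2 * lam * (17 / 25) <= T2 * lam * lb by rewrite ler_wpM2l // mulr_ge0 // ltW.
  by clear - t2 kQ' lQ Q9; lra.
have n0 : 10 ^+ 11 <= n by clear - Qn Q9; lra.
have nB0 : 0 <= n by clear - n0; lra.
have BT : B * T1 <= n * (300 * D) by apply: ler_pM.
have TD0 : 0 <= 300 * D by clear - D1; lra.
have F : (T1 * a1 + T2 * a2) / a2 <= (n + 1) * (300 * D) + Q.
  rewrite ler_pdivrMr //.
  have : T1 * a1 <= 300 * D * ((n + 1) * a2).
    apply: ler_pM => //; apply: le_trans a1B _.
    by rewrite ler_wpM2r ?(ltW a20) // lerD2r.
  have : T2 * a2 <= Q * a2 by rewrite ler_wpM2r // ltW.
  by clear; lra.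
have F0 : 0 <= (T1 * a1 + T2 * a2) / a2.
  by rewrite divr_ge0 ?(ltW a20) // addr_ge0 // mulr_ge0 // ltW.
have F2 := ler_pM E0 F0 E15 F.
have Dn : 10 ^+ 4 * n <= D * n by rewrite ler_wpM2r.
have Dn2 : D * (10 ^+ 11) <= D * n by rewrite ler_wpM2l //; clear - D1; lra.
rewrite -[E * _ / a2]mulrA; split; last by clear - T2Q Q9; lra.
by clear - T2Q BT F2 Dn Dn2 Qn n0; lra.
Qed.
End Num2.

Section Params2.
Variable R : realType.
Notation al := (@alpha R).
Notation be := (@beta R).

(* Here M is about lam and K about 55/100 lam Q. *)
Lemma two_log_params (B n : nat) (x1 y1 x2 y2 : {poly int}) (lam lb h : R)
    (g1 := ln (ev al x1) - ln (ev al y1)) (g2 := ln (ev al x2) - ln (ev al y2))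
    (Q := 10 ^+ 6 * (lam * lam * (lb * h))) (h1 := 204 * lam * h) (h2 := 102 * lam * lb) :
  0 < ev al x1 -> 0 < ev al y1 -> 0 < ev al x2 -> 0 < ev al y2 ->
  ev al x1 <= expR h1 -> ev al y1 <= expR h1 -> ev al x2 <= expR h2 -> ev al y2 <= expR h2 ->
  `|ev be x1| <= expR h1 -> `|ev be y1| <= expR h1 -> `|ev be x2| <= expR h2 -> `|ev be y2| <= expR h2 ->
  200 <= lam -> 17 / 25 <= lb -> lb <= h ->
  `|g1| <= h1 -> `|g2| <= 1 -> expR (- (205 * (lam * lb))) <= `|g2| ->
  `|g1 + B%:R * g2| <= 102 * lam * expR (- (23 / 10 * (lam * lam) * Q)) ->
  100 * Q <= B%:R -> (B <= n)%N ->
  4 * 10 ^+ 6 * (lam * lam * lb * n%:R) <= expR lam -> False.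
Proof.
move=> x10 y10 x20 y20 x1h y1h x2h y2h x1hb y1hb x2hb y2hb lam200 lb68 lbh g1h g2h g2l Lsm QB Bn nlam.
have h68 := le_trans lb68 lbh.
have lb0 : 0 < lb by clear - lb68; lra.
have h0 : 0 < h by clear - h68; lra.
have lam0 : 0 < lam by clear - lam200; lra.
have llb : 136 <= lam * lb.
  apply: le_trans (_ : 200 * (17 / 25) <= _); first by clear; lra.
  by apply: ler_pM => //; clear; lra.
have llb0 : 0 < lam * lb by rewrite mulr_gt0.
have lh0 : 0 < lam * h by rewrite mulr_gt0.
have [Q1 Q2 Q3] := Q_bounds lam200 lb68 lbh; rewrite -/Q in Q1 Q2 Q3.
have Q9 : 10 ^+ 9 <= Q by clear - Q1 lam200; lra.
have lQ : 200 * Q <= lam * Q by rewrite ler_wpM2r //; clear - Q9; lra.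
have [Mh [M1 M2]] := @nat_ceil R lam (ltW lam0).
have [k [KQ kQ]] := @nat_ceil R (55 / 100 * (lam * Q)) ltac:(clear - Q9 lQ; lra).
have {}kQ := ltW kQ; have {}M2 := ltW M2.
have K0 : 0 <= k%:R :> R by exact: ler0n.
pose L := (2 * Mh).+1.
have LE : L%:R = 2 * Mh%:R + 1 :> R by rewrite /L -natr1 natrM.
have L2 : L%:R <= 2 * lam + 3 by rewrite LE; clear - M2; lra.
pose t0 := (k.+1 * L)%N.
have [T1 [T1l T1u]] := @nat_floor R (k%:R / (2449 * (lam * h))) ltac:(by rewrite divr_ge0 // mulr_ge0 // ltW).
have [T2 [T2l T2u]] := @nat_floor R (k%:R / (431 * (lam * lb))) ltac:(by rewrite divr_ge0 // mulr_ge0 // ltW).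
have T1l' : 2449 * (T1%:R * (lam * h)) <= k%:R :> R.
  by move: T1l; rewrite ler_pdivlMr ?mulr_gt0 //; clear; lra.
have T1u' : k%:R <= 2449 * (T1%:R * (lam * h)) + 2449 * (lam * h).
  by move: T1u; rewrite ltr_pdivrMr ?mulr_gt0 //; clear; lra.
have T2l' : 431 * (T2%:R * (lam * lb)) <= k%:R :> R.
  by move: T2l; rewrite ler_pdivlMr ?mulr_gt0 //; clear; lra.
have T2u' : k%:R <= 431 * (T2%:R * (lam * lb)) + 431 * (lam * lb).
  by move: T2u; rewrite ltr_pdivrMr ?mulr_gt0 //; clear; lra.
clear T1l T1u T2l T2u.
have Bn' : B%:R <= n%:R :> R by rewrite ler_nat.
have g20 : 0 < `|g2| by apply: lt_le_trans g2l; exact: expR_gt0.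
have t0R : t0%:R = (k%:R + 1) * (2 * Mh%:R + 1) :> R by rewrite /t0 natrM natr1 LE.
(* Here 2 t0 is about 4 lam K, that is 2.2 lam^2 Q. This fixes the constant 23/10; with three
   logarithms 2 t0 is only about 240 lam Q. *)
have T0 : 2 * t0%:R + 2 * k%:R <= 23 / 10 * (lam * lam) * Q - 307 * (lam * lb) - 102 * lam.
  have s1 : (k%:R + 1) * (2 * Mh%:R + 1) <= (55 / 100 * (lam * Q) + 2) * (2 * lam + 3).
    by apply: ler_pM => //; clear - kQ M1 M2 K0 lam0; lra.
  have s2 : 200 * (lam * Q) <= lam * (lam * Q).
    by rewrite ler_wpM2r //; clear - Q9 lQ; lra.
  by rewrite t0R; clear - s1 s2 kQ Q9 Q1 Q2 lQ lam0 llb0 lam200; lra.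
have lamE : 102 * lam <= expR (102 * lam).
  by apply: le_trans (expR_ge1Dx _); rewrite lerDr.
pose t := 23 / 10 * (lam * lam) * Q - 205 * (lam * lb) - 102 * lam.
have S1 : `|g1 + B%:R * g2| / `|g2| <= expR (- t).
  rewrite ler_pdivrMr //; apply: le_trans Lsm _.
  apply: le_trans (_ : expR (- t) * expR (- (205 * (lam * lb))) <= _); last first.
    by rewrite ler_wpM2l // expR_ge0.
  rewrite -expRD (_ : - t + _ = 102 * lam + - (23 / 10 * (lam * lam) * Q)); last by rewrite /t; ring.
  by rewrite expRD ler_wpM2r // expR_ge0.
have ht : 2 * t0%:R + 2 * k%:R <= t.
  by rewrite /t; clear - T0 llb0; lra.
have S0 : 0 <= `|g1 + B%:R * g2| / `|g2| by rewrite divr_ge0.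
have St1 : `|g1 + B%:R * g2| <= `|g2|.
  rewrite -[leRHS]mul1r -ler_pdivrMr //; apply: le_trans S1 _.
  by rewrite -[leRHS]expR0 ler_expR oppr_le0; apply: le_trans ht; rewrite addr_ge0 // mulr_ge0.
(* As Lambda is smaller than g2, g1 is nearly - B g2; this controls the quotient g1 / g2 in [VZ]
   although g2 may be tiny. *)
have g12 : `|g1| <= (B%:R + 1) * `|g2|.
  rewrite (_ : g1 = (g1 + B%:R * g2) - B%:R * g2); last by rewrite addrK.
  apply: le_trans (ler_normB _ _) _; rewrite normrM ger0_norm //.
  by rewrite mulrDl mul1r addrC lerD2l.
have [V1 V2] := @two_log_sizes _ lam lb h Q k%:R T1%:R T2%:R B%:R n%:R (expR 2) `|g1| `|g2| lam200 llb lb68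
  lbh (ltac:(rewrite /Q; ring)) Q9 kQ T1l' T2l' (ler0n _ _) (ler0n _ _) (ler0n _ _) Bn'
  (le_trans QB Bn') (expR2_le R) (expR_ge0 _) (normr_ge0 _) g20 g12.
have [C1 C2] := two_log_counts lam200 lb0 h0 Q9 Q2 Q3 KQ L2 T1u' T2u'.
set Z := expR 2 * _ / _ in V1.
have Z0 : 0 <= Z.
  rewrite /Z divr_ge0 // mulr_ge0 ?expR_ge0 // addr_ge0 // mulr_ge0 //.
have LT2 : (L <= 2 * T2)%N by rewrite -(ler_nat R) natrM; clear - C2; lra.
case: (@two_log_contradiction R B k Mh t0 T1 T2 x1 y1 x2 y2 h1 h2 (1 + T2%:R + B%:R * T1%:R + Z) lam) => //.
- by rewrite /h1 -mulrA; clear - lh0; lra.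
- by rewrite /h2 -mulrA; clear - llb0; lra.
- by rewrite -normr_gt0.
- by rewrite -!addrA lerDl !addr_ge0 // mulr_ge0.
- exact: le_trans V1 nlam.
- exact: ltW.
- have : 0 <= B%:R * T1%:R :> R by rewrite mulr_ge0.
  by clear - Z0; lra.
- by rewrite -[X in X <= _]add0r lerD2r addr_ge0 ?addr_ge0 // mulr_ge0.
- by rewrite !card_prod !card_ord -/L mul1n.
- rewrite -/g1 -/g2 -[T1%:R * _ / _]mulrA.
  apply: (perturbation_small (t := t)) => //; first exact: natR_le_exp.
  rewrite -(ler_pM2r lh0).
  have : 136 * k%:R <= lam * h * k%:R.
    rewrite ler_wpM2r //; apply: le_trans llb _; by rewrite ler_wpM2l // ltW.
  by clear - T1l' K0; lra.
- rewrite -[Mh.+1%:R]natr1 -/g1 -/g2.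
  apply: (@two_log_cost _ lam lb h Q k%:R Mh%:R T1%:R T2%:R t0%:R) => //.
  + rewrite !card_prod !card_ord -/L !natrM !lnM ?posrE ?mulr_gt0 ?ltr0n // ln1 add0r.
    have := ln_natS_le R k; have := ln_natS_le R (2 * Mh); rewrite -/L natrM.
    by clear; lra.
  + exact: expR2_le.
  + exact: expR_ge0.
- rewrite -(ler_nat R) natrM; exact: le_trans V2 QB.
- have e : (2 * T2 - L)%:R = 2 * T2%:R - L%:R :> R by rewrite natrB // natrM.
  by rewrite -(ltr_nat R) natrM [(2 * T1 * _)%:R]natrM e natrM.
Qed.
End Params2.

(** * Lower bound for the linear form, including the degenerate case *)

Lemma int_parts (r : int) : exists rp rm : nat, r = rp%:Z - rm%:Z /\ absz r = (rp + rm)%N.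
Proof. by case: r => n; [exists n, 0%N | exists 0%N, n.+1]; split => //; lia. Qed.

(** Since |r| < B <= q B, the term p A has to compensate q B. *)
Lemma coef_neg (q A B : nat) (p r : int) : (0 < q)%N -> (`|r| < B)%N -> q%:Z * B%:Z + p * A%:Z = r ->
  exists2 p' : nat, p = - p'%:Z & (0 < p')%N.
Proof.
move=> q0 rB E; case: p E => p E; last by exists p.+1.
have qB : (B <= q * B)%N by rewrite leq_pmull.
have := congr1 absz E; rewrite -!PoszM -PoszD absz_nat => e; lia.
Qed.

Section LF.
Variable R : realType.
Notation al := (@alpha R).
Notation be := (@beta R).

Lemma lnX_natl (x : R) n : 0 < x -> ln (x ^+ n) = n%:R * ln x.
Proof. by move=> x0; rewrite lnXn // mulr_natl. Qed.

Lemma expR_dist_le (u v m : R) : u <= m -> v <= m -> `|expR u - expR v| <= expR m * `|u - v|.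
Proof.
wlog uv : u v / u <= v.
  move=> H um vm; case: (leP u v) => [h|/ltW h]; first exact: H.
  by rewrite distrC [`|u - v|]distrC; apply: H.
move=> um vm; rewrite distrC [`|u - v|]distrC !ger0_norm ?subr_ge0 ?ler_expR //.
apply: le_trans (_ : expR v * (v - u) <= _); last first.
  by rewrite ler_wpM2r ?subr_ge0 // ler_expR.
have -> : expR u = expR v * expR (u - v) by rewrite -expRD; congr expR; lra.
rewrite -[X in X - _]mulr1 -mulrBr ler_wpM2l ?expR_ge0 //.
have := expR_ge1Dx (u - v); lra.
Qed.

Lemma pow_bound (z w h a : R) (p r : nat) : 0 <= z -> z <= expR h -> 0 <= w -> w <= expR a ->
  z ^+ p * w ^+ r <= expR (p%:R * h + r%:R * a).
Proof.
move=> z0 zh w0 wa; rewrite expRD !expRM_natl.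
by apply: ler_pM; rewrite ?exprn_ge0 // lerXn2r // nnegrE expR_ge0.
Qed.

(** An inequality of Liouville type. The norm of alpha^q - b^p is a nonzero integer, since |beta^q|
    <= 1 < b^p, and the conjugate is at most 2 b^p. *)
Lemma alpha_pow_dist (b p q : nat) (c : R) : (2 <= b)%N ->
  q%:R * ln al <= c -> p%:R * ln b%:R <= c -> (0 < p)%N ->
  1 <= 2 * expR (c + c) * `|q%:R * ln al - p%:R * ln b%:R|.
Proof.
move=> b2 qc pc p0.
have b0 : (0 : R) < b%:R by rewrite ltr0n; exact: leq_trans b2.
have bp1 : (1 : R) < b%:R ^+ p by rewrite exprn_egt1 ?ltr1n // -lt0n.
have be1 q' : `|be ^+ q'| <= 1 by rewrite normrX exprn_ile1 // beta_le1.
have evE z : ev z ('X^q - ((b ^ p)%N%:Z)%:P) = z ^+ q - b%:R ^+ p :> R.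
  by rewrite rmorphB rmorphXn /= evX evC -[_%:~R]/((b ^ p)%N%:R) natrX.
have D' : `|be ^+ q - b%:R ^+ p| <= 2 * b%:R ^+ p.
  apply: le_trans (ler_normB _ _) _; rewrite [X in _ + X]ger0_norm ?exprn_ge0 ?ltW //.
  by have := be1 q; lra.
have D'0 : be ^+ q - b%:R ^+ p != 0.
  apply/eqP => /subr0_eq e; have he := be1 q; rewrite e in he.
  by have := le_lt_trans (le_trans (ler_norm _) he) bp1; rewrite ltxx.
have := @norm_lower R ('X^q - ((b ^ p)%N%:Z)%:P); rewrite !evE D'0 orbT => /(_ isT) N.
have aE : al ^+ q = expR (q%:R * ln al) by rewrite expRM_natl lnK // posrE alpha_gt0.
have bE : b%:R ^+ p = expR (p%:R * ln b%:R) :> R by rewrite expRM_natl lnK // posrE.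
apply: le_trans N _.
have d1 : `|al ^+ q - b%:R ^+ p| <= expR c * `|q%:R * ln al - p%:R * ln b%:R|.
  by rewrite aE bE; apply: expR_dist_le.
have d2 : `|be ^+ q - b%:R ^+ p| <= 2 * expR c.
  by apply: le_trans D' _; rewrite ler_wpM2l // bE ler_expR.
apply: le_trans (ler_pM (normr_ge0 _) (normr_ge0 _) d1 d2) _.
by rewrite expRD; move: (expR c) `|_| => u v; lra.
Qed.

(* In the degenerate case q B - p' A = r, the form p' Lambda equals g1 + B g2 with
   g1 = p' (ln x - ln y) - r ln alpha and g2 = q ln alpha - p' ln b. *)
Theorem log_form_lower (b A B n : nat) (x y : {poly int}) (h lam : R)
    (a := ln al) (lb := ln b%:R : R) (lga := ln (ev al x) - ln (ev al y))
    (Lam := lga + A%:R * a - B%:R * lb) (Q := 10 ^+ 6 * (lam * lam * (lb * h))) :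
  (2 <= b)%N -> 0 < ev al x -> 0 < ev al y -> ev al x <= expR h -> ev al y <= expR h ->
  `|ev be x| <= expR h -> `|ev be y| <= expR h -> `|lga| <= h -> 200 <= lam -> lb <= h ->
  100 * Q <= A%:R -> 100 * Q <= B%:R -> (A <= n)%N -> (B <= n)%N ->
  4 * 10 ^+ 6 * (lam * lam * lb * n%:R) <= expR lam ->
  expR (- (23 / 10 * (lam * lam) * Q)) < `|Lam|.
Proof.
move=> b2 x0 y0 xh yh xhb yhb lg_h lam200 lbh QA QB An Bn nlam.
rewrite ltNge; apply/negP => Ls.
have lb68 : 17 / 25 <= lb.
  apply: le_trans (_ : ln 2 <= _); first by apply: le_trans (ln2_ge R); clear; lra.
  by rewrite ler_ln ?posrE ?ltr0n ?ler_nat //; exact: leq_trans b2.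
have h68 := le_trans lb68 lbh.
have lb0 : 0 < lb by clear - lb68; lra.
have h0 : 0 < h by clear - h68; lra.
have lam0 : 0 < lam by clear - lam200; lra.
have llb0 : 0 < lam * lb by rewrite mulr_gt0.
have lh0 : 0 < lam * h by rewrite mulr_gt0.
have [Q1 Q2 Q3] := Q_bounds lam200 lb68 lbh; rewrite -/Q in Q1 Q2 Q3.
have b0 : (0 : R) < b%:R by rewrite ltr0n; exact: leq_trans b2.
have a0 : 0 < a := ln_alpha_gt0 R.
have a1 : a <= 1 / 2 := ln_alpha_le R.
case: (three_log_params b2 x0 y0 xh yh xhb yhb lg_h lam200 lbh QA QB An Bn nlam Ls) =>
  q [p [r0 [q0 E hq hp hr]]]; rewrite -/lb in hq.
have [rp [rm [rE rA]]] := int_parts r0.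
have hr' : rp%:R + rm%:R <= 204 * lam * h by rewrite -natrD -rA natr_absz.
have hr0 : (`|r0| < B)%N.
  rewrite -(ltr_nat R) rA natrD; apply: lt_le_trans QB.
  by clear - hr' Q3 lh0; lra.
have [p' pE p'0] := coef_neg q0 hr0 E.
have hp' : p'%:R <= 102 * lam by move: hp; rewrite pE normrN.
have rpn : 0 <= rp%:R :> R := ler0n _ _.
have rmn : 0 <= rm%:R :> R := ler0n _ _.
have ER : q%:R * B%:R - p'%:R * A%:R = rp%:R - rm%:R :> R.
  have := congr1 (fun z : int => z%:~R : R) E.
  by rewrite pE rE mulNr !(rmorphD, rmorphB, rmorphN, rmorphM).
clear E rE rA hp hr hr0 pE p r0.
have p'h : p'%:R * h <= 102 * lam * h by rewrite ler_wpM2r // ltW.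
have rma : rm%:R * a <= rm%:R * (1 / 2) by rewrite ler_wpM2l.
have rpa : rp%:R * a <= rp%:R * (1 / 2) by rewrite ler_wpM2l.
have ae : al <= expR a by rewrite lnK // posrE alpha_gt0.
have bee : `|be| <= expR a.
  by apply: le_trans (beta_le1 R) _; rewrite -[leLHS]expR0 ler_expR ltW.
(* The bound h1 is 102 lam h for p' (ln x - ln y) plus half of 204 lam h for r ln alpha; h2 bounds
   both q ln alpha and p' ln b. *)
pose h1 := 204 * lam * h; pose h2 := 102 * lam * lb.
have m1 : p'%:R * h + rm%:R * a <= h1.
  by rewrite /h1; clear - p'h rma hr' rpn; lra.
have m2 : p'%:R * h + rp%:R * a <= h1.
  by rewrite /h1; clear - p'h rpa hr' rmn; lra.
have qa : q%:R * a <= h2.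
  have : q%:R * a <= q%:R * (1 / 2) by rewrite ler_wpM2l.
  by rewrite /h2; clear - hq; lra.
have pb : p'%:R * lb <= h2 by rewrite /h2 ler_wpM2r // ltW.
(* The quotients x1 / y1 and x2 / y2 have logarithms g1 and g2; writing r = rp - rm keeps numerators
   and denominators in Z[alpha]. *)
pose x1 := x ^+ p' * 'X^rm; pose y1 := y ^+ p' * 'X^rp.
pose x2 : {poly int} := 'X^q; pose y2 : {poly int} := ((b ^ p')%N%:Z)%:P.
have x1E z : ev z x1 = ev z x ^+ p' * z ^+ rm :> R by rewrite rmorphM !rmorphXn /= evX.
have y1E z : ev z y1 = ev z y ^+ p' * z ^+ rp :> R by rewrite rmorphM !rmorphXn /= evX.
have x2E z : ev z x2 = z ^+ q :> R by rewrite rmorphXn /= evX.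
have y2E z : ev z y2 = b%:R ^+ p' :> R by rewrite evC -[_%:~R]/((b ^ p')%N%:R) natrX.
have al0 : 0 < al := alpha_gt0 R.
have g1E : ln (ev al x1) - ln (ev al y1) = p'%:R * lga + (rm%:R - rp%:R) * a.
  rewrite x1E y1E !lnM ?posrE ?exprn_gt0 // !lnX_natl // /lga -/a.
  by ring.
have g2E : ln (ev al x2) - ln (ev al y2) = q%:R * a - p'%:R * lb.
  by rewrite x2E y2E !lnX_natl.
have LE : p'%:R * Lam = (p'%:R * lga + (rm%:R - rp%:R) * a) + B%:R * (q%:R * a - p'%:R * lb).
  rewrite /Lam; have -> : rm%:R - rp%:R = p'%:R * A%:R - q%:R * B%:R :> R by rewrite -opprB -ER opprB.
  by ring.
have Ls' : p'%:R * `|Lam| <= 102 * lam * expR (- (23 / 10 * (lam * lam) * Q)) by apply: ler_pM.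
have g1h : `|p'%:R * lga + (rm%:R - rp%:R) * a| <= h1.
  apply: le_trans (ler_normD _ _) _; rewrite !normrM (ger0_norm (ltW a0)) ger0_norm //.
  have : p'%:R * `|lga| <= p'%:R * h by rewrite ler_wpM2l.
  have : `|rm%:R - rp%:R| * a <= (rm%:R + rp%:R) * (1 / 2).
    apply: ler_pM => //; first exact: ltW.
    by apply: le_trans (ler_normB _ _) _; rewrite !ger0_norm.
  by rewrite /h1; clear - p'h hr' lh0; lra.
have g2l : expR (- (205 * (lam * lb))) <= `|q%:R * a - p'%:R * lb|.
  have H := alpha_pow_dist b2 qa pb p'0; rewrite -/a -/lb in H.
  have e2 : 2 <= expR (lam * lb).
    apply: le_trans (expR_ge1Dx _).
    have : 200 * (17 / 25) <= lam * lb by apply: ler_pM => //; clear; lra.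
    by clear; lra.
  have e3 : 2 * expR (h2 + h2) <= expR (205 * (lam * lb)).
    rewrite (_ : 205 * (lam * lb) = lam * lb + (h2 + h2)); last by rewrite /h2; ring.
    by rewrite [leRHS]expRD ler_wpM2r // ?expR_ge0.
  rewrite expRN -[leLHS]mul1r ler_pdivrMr ?expR_gt0 // mulrC; apply: le_trans H _.
  by rewrite ler_wpM2r.
(* B g2 is p' Lambda - g1, and both terms together are smaller than B. *)
have g2u : `|q%:R * a - p'%:R * lb| <= 1.
  have B0 : 0 < B%:R :> R by apply: lt_le_trans QB; clear - Q3 lh0; lra.
  rewrite -(ler_pM2l B0) mulr1 -[X in X * _]ger0_norm // -normrM.
  have -> : B%:R * (q%:R * a - p'%:R * lb) = p'%:R * Lam - (p'%:R * lga + (rm%:R - rp%:R) * a).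
    by rewrite LE [RHS]addrC addKr.
  apply: le_trans (ler_normB _ _) _; rewrite [`|p'%:R * Lam|]normrM [`|p'%:R|]ger0_norm //.
  have e1 : 102 * lam * expR (- (23 / 10 * (lam * lam) * Q)) <= 102 * lam * 1.
    apply: ler_wpM2l; first by rewrite mulr_ge0 // ltW.
    rewrite -[leRHS]expR0 ler_expR oppr_le0.
    have Q0 : 0 <= Q by clear - Q1 lam0; lra.
    by apply: mulr_ge0 => //; apply: mulr_ge0; [clear; lra | exact: ltW (mulr_gt0 lam0 lam0)].
  have e2 : lam * (17 / 25) <= lam * h by rewrite ler_wpM2l // ltW.
  by move: g1h Ls'; rewrite /h1; clear - e1 e2 QB Q3 lh0; lra.
case: (@two_log_params R B n x1 y1 x2 y2 lam lb h).
- by rewrite x1E mulr_gt0 // exprn_gt0.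
- by rewrite y1E mulr_gt0 // exprn_gt0.
- by rewrite x2E exprn_gt0.
- by rewrite y2E exprn_gt0.
- by rewrite x1E; apply: le_trans (pow_bound _ _ (ltW x0) xh (ltW al0) ae) _; rewrite ler_expR.
- by rewrite y1E; apply: le_trans (pow_bound _ _ (ltW y0) yh (ltW al0) ae) _; rewrite ler_expR.
- by rewrite x2E -[al]lnK ?posrE // -expRM_natl ler_expR.
- by rewrite y2E -[b%:R]lnK ?posrE // -expRM_natl ler_expR.
- by rewrite x1E normrM !normrX; apply: le_trans (pow_bound _ _ (normr_ge0 _) xhb (normr_ge0 _) bee) _; rewrite ler_expR.
- by rewrite y1E normrM !normrX; apply: le_trans (pow_bound _ _ (normr_ge0 _) yhb (normr_ge0 _) bee) _; rewrite ler_expR.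
- rewrite x2E normrX; apply: le_trans (_ : 1 <= _); first by rewrite exprn_ile1 // beta_le1.
  by rewrite -[leLHS]expR0 ler_expR -mulrA mulr_ge0 // ltW.
- rewrite y2E ger0_norm; last by rewrite exprn_ge0 // ltW.
  by rewrite -[b%:R]lnK ?posrE // -expRM_natl ler_expR.
- by [].
- by [].
- by [].
- by rewrite g1E.
- by rewrite g2E.
- by rewrite g2E.
- by rewrite g1E g2E -LE normrM [`|p'%:R|]ger0_norm.
- by [].
- by [].
- by [].
Qed.
End LF.

(** * The equation *)

Section Estimates.
Variable R : realFieldType.

(** A and B stand for the powers of alpha and beta. The neglected terms amount to at most 5 times
    the largest one (or 1), and W >= 5/6 c A1 because A1 >= 6; this produces the factor 6. *)
Lemma left_errors (A1 A2 A3 B1 B2 B3 c : R) (W := c * (A1 + A2 + A3 - (B1 + B2 + B3))) :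
  0 <= c -> `|B1| <= 1 -> `|B2| <= 1 -> `|B3| <= 1 -> 1 <= A3 -> A3 <= A2 -> A2 <= A1 -> 6 <= A1 ->
  [/\ `|c * A1 - W| <= 6 * (A2 / A1) * W, `|c * (A1 + A2) - W| <= 6 * (A3 / A1) * W,
      `|c * (A1 + A2 + A3) - W| <= 6 * (1 / A1) * W
    & c * (A1 - 1) <= W /\ W <= c * (4 * A1)].
Proof.
move=> c0 n1 n2 n3 h3 h2 h1 h6.
have [u1 v1] : -1 <= B1 /\ B1 <= 1 by move: n1; rewrite ler_norml => /andP.
have [u2 v2] : -1 <= B2 /\ B2 <= 1 by move: n2; rewrite ler_norml => /andP.
have [u3 v3] : -1 <= B3 /\ B3 <= 1 by move: n3; rewrite ler_norml => /andP.
have A10 : 0 < A1 by clear - h6; lra.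
have W1 : c * (A1 - 1) <= W by apply: ler_wpM2l => //; clear - h3 h2 v1 v2 v3; lra.
have W2 : W <= c * (4 * A1) by apply: ler_wpM2l => //; clear - h1 h2 h6 u1 u2 u3; lra.
have key M D : 1 <= M -> `|D| <= 5 * M -> `|c * D| <= 6 * (M / A1) * W.
  move=> M1 DM; rewrite normrM ger0_norm //.
  apply: le_trans (_ : c * (5 * M) <= _); first by rewrite ler_wpM2l.
  apply: le_trans (_ : 6 * (M / A1) * (c * (5 / 6 * A1)) <= _); last first.
    apply: ler_wpM2l.
      by rewrite mulr_ge0 // divr_ge0 ?(ltW A10) //; clear - M1; lra.
    by apply: le_trans W1; rewrite ler_wpM2l //; clear - h6; lra.
  rewrite (_ : 6 * _ * _ = c * (5 * M)) //; field; exact: lt0r_neq0.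
split=> //.
- have -> : c * A1 - W = c * (B1 + B2 + B3 - A2 - A3) by rewrite /W; ring.
  by apply: key; [clear - h3 h2; lra | rewrite ler_norml; apply/andP; split; clear - h3 h2 u1 v1 u2 v2 u3 v3; lra].
- have -> : c * (A1 + A2) - W = c * (B1 + B2 + B3 - A3) by rewrite /W; ring.
  by apply: key; [clear - h3 h2; lra | rewrite ler_norml; apply/andP; split; clear - h3 h2 u1 v1 u2 v2 u3 v3; lra].
- have -> : c * (A1 + A2 + A3) - W = c * (B1 + B2 + B3) by rewrite /W; ring.
  by apply: key; [clear; lra | rewrite ler_norml; apply/andP; split; clear - h3 h2 u1 v1 u2 v2 u3 v3; lra].
Qed.

(** With x, y, z the powers of b for the three blocks, V is b - 1 times the integer. It telescopes:
    V = y3 z - d3, where y3 = y2 y - d2 + d3 and y2 = d1 x - d1 + d2, so cutting after a block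
    neglects less than one unit of that position, up to the factor b - 1. *)
Lemma right_errors (b d1 d2 d3 x y z : R)
    (V := d1 * (x - 1) * (y * z) + d2 * (y - 1) * z + d3 * (z - 1))
    (y2 := d1 * x - d1 + d2) (y3 := y2 * y - d2 + d3) :
  2 <= b -> 1 <= d1 -> d1 <= b - 1 -> 0 <= d2 -> d2 <= b - 1 -> 0 <= d3 -> d3 <= b - 1 ->
  b <= x -> b <= y -> b <= z ->
  [/\ `|d1 * (x * y * z) - V| <= (b - 1) * (y * z), `|y2 * (y * z) - V| <= (b - 1) * z,
      `|y3 * z - V| <= b - 1 & (b - 1) * (x * y * z) <= b * V /\ V <= (b - 1) * (x * y * z)] /\
  [/\ 1 <= y2, y2 <= b * x, 1 <= y3 & y3 <= b * (x * y)].
Proof.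
move=> b2 d11 d1b d20 d2b d30 d3b bx by_ bz.
have yz0 : 0 <= y * z by apply: mulr_ge0; clear - b2 by_ bz; lra.
have z0 : 0 <= z by clear - b2 bz; lra.
have y0 : 0 <= y by clear - b2 by_; lra.
have x1z : 0 <= (x - 1) * (y * z) by apply: mulr_ge0 => //; clear - b2 bx; lra.
have y1z : 0 <= (y - 1) * z by apply: mulr_ge0 => //; clear - b2 by_; lra.
have z1 : 0 <= z - 1 by clear - b2 bz; lra.
have x1y : 0 <= (x - 1) * y by apply: mulr_ge0 => //; clear - b2 bx; lra.
have x1 : 0 <= x - 1 by clear - b2 bx; lra.
have y1 : 0 <= y - 1 by clear - b2 by_; lra.
have m1 : d1 * (y * z) <= (b - 1) * (y * z) by rewrite ler_wpM2r.
have m1' : 0 <= d1 * (y * z) by apply: mulr_ge0 => //; clear - d11; lra.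
have m2 : d2 * ((y - 1) * z) <= (b - 1) * ((y - 1) * z) by rewrite ler_wpM2r.
have m2' : 0 <= d2 * ((y - 1) * z) by apply: mulr_ge0.
have m3 : d3 * (z - 1) <= (b - 1) * (z - 1) by rewrite ler_wpM2r.
have m3' : 0 <= d3 * (z - 1) by apply: mulr_ge0.
have m4 : d2 * z <= (b - 1) * z by rewrite ler_wpM2r.
have m4' : 0 <= d2 * z by apply: mulr_ge0.
have m5 : d1 * ((x - 1) * (y * z)) <= (b - 1) * ((x - 1) * (y * z)) by rewrite ler_wpM2r.
have m5' : 1 * ((x - 1) * (y * z)) <= d1 * ((x - 1) * (y * z)) by rewrite ler_wpM2r.
have m6 : b * (d1 * ((x - 1) * (y * z))) <= b * V.
  apply: ler_wpM2l; first by clear - b2; lra.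
  by rewrite /V; clear - m2' m3'; lra.
have m7 : b * ((x - 1) * (y * z)) <= b * (d1 * ((x - 1) * (y * z))).
  by apply: ler_wpM2l; [clear - b2; lra | clear - m5'; lra].
have m8 : 0 <= (x - b) * (y * z) by apply: mulr_ge0 => //; clear - bx; lra.
have m9 : d1 * (x - 1) <= (b - 1) * (x - 1) by rewrite ler_wpM2r.
have m9' : 1 * (x - 1) <= d1 * (x - 1) by rewrite ler_wpM2r.
have m10 : d1 * ((x - 1) * y) <= (b - 1) * ((x - 1) * y) by rewrite ler_wpM2r.
have m10' : 1 * ((x - 1) * y) <= d1 * ((x - 1) * y) by rewrite ler_wpM2r.
have m11 : d2 * (y - 1) <= (b - 1) * (y - 1) by rewrite ler_wpM2r.
have m11' : 0 <= d2 * (y - 1) by apply: mulr_ge0.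
have m12 : 1 * y <= (x - 1) * y by apply: ler_wpM2r => //; clear - b2 bx; lra.
have m13 : 0 <= x * y by apply: mulr_ge0 => //; clear - b2 bx; lra.
split; split.
- by rewrite ler_norml; apply/andP; split; rewrite /V; [clear - m1' m2 m3 b2 | clear - m1 m2' m3']; lra.
- by rewrite ler_norml; apply/andP; split; rewrite /V /y2; [clear - m4' m3 b2 | clear - m4 m3']; lra.
- by rewrite ler_norml; apply/andP; split; rewrite /V /y3 /y2; [clear - d30 b2 | clear - d3b]; lra.
- split; first by clear - m6 m7 m8; lra.
  by rewrite /V; clear - m5 m2 m3 b2; lra.
- by rewrite /y2; clear - m9' bx b2 d20; lra.
- by rewrite /y2; clear - m9 d2b bx b2; lra.
- by rewrite /y3 /y2; clear - m10' m11' m12 d30 by_ b2; lra.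
- by rewrite /y3 /y2; clear - m10 m11 d3b m13 b2; lra.
Qed.
End Estimates.

Section Binet.
Variable R : realType.
Notation al := (@alpha R).
Notation be := (@beta R).

Lemma binet n : Num.sqrt 5 * (fib n)%:R = al ^+ n - be ^+ n.
Proof.
suff : Num.sqrt 5 * (fib n)%:R = al ^+ n - be ^+ n /\ Num.sqrt 5 * (fib n.+1)%:R = al ^+ n.+1 - be ^+ n.+1.
  by case.
elim: n => [|n [IH1 IH2]].
  by split; rewrite ?mulr0 ?subrr // mulr1 !expr1 /alpha /beta; clear; lra.
split => //.
have -> : fib n.+2 = (fib n.+1 + fib n)%N by [].
rewrite natrD mulrDr IH1 IH2.
have a2 : al ^+ 2 = al + 1 by have := alpha_eq R; clear; lra.
have b2 : be ^+ 2 = be + 1 by have := beta_eq R; clear; lra.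
have E z : z ^+ 2 = z + 1 -> z ^+ n.+2 = z ^+ n.+1 + z ^+ n :> R.
  by move=> h; rewrite -addn2 exprD h exprSr; ring.
by rewrite !E //; ring.
Qed.
End Binet.

(** Each step advances one of two indices. While both stay at most 2 their sum is at most 4, so the
    fifth step brings one of them to 3. *)
Lemma alternating_chain (R : realDomainType) (P G H : nat -> R) :
  P 0 <= H 0 -> G 0 <= H 0 -> (forall k, H k <= H k.+1) ->
  (forall j i k, (j < 3)%N -> (i < 3)%N -> (k <= 4)%N -> P j <= H k -> G i <= H k ->
     P j.+1 <= H k.+1 \/ G i.+1 <= H k.+1) ->
  P 3 <= H 5 \/ G 3 <= H 5.
Proof.
move=> P0 G0 Hm step.
have claim k : (k <= 5)%N -> (P 3 <= H k \/ G 3 <= H k) \/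
    exists j i, [/\ (j < 3)%N, (i < 3)%N, (j + i)%N = k & P j <= H k /\ G i <= H k].
  elim: k => [|k IH] hk; first by right; exists 0%N, 0%N.
  case: (IH (ltnW hk)) => [[h|h]|[j [i [j3 i3 E [hP hG]]]]].
  - by left; left; apply: le_trans h (Hm _).
  - by left; right; apply: le_trans h (Hm _).
  case: (step j i k j3 i3 hk hP hG) => h.
  - case: (ltnP j.+1 3) => j3'; last by left; left; move: h; rewrite (_ : j.+1 = 3) //; apply/eqP; rewrite eqn_leq j3 j3'.
    by right; exists j.+1, i; split; rewrite ?addSn ?E //; split => //; apply: le_trans hG (Hm _).
  - case: (ltnP i.+1 3) => i3'; last by left; right; move: h; rewrite (_ : i.+1 = 3) //; apply/eqP; rewrite eqn_leq i3 i3'.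
    by right; exists j, i.+1; split; rewrite ?addnS ?E //; split => //; apply: le_trans hP (Hm _).
case: (claim 5 isT) => // -[j [i [j3 i3 E _]]].
by move: j3 i3 E; rewrite !ltnS => j3 i3 E; have := leq_add j3 i3; rewrite E.
Qed.

Section Step.
Variable R : realType.
Notation al := (@alpha R).
Notation be := (@beta R).

Lemma ln_close (X W d : R) : 0 < W -> 0 <= d -> d <= 1 / 2 -> `|X - W| <= d * W ->
  `|ln X - ln W| <= 2 * d.
Proof.
move=> W0 d0 d1; rewrite ler_norml => /andP[h1 h2].
have X0 : 0 < X.
  have : d * W <= 1 / 2 * W by rewrite ler_wpM2r // ltW.
  by clear - h1 W0; lra.
have L1 : ln X - ln W <= d.
  rewrite -ln_div ?posrE //; apply: le_trans (_ : X / W - 1 <= _).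
    have -> : X / W = 1 + (X / W - 1) by rewrite addrC subrK.
    rewrite [X in _ <= X]addrC addKr; apply: le_ln1Dx.
    by have := divr_gt0 X0 W0; clear; lra.
  by rewrite lerBlDr ler_pdivrMr //; clear - h2; lra.
have L2 : ln W - ln X <= 2 * d.
  rewrite -ln_div ?posrE //; apply: le_trans (_ : W / X - 1 <= _).
    have -> : W / X = 1 + (W / X - 1) by rewrite addrC subrK.
    rewrite [X in _ <= X]addrC addKr; apply: le_ln1Dx.
    by have := divr_gt0 W0 X0; clear; lra.
  rewrite lerBlDr ler_pdivrMr //.
  have : d * (X - (1 - d) * W) >= 0 by rewrite mulr_ge0 //; clear - h1; lra.
  have : d * ((1 / 2 - d) * W) >= 0 by rewrite !mulr_ge0 //; [clear - d1; lra | exact: ltW].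
  by clear - h1; lra.
by rewrite ler_norml; apply/andP; split; clear - L1 L2 d0; lra.
Qed.

(** If both gaps exceeded f = tau h + 4 lb, the two products would be so close to W that |Lambda| <=
    (12 + 2 b) e^(- f) <= 8 b e^(- f) <= b^4 e^(- f) = e^(- tau h), against the lower bound. The
    term 4 lb is there to absorb these constants. *)
Theorem log_form_step (b A B n : nat) (x y : {poly int}) (h lam W p g : R) (lb := ln b%:R : R)
    (tau := 23 / 10 * 10 ^+ 6 * (lam * lam * (lam * lam)) * lb) :
  (2 <= b)%N -> 1 <= ev al x -> 1 <= ev al y -> ev al x <= expR h -> ev al y <= expR h ->
  `|ev be x| <= expR h -> `|ev be y| <= expR h -> 200 <= lam -> lb <= h ->
  100 * (10 ^+ 6 * (lam * lam * (lb * h))) <= A%:R ->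
  100 * (10 ^+ 6 * (lam * lam * (lb * h))) <= B%:R -> (A <= n)%N -> (B <= n)%N ->
  4 * 10 ^+ 6 * (lam * lam * lb * n%:R) <= expR lam ->
  0 < W -> `|ev al x * al ^+ A - W| <= 6 * expR (- p) * W ->
  `|ev al y * b%:R ^+ B - W| <= expR (lb - g) * W ->
  p <= tau * h + 4 * lb \/ g <= tau * h + 4 * lb.
Proof.
move=> b2 x1 y1 xh yh xhb yhb lam200 lbh QA QB An Bn nlam W0 hx hy.
have x0 : 0 < ev al x := lt_le_trans ltr01 x1.
have y0 : 0 < ev al y := lt_le_trans ltr01 y1.
have b2R : 2 <= b%:R :> R by rewrite ler_nat.
have b0 : 0 < b%:R :> R by apply: lt_le_trans b2R.
have a0 : 0 < al := alpha_gt0 R.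
case: (leP p (tau * h + 4 * lb)) => pf; first by left.
case: (leP g (tau * h + 4 * lb)) => gf; first by right.
exfalso; set f := tau * h + 4 * lb in pf gf.
have lga : `|ln (ev al x) - ln (ev al y)| <= h.
  have lx := ln_ge0 x1; have ly := ln_ge0 y1.
  have hx' : ln (ev al x) <= h by rewrite -[h]expRK ler_ln ?posrE ?expR_gt0.
  have hy' : ln (ev al y) <= h by rewrite -[h]expRK ler_ln ?posrE ?expR_gt0.
  by rewrite ler_norml; apply/andP; split; clear - lx ly hx' hy'; lra.
have := log_form_lower b2 x0 y0 xh yh xhb yhb lga lam200 lbh QA QB An Bn nlam.
rewrite -/lb; apply/negP; rewrite -leNgt.
have lb0 : 0 < lb by apply: ln_gt0; clear - b2R; lra.
have f4 : 4 * lb <= f.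
  rewrite /f lerDr /tau !mulr_ge0 ?invr_ge0 ?exprn_ge0 ?(ltW lb0) ?(le_trans (ltW lb0) lbh) //; clear - lam200; lra.
have eb : expR lb = b%:R by rewrite lnK.
have eb4 : expR (4 * lb) = b%:R * b%:R * (b%:R * b%:R).
  by rewrite -eb -!expRD; congr expR; clear; lra.
have bb : 2 * b%:R <= b%:R * b%:R :> R by rewrite ler_wpM2r // ltW.
have bb2 : 4 * (b%:R * b%:R) <= b%:R * b%:R * (b%:R * b%:R) :> R.
  by apply: ler_wpM2r; clear - bb b2R; lra.
have ef : expR (- f) * expR (4 * lb) <= 1.
  by rewrite -expRD -[leRHS]expR0 ler_expR; clear - f4; lra.
have ef0 := expR_gt0 (- f).
have d1 : 6 * expR (- p) <= 6 * expR (- f).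
  by rewrite ler_wpM2l // ler_expR lerN2 ltW.
have d2 : expR (lb - g) <= b%:R * expR (- f).
  by rewrite -eb -expRD ler_expR lerD2l lerN2 ltW.
have ef1 : expR (- f) * (8 * b%:R) <= 1.
  by apply: le_trans ef; rewrite ler_wpM2l ?(ltW ef0) // eb4; clear - bb bb2; lra.
have efb : expR (- f) * 2 <= expR (- f) * b%:R by rewrite ler_wpM2l // ltW.
have e1 : 6 * expR (- f) <= 1 / 2 by clear - ef1 efb ef0; lra.
have e2 : b%:R * expR (- f) <= 1 / 2 by clear - ef1 efb ef0; lra.
have WX : `|ln (ev al x * al ^+ A) - ln W| <= 2 * (6 * expR (- f)).
  apply: ln_close => //; first by rewrite mulr_ge0 // ltW.
  by apply: le_trans hx _; rewrite ler_wpM2r // ltW.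
have WY : `|ln (ev al y * b%:R ^+ B) - ln W| <= 2 * (b%:R * expR (- f)).
  apply: ln_close => //; first by rewrite mulr_ge0 // ltW.
  by apply: le_trans hy _; rewrite ler_wpM2r // ltW.
have EX : ln (ev al x * al ^+ A) = ln (ev al x) + A%:R * ln al.
  by rewrite lnM ?posrE ?exprn_gt0 // lnX_natl.
have EY : ln (ev al y * b%:R ^+ B) = ln (ev al y) + B%:R * lb.
  by rewrite lnM ?posrE ?exprn_gt0 // lnX_natl.
rewrite EX in WX; rewrite EY in WY.
have E : ln (ev al x) - ln (ev al y) + A%:R * ln al - B%:R * lb =
   (ln (ev al x) + A%:R * ln al - ln W) - (ln (ev al y) + B%:R * lb - ln W) by ring.
rewrite E; apply: le_trans (ler_normB _ _) _.
apply: le_trans (lerD WX WY) _.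
have -> : - (23 / 10 * (lam * lam) * (10 ^+ 6 * (lam * lam * (lb * h)))) = - f + 4 * lb.
  by rewrite /f /tau; ring.
have ef2 : expR (- f) * (8 * b%:R) <= expR (- f + 4 * lb).
  by rewrite expRD ler_wpM2l ?(ltW ef0) // eb4; clear - bb bb2; lra.
by apply: le_trans ef2; clear - efb ef0; lra.
Qed.
End Step.

Section Numeric.
Variable R : realType.

Lemma expR1_ge : 262 / 100 <= expR 1 :> R.
Proof.
have h1 : 65 / 64 <= expR (1 / 64) :> R by apply: le_trans (expR_ge1Dx _); lra.
have -> : expR 1 = expR (1 / 64) ^+ 64 :> R by rewrite -expRM_natl; congr expR; lra.
apply: le_trans (_ : (65 / 64) ^+ 64 <= _); first by clear; lra.
by apply: lerXn2r => //; rewrite nnegrE ?expR_ge0 //; lra.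
Qed.

(* With s = N^(1/220) one has lam <= 105 s, so that the factor lam^20 coming from the five
   steps only costs N^(1/11). *)
Lemma parameter_bounds (N lb : R) (lam := 5 / 4 * ln N)
    (tau := 23 / 10 * 10 ^+ 6 * (lam * lam * (lam * lam)) * lb) :
  17 / 25 <= lb -> 309 * 10 ^+ 80 * lb ^+ 11 <= N ->
  [/\ 200 <= lam, 4 * 10 ^+ 6 * (lam * lam * lb * N) <= expR lam,
      3 * lb * (tau + 3) ^+ 5 <= 4 / 10 * N
    & 2 * 10 ^+ 8 * (lam * lam * (lb * lb)) * (3 * lb * (tau + 3) ^+ 4) <= 4 / 10 * N].
Proof.
move=> lb68 NN.
have lb0 : 0 < lb by clear - lb68; lra.
have lbk k : 0 < lb ^+ k by rewrite exprn_gt0.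
have N0 : 0 < N by apply: lt_le_trans NN; rewrite !mulr_gt0 ?exprn_gt0.
pose t := ln N / 220; pose s := expR t; pose w := s ^+ 20.
have s0 : 0 < s by exact: expR_gt0.
have w0 : 0 < w by rewrite exprn_gt0.
have wE : w ^+ 11 = N.
  rewrite /w -exprM /s -expRM_natl -[RHS]lnK ?posrE //; congr expR.
  by rewrite /t; clear; lra.
(* This is where the constant of the theorem is used: 31^11 * 10^66 is below 309 * 10^80. *)
have ww : 31 * 10 ^+ 6 * lb <= w.
  have c0 : 0 <= 31 * 10 ^+ 6 * lb by clear - lb0; lra.
  rewrite -(ler_pXn2r (n := 11)) ?nnegrE ?(ltW w0) // wE; apply: le_trans NN.
  rewrite exprMn; apply: ler_wpM2r; first exact: ltW.
  by clear; lra.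
have w21 : 21 * 10 ^+ 6 <= w by clear - ww lb68; lra.
have t08 : 8 / 10 <= t.
  have : expR 16 <= expR (20%:R * t).
    rewrite (expRM_natl 20 t) -/s -/w; apply: le_trans w21.
    have -> : expR 16 = expR 2 ^+ 8 :> R by rewrite -expRM_natl; congr expR; clear; lra.
    apply: le_trans (_ : (15 / 2) ^+ 8 <= _); last by clear; lra.
    by apply: lerXn2r; rewrite ?nnegrE ?expR_ge0 ?expR2_le //; clear; lra.
  by rewrite ler_expR; clear; lra.
have lamE : lam = 275 * t by rewrite /lam /t; clear; lra.
clearbody lam.
have lam200 : 200 <= lam by rewrite lamE; clear - t08; lra.
have s1 : 1 <= s by rewrite -[leLHS]expR0 ler_expR; clear - t08; lra.
(* The function e^(t - 1) lies above t, and 275 / 2.62 < 105. *)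
have lams : lam <= 105 * s.
  have -> : s = expR (t - 1) * expR 1 by rewrite -expRD subrK.
  have h : t <= expR (t - 1) by have := expR_ge1Dx (t - 1); clear; lra.
  have := ler_pM (ltac:(clear - t08; lra) : 0 <= t) (ltac:(clear; lra) : 0 <= 262 / 100 :> R) h expR1_ge.
  by rewrite lamE; clear - t08; lra.
have lam0 : 0 <= lam by clear - lam200; lra.
have ll : lam * lam <= 105 * s * (105 * s) by apply: ler_pM.
have ll0 : 0 <= lam * lam by apply: mulr_ge0.
have llll : lam * lam * (lam * lam) <= 105 * s * (105 * s) * (105 * s * (105 * s)) by apply: ler_pM.
have s4 : 1 <= s ^+ 4 by rewrite exprn_ege1.
have s4lb : 17 / 25 <= s ^+ 4 * lb.
  by rewrite -[leLHS]mul1r; apply: ler_pM => //; clear; lra.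
(* The product 2.3 * 10^6 * 105^4 is just below 28 * 10^13. *)
have tau3 : tau + 3 <= 28 * 10 ^+ 13 * (s ^+ 4 * lb).
  have : lam * lam * (lam * lam) * lb <= 105 * s * (105 * s) * (105 * s * (105 * s)) * lb.
    by rewrite ler_wpM2r // ltW.
  have -> : 105 * s * (105 * s) * (105 * s * (105 * s)) * lb = 105 ^+ 4 * (s ^+ 4 * lb) by ring.
  by rewrite /tau; clear - s4lb; lra.
have tau0 : 0 <= tau + 3.
  have : 0 <= lam * lam * (lam * lam) * lb by rewrite !mulr_ge0 // ltW.
  by rewrite /tau; clear; lra.
have T k : (tau + 3) ^+ k <= (28 * 10 ^+ 13 * (s ^+ 4 * lb)) ^+ k.
  by apply: lerXn2r; rewrite ?nnegrE //; apply: le_trans tau3.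
(* Of the eleven factors w of N, ten are traded for (31 * 10^6 lb)^10, which dominates the constants
   and the powers of lb; the last one, w = s^20, matches the twentieth power of lam. *)
have w10 : 31 ^+ 10 * 10 ^+ 60 * (w * lb ^+ 10) <= N.
  rewrite -wE [leRHS]exprS mulrCA; apply: ler_wpM2l; first exact: ltW.
  have -> : 31 ^+ 10 * 10 ^+ 60 * lb ^+ 10 = (31 * 10 ^+ 6 * lb) ^+ 10 by ring.
  by apply: lerXn2r; rewrite // nnegrE; [clear - lb0; lra | exact: ltW].
have lbpow i j : (17 / 25) ^+ i * (w * lb ^+ j) <= w * lb ^+ (i + j)%N.
  rewrite mulrCA; apply: ler_wpM2l; first exact: ltW.
  rewrite exprD; apply: ler_wpM2r; first exact: ltW.
  by apply: lerXn2r; rewrite ?nnegrE //; clear - lb68; lra.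
split => //.
(* Because 5/4 * 220 = 220 + 55, the factor 5/4 in lam leaves s^55 to dominate the factors other
   than N. *)
- have -> : expR lam = N * s ^+ 55.
    rewrite /s -expRM_natl -[X in _ = X * _]lnK ?posrE // -expRD; congr expR.
    by rewrite lamE /t; clear; lra.
  rewrite [leLHS](_ : _ = N * (4 * 10 ^+ 6 * (lam * lam * lb))); last by ring.
  apply: ler_wpM2l; first exact: ltW.
  apply: le_trans (_ : s ^+ 42 <= _); last by apply: ler_weXn2l.
  have : lam * lam * lb <= 105 * s * (105 * s) * lb by rewrite ler_wpM2r // ltW.
  have : 31 * 10 ^+ 6 * lb * (21 * 10 ^+ 6) <= w * w.
    by apply: ler_pM => //; clear - lb0; lra.
  move=> h1 h2.
  have : s ^+ 2 * (31 * 10 ^+ 6 * lb * (21 * 10 ^+ 6)) <= s ^+ 2 * (w * w).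
    by apply: ler_wpM2l => //; rewrite exprn_ge0 // ltW.
  have -> : s ^+ 2 * (w * w) = s ^+ 42 by rewrite /w; ring.
  have : 0 <= s ^+ 2 * lb by rewrite mulr_ge0 ?exprn_ge0 ?ltW.
  by clear - h2; lra.
- have h : 3 * lb * (tau + 3) ^+ 5 <= 3 * lb * (28 * 10 ^+ 13 * (s ^+ 4 * lb)) ^+ 5.
    by apply: ler_wpM2l => //; clear - lb0; lra.
  apply: le_trans h _.
  have -> : 3 * lb * (28 * 10 ^+ 13 * (s ^+ 4 * lb)) ^+ 5 = 3 * 28 ^+ 5 * 10 ^+ 65 * (w * lb ^+ 6).
    by rewrite /w; ring.
  have := lbpow 4 6; have := mulr_gt0 w0 (lbk 6); move: w10; clear; rewrite -[(4 + 6)%N]/10%N.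
  by move: (w * lb ^+ 10) (w * lb ^+ 6) => p q; lra.
- have h : lam * lam * (lb * lb) * (3 * lb * (tau + 3) ^+ 4) <=
    105 * s * (105 * s) * (lb * lb) * (3 * lb * (28 * 10 ^+ 13 * (s ^+ 4 * lb)) ^+ 4).
    apply: ler_pM.
    + by rewrite !mulr_ge0 // ltW.
    + by rewrite !mulr_ge0 ?exprn_ge0 // ltW.
    + by apply: ler_wpM2r => //; rewrite mulr_ge0 // ltW.
    + by apply: ler_wpM2l => //; clear - lb0; lra.
  have E : 105 * s * (105 * s) * (lb * lb) * (3 * lb * (28 * 10 ^+ 13 * (s ^+ 4 * lb)) ^+ 4) =
    3 * 105 ^+ 2 * 28 ^+ 4 * 10 ^+ 52 * (s ^+ 18 * lb ^+ 7) by ring.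
  have h2 : s ^+ 18 * lb ^+ 7 <= w * lb ^+ 7.
    by apply: ler_wpM2r; [exact: ltW | apply: ler_weXn2l].
  move: h; rewrite E -(mulrA (2 * 10 ^+ 8)); have := lbpow 3 7; have := mulr_gt0 w0 (lbk 7); move: w10 h2.
  clear; rewrite -[(3 + 7)%N]/10%N.
  move: (w * lb ^+ 10) (w * lb ^+ 7) (s ^+ 18 * lb ^+ 7) (lam * lam * (lb * lb) * _) => p q r v.
  by lra.
Qed.
End Numeric.

Section Facts.
Variable R : realType.
Notation al := (@alpha R).
Notation be := (@beta R).
Variable b : nat.
Notation lb := (ln b%:R : R).

Lemma sqrt5_bounds : 2 <= Num.sqrt 5 :> R /\ Num.sqrt 5 <= 9 / 4 :> R.
Proof.
have h0 : 0 <= Num.sqrt 5 :> R := sqrtr_ge0 _; have h5 := sqrt5_sq R.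
by split; rewrite -ler_sqr ?nnegrE // ?h5; clear; lra.
Qed.

(** The 3 lb in the height comes from 3 (b - 1) <= b^3, which covers the factor b - 1 and the at
    most three powers of alpha in S. *)
Lemma x_height (S : {poly int}) (k : nat) : (2 <= b)%N ->
  1 <= ev al S -> ev al S <= 3 * al ^+ k -> `|ev be S| <= 3 ->
  let x := (b%:Z - 1)%:P * S in
  [/\ ev al x = (b%:R - 1) * ev al S, 1 <= ev al x, ev al x <= expR (3 * lb + k%:R * ln al)
    & `|ev be x| <= expR (3 * lb + k%:R * ln al)].
Proof.
move=> b2 S1 S3 SB x.
have b2R : 2 <= b%:R :> R by rewrite ler_nat.
have E z : ev z x = (b%:R - 1) * ev z S :> R by rewrite rmorphM /= evC rmorphB rmorph1.
have c0 : 1 <= b%:R - 1 :> R by clear - b2R; lra.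
have b0 : 0 < b%:R :> R by clear - b2R; lra.
have ak : 1 <= al ^+ k by rewrite exprn_ege1 // ltW // alpha_gt1.
have c3 : (b%:R - 1) * 3 <= b%:R ^+ 3 :> R.
  have : 2 * b%:R <= b%:R * b%:R :> R by rewrite ler_wpM2r // ltW.
  move=> h; have : 2 * b%:R * 2 <= b%:R * b%:R * b%:R :> R by apply: ler_pM => //; clear - b0; lra.
  by rewrite !exprS expr0; clear - b0; lra.
have ex : expR (3 * lb + k%:R * ln al) = b%:R ^+ 3 * al ^+ k.
  by rewrite expRD (expRM_natl 3) expRM_natl !lnK ?posrE // alpha_gt0.
rewrite ex !E; split => //.
- by rewrite -[leLHS]mulr1; apply: ler_pM => //; clear - c0; lra.
- apply: le_trans (_ : (b%:R - 1) * (3 * al ^+ k) <= _).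
    by apply: ler_wpM2l => //; clear - c0; lra.
  by rewrite mulrA; apply: ler_wpM2r => //; clear - ak; lra.
- rewrite normrM ger0_norm; last by clear - c0; lra.
  apply: le_trans (_ : (b%:R - 1) * 3 * 1 <= _).
    by rewrite mulr1; apply: ler_wpM2l => //; clear - c0; lra.
  by apply: ler_pM => //; clear - c0; lra.
Qed.

(** At alpha and beta, [2 * 'X - 1] takes the values sqrt 5 and - sqrt 5, so the factor sqrt 5 stays
    in Z[alpha]. Bounding it by b^2 and y by b^(k + 1) gives the 3 lb. *)
Lemma y_height (y : int) (k e e' L : nat) (V : R) : (2 <= b)%N -> 1 <= y%:~R :> R ->
  y%:~R <= b%:R * b%:R ^+ k :> R -> 0 < V ->
  `|y%:~R * b%:R ^+ e - V| <= (b%:R - 1) * b%:R ^+ e' -> (e' <= L)%N ->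
  (b%:R - 1) * b%:R ^+ L <= b%:R * V ->
  let yp := (2 * 'X - 1) * y%:P in
  [/\ 1 <= ev al yp, ev al yp <= expR (3 * lb + k%:R * lb), `|ev be yp| <= expR (3 * lb + k%:R * lb)
   & `|ev al yp * b%:R ^+ e - Num.sqrt 5 * V| <= expR (lb - (L - e')%N%:R * lb) * (Num.sqrt 5 * V)].
Proof.
move=> b2 y1 yk V0 yV eL VL yp.
have [s1 s2] := sqrt5_bounds.
have b2R : 2 <= b%:R :> R by rewrite ler_nat.
have b0 : 0 < b%:R :> R by clear - b2R; lra.
have s0 : 0 <= Num.sqrt 5 :> R by clear - s1; lra.
have ea : ev al yp = Num.sqrt 5 * y%:~R.
  rewrite /yp rmorphM rmorphB rmorphM /= evX rmorph1 rmorph_nat; congr (_ * _); last exact: evC.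
  by rewrite /alpha; clear; lra.
have eb : ev be yp = - (Num.sqrt 5 * y%:~R).
  rewrite /yp rmorphM rmorphB rmorphM /= evX rmorph1 rmorph_nat -mulNr; congr (_ * _); last exact: evC.
  by rewrite /beta; clear; lra.
have ex : expR (3 * lb + k%:R * lb) = b%:R ^+ 3 * b%:R ^+ k.
  by rewrite expRD (expRM_natl 3) expRM_natl !lnK ?posrE.
have up : Num.sqrt 5 * y%:~R <= b%:R ^+ 3 * b%:R ^+ k :> R.
  have -> : b%:R ^+ 3 * b%:R ^+ k = (b%:R * b%:R) * (b%:R * b%:R ^+ k) :> R by ring.
  have h4 : 2 * 2 <= b%:R * b%:R :> R by apply: ler_pM.
  have y0 : 0 <= y%:~R :> R by clear - y1; lra.
  have sb : Num.sqrt 5 <= b%:R * b%:R :> R by clear - s2 h4; lra.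
  exact: ler_pM.
have y0 : 0 <= y%:~R :> R by clear - y1; lra.
rewrite ex eb normrN ea ger0_norm; last by apply: mulr_ge0.
split => //.
  by rewrite -[leLHS]mulr1; apply: ler_pM => //; clear - s1; lra.
rewrite -[_ * _ * _]mulrA -mulrBr normrM ger0_norm // [leRHS]mulrCA.
apply: ler_wpM2l => //; apply: le_trans yV _.
rewrite expRB expRM_natl lnK ?posrE // mulrAC ler_pdivlMr ?exprn_gt0 //.
by rewrite -mulrA -exprD subnKC.
Qed.
End Facts.

(* The value 0 past the third exponent corresponds to the bounded remainder left once all
   terms are taken into account. *)
Definition exponents (m1 m2 m3 j : nat) : nat := match j with 0 => m1 | 1 => m2 | 2 => m3 | _ => 0 end%N.

Section Main.
Variable R : realType.
Notation al := (@alpha R).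
Notation be := (@beta R).

(** Index j keeps the terms n_1, ..., n_(j+1) and factors out their smallest power of alpha. The
    powers left in x are at most the gap n_1 - n_(j+1), so no other quantity than this gap and b
    enters its height. *)
Lemma x_approx (b n1 n2 n3 j : nat) (W : R) : (2 <= b)%N -> (n3 <= n2)%N -> (n2 <= n1)%N ->
  6 <= al ^+ n1 ->
  W = (b%:R - 1) * (al ^+ n1 + al ^+ n2 + al ^+ n3 - (be ^+ n1 + be ^+ n2 + be ^+ n3)) ->
  (j < 3)%N -> exists x : {poly int},
  let e := (3 * ln b%:R + (n1 - exponents n1 n2 n3 j)%N%:R * ln al) in
  [/\ 1 <= ev al x, ev al x <= expR e, `|ev be x| <= expR e
    & `|ev al x * al ^+ exponents n1 n2 n3 j - W|
        <= 6 * expR (- ((n1 - exponents n1 n2 n3 j.+1)%N%:R * ln al)) * W].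
Proof.
move=> b2 n32 n21 h6 WE j3.
have b2R : 2 <= b%:R :> R by rewrite ler_nat.
have c0 : 0 <= b%:R - 1 :> R by clear - b2R; lra.
have a0 : 0 < al := alpha_gt0 R.
have a1 : 1 <= al := ltW (alpha_gt1 R).
have ap k : 1 <= al ^+ k by rewrite exprn_ege1.
have bp k : `|be ^+ k| <= 1 by rewrite normrX exprn_ile1 // beta_le1.
have am m n : (m <= n)%N -> al ^+ m <= al ^+ n by move=> mn; apply: ler_weXn2l.
have er m : (m <= n1)%N -> expR (- ((n1 - m)%N%:R * ln al)) = al ^+ m / al ^+ n1.
  move=> mn; rewrite expRN expRM_natl lnK ?posrE // -[in RHS](subnK mn) exprD invfM mulrC divfK //.
  by rewrite expf_neq0 // gt_eqF.
have [E1 E2 E3 _] := left_errors c0 (bp n1) (bp n2) (bp n3) (ap n3) (am _ _ n32) (am _ _ n21) h6.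
rewrite -WE in E1 E2 E3.
have n31 := leq_trans n32 n21.
case: j j3 => [|[|[|//]]] _ /=.
- have [||| e1 e2 e3 e4] := @x_height R b 1 (n1 - n1) b2; rewrite ?rmorph1 ?normr1 //.
  + by have := ap (n1 - n1)%N; clear; lra.
  + by clear; lra.
  exists ((b%:Z - 1)%:P * 1); split => //.
  by rewrite e1 rmorph1 mulr1 er.
- pose S : {poly int} := 1 + 'X^(n1 - n2).
  have SE z : ev z S = 1 + z ^+ (n1 - n2) :> R by rewrite rmorphD rmorph1 rmorphXn /= evX.
  have [||| e1 e2 e3 e4] := @x_height R b S (n1 - n2) b2; rewrite ?SE //.
  + by have := ap (n1 - n2)%N; clear; lra.
  + by have := ap (n1 - n2)%N; clear; lra.
  + by apply: le_trans (ler_normD _ _) _; rewrite normr1; have := bp (n1 - n2)%N; clear; lra.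
  exists ((b%:Z - 1)%:P * S); split => //.
  have -> : ev al ((b%:Z - 1)%:P * S) * al ^+ n2 = (b%:R - 1) * (al ^+ n1 + al ^+ n2).
    by rewrite e1 SE -[in RHS](subnK n21) exprD; ring.
  by rewrite er.
- pose S : {poly int} := 'X^(n1 - n3) + 'X^(n2 - n3) + 1.
  have SE z : ev z S = z ^+ (n1 - n3) + z ^+ (n2 - n3) + 1 :> R.
    by rewrite !rmorphD rmorph1 !rmorphXn /= evX.
  have [||| e1 e2 e3 e4] := @x_height R b S (n1 - n3) b2; rewrite ?SE //.
  + by have := ap (n1 - n3)%N; have := ap (n2 - n3)%N; clear; lra.
  + have := ap (n1 - n3)%N; have := am (n2 - n3)%N (n1 - n3)%N (leq_sub2r _ n21).
    by clear; lra.
  + apply: le_trans (ler_normD _ _) _; rewrite normr1.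
    have := ler_normD (be ^+ (n1 - n3)) (be ^+ (n2 - n3)).
    by have := bp (n1 - n3)%N; have := bp (n2 - n3)%N; clear; lra.
  exists ((b%:Z - 1)%:P * S); split => //.
  have -> : ev al ((b%:Z - 1)%:P * S) * al ^+ n3 = (b%:R - 1) * (al ^+ n1 + al ^+ n2 + al ^+ n3).
    have f1 : al ^+ n1 = al ^+ (n1 - n3) * al ^+ n3 by rewrite -exprD subnK.
    have f2 : al ^+ n2 = al ^+ (n2 - n3) * al ^+ n3 by rewrite -exprD subnK.
    by rewrite e1 SE f1 f2; ring.
  by rewrite er // expr0.
Qed.

(** The witnesses are sqrt 5 times the telescoped leading blocks d1, y2, y3 of [right_errors]. *)
Lemma y_approx (b l1 l2 l3 d1 d2 d3 i : nat)
  (V := d1%:R * (b%:R ^+ l1 - 1) * (b%:R ^+ l2 * b%:R ^+ l3) + d2%:R * (b%:R ^+ l2 - 1) * b%:R ^+ l3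
     + d3%:R * (b%:R ^+ l3 - 1) : R) (L := (l1 + l2 + l3)%N) (f := exponents L (l2 + l3) l3) :
  (2 <= b)%N -> (0 < l1)%N -> (0 < l2)%N -> (0 < l3)%N -> (0 < d1)%N ->
  (d1 < b)%N -> (d2 < b)%N -> (d3 < b)%N -> 0 < V -> (i < 3)%N -> exists y : {poly int},
  let e := (3 * ln b%:R + (L - f i)%N%:R * ln b%:R) in
  [/\ 1 <= ev al y, ev al y <= expR e, `|ev be y| <= expR e
    & `|ev al y * b%:R ^+ f i - Num.sqrt 5 * V|
        <= expR (ln b%:R - (L - f i.+1)%N%:R * ln b%:R) * (Num.sqrt 5 * V)].
Proof.
move=> b2 l10 l20 l30 d10 d1b d2b d3b V0 i3.
have b2R : 2 <= b%:R :> R by rewrite ler_nat.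
have b1R : 1 <= b%:R :> R by clear - b2R; lra.
have dle d : (d < b)%N -> d%:R <= b%:R - 1 :> R by move=> db; rewrite lerBrDr natr1 ler_nat.
have bp l : (0 < l)%N -> b%:R <= b%:R ^+ l :> R by move=> h; apply: ler_eXnr.
have d1R : 1 <= d1%:R :> R by rewrite ler1n.
have [[E1 E2 E3 [E4 _]] [F1 F2 F3 F4]] := right_errors b2R d1R (dle _ d1b) (ler0n _ d2) (dle _ d2b)
  (ler0n _ d3) (dle _ d3b) (bp _ l10) (bp _ l20) (bp _ l30).
rewrite -/V in E1 E2 E3 E4.
have LE : b%:R ^+ L = b%:R ^+ l1 * b%:R ^+ l2 * b%:R ^+ l3 :> R by rewrite !exprD.
rewrite -LE in E4.
case: i i3 => [|[|[|//]]] _ /=.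
- eexists; apply: (y_height (y := d1%:Z) (k := (L - L)%N) (L := L)) => //.
  + by rewrite subnn expr0 mulr1; have := dle _ d1b; rewrite -[d1%:~R]/(d1%:R); clear; lra.
  + by rewrite LE exprD.
  + by rewrite /L -addnA leq_addl.
- eexists; apply: (y_height (y := d1%:Z * (b ^ l1)%N%:Z - d1%:Z + d2%:Z) (k := (L - (l2 + l3))%N) (L := L)) => //.
  + rewrite rmorphD rmorphB rmorphM /= -[(b ^ l1)%N%:~R]/((b ^ l1)%N%:R) natrX; exact: F1.
  + rewrite rmorphD rmorphB rmorphM /= -[(b ^ l1)%N%:~R]/((b ^ l1)%N%:R) natrX.
    by rewrite /L -addnA addnK; exact: F2.
  + rewrite rmorphD rmorphB rmorphM /= -[(b ^ l1)%N%:~R]/((b ^ l1)%N%:R) natrX exprD; exact: E2.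
  + by rewrite /L leq_addl.
- eexists; apply: (y_height (y := (d1%:Z * (b ^ l1)%N%:Z - d1%:Z + d2%:Z) * (b ^ l2)%N%:Z - d2%:Z + d3%:Z)
    (k := (L - l3)%N) (L := L)) => //.
  + rewrite rmorphD rmorphB rmorphM rmorphD rmorphB rmorphM /= -[(b ^ l1)%N%:~R]/((b ^ l1)%N%:R) -[(b ^ l2)%N%:~R]/((b ^ l2)%N%:R) !natrX; exact: F3.
  + rewrite rmorphD rmorphB rmorphM rmorphD rmorphB rmorphM /= -[(b ^ l1)%N%:~R]/((b ^ l1)%N%:R) -[(b ^ l2)%N%:~R]/((b ^ l2)%N%:R) !natrX.
    by rewrite /L addnK exprD; exact: F4.
  + rewrite rmorphD rmorphB rmorphM rmorphD rmorphB rmorphM /= -[(b ^ l1)%N%:~R]/((b ^ l1)%N%:R) -[(b ^ l2)%N%:~R]/((b ^ l2)%N%:R) !natrX expr0 mulr1; exact: E3.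
Qed.
End Main.

Section Main.
Variable R : realType.
Notation al := (@alpha R).
Notation be := (@beta R).

(** The first relation compares logarithms in alpha^n1 <= 9/4 b^L + 1 < b^(L + 3). In the second, ln
    alpha <= 1/2 < 68/100 <= ln b leaves a margin that swallows the constants since n1 >= 10^6. *)
Lemma size_relations (b n1 L : nat) (V W c : R) : (2 <= b)%N -> c = b%:R - 1 ->
  10 ^+ 6 <= n1%:R :> R -> W = Num.sqrt 5 * V -> 0 < V ->
  c * (al ^+ n1 - 1) <= W -> W <= c * (4 * al ^+ n1) ->
  c * b%:R ^+ L <= b%:R * V -> V <= c * b%:R ^+ L ->
  n1%:R * ln al < L%:R * ln b%:R + 3 * ln b%:R /\ (L <= n1)%N.
Proof.
move=> b2 cE n16 WE V0 h1 h2 h3 h4.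
have b2R : 2 <= b%:R :> R by rewrite ler_nat.
have b0 : 0 < b%:R :> R by clear - b2R; lra.
have c0 : 0 < c by rewrite cE; clear - b2R; lra.
have [s1 s2] := sqrt5_bounds R.
have al0 : 0 < al := alpha_gt0 R.
have bL : 1 <= b%:R ^+ L :> R by apply: exprn_ege1; clear - b2R; lra.
have A0 : 0 < al ^+ n1 by rewrite exprn_gt0.
have B0 : 0 < b%:R ^+ L :> R by rewrite exprn_gt0.
have lb0 : 68 / 100 <= ln b%:R :> R.
  apply: le_trans (ln2_ge R) _; by rewrite ler_ln ?posrE.
split.
  have sV : Num.sqrt 5 * V <= 9 / 4 * (c * b%:R ^+ L) by apply: ler_pM => //; [clear - s1; lra | exact: ltW].
  have : al ^+ n1 - 1 <= 9 / 4 * b%:R ^+ L.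
    by rewrite -(ler_pM2l c0); move: h1; rewrite WE; clear - sV; lra.
  have h8 : 2 * 2 * b%:R ^+ L <= b%:R * b%:R * b%:R ^+ L :> R.
    by apply: ler_wpM2r; [exact: ltW | apply: ler_pM].
  have h9 : 1 * (b%:R * b%:R * b%:R ^+ L) <= b%:R * (b%:R * b%:R * b%:R ^+ L) :> R.
    by apply: ler_wpM2r; [rewrite !mulr_ge0 // ltW | clear - b2R; lra].
  move=> h10; have : al ^+ n1 < b%:R ^+ L * b%:R ^+ 3.
    by rewrite !exprS expr0 mulr1; clear - h8 h9 h10 bL; lra.
  move=> h11; have : ln (al ^+ n1) < ln (b%:R ^+ L * b%:R ^+ 3).
    by rewrite ltr_ln ?posrE // mulr_gt0 // exprn_gt0.
  by rewrite lnM ?posrE ?exprn_gt0 // !lnX_natl.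
have V2 : 2 * V <= c * (4 * al ^+ n1).
  by apply: le_trans h2; rewrite WE; apply: ler_wpM2r => //; exact: ltW.
have bA : b%:R ^+ L <= b%:R ^+ 2 * al ^+ n1.
  rewrite -(ler_pM2l c0).
  have : b%:R * (2 * V) <= b%:R * (c * (4 * al ^+ n1)) by apply: ler_wpM2l => //; exact: ltW.
  have : 2 * (b%:R * (c * al ^+ n1)) <= b%:R * (b%:R * (c * al ^+ n1)).
    by apply: ler_wpM2r => //; rewrite !mulr_ge0 // ltW.
  by rewrite expr2; clear - h3; lra.
have : ln (b%:R ^+ L) <= ln (b%:R ^+ 2 * al ^+ n1).
  by rewrite ler_ln ?posrE // mulr_gt0 // exprn_gt0.
rewrite lnM ?posrE ?exprn_gt0 // !lnX_natl // => {}bA.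
rewrite -(ler_nat R).
have na : n1%:R * ln al <= n1%:R * (1 / 2) by apply: ler_wpM2l => //; exact: ln_alpha_le.
case: (leP L%:R (2 : R)) => hL; first by clear - hL n16; lra.
have : (L%:R - 2) * (68 / 100) <= (L%:R - 2) * ln b%:R :> R.
  by apply: ler_wpM2l => //; clear - hL; lra.
by clear - na bA n16; lra.
Qed.

(** The equation is taken multiplied by b - 1, which makes both sides polynomial in the powers of b.
    Assuming n1 large, the chain of five steps bounds the full size of one side by less than 4/10
    n1. *)
Theorem repdigit_bound (b n1 n2 n3 l1 l2 l3 d1 d2 d3 : nat) :
  (2 <= b)%N -> (n3 <= n2)%N -> (n2 <= n1)%N -> (0 < l1)%N -> (0 < l2)%N -> (0 < l3)%N ->
  (0 < d1)%N -> (d1 < b)%N -> (d2 < b)%N -> (d3 < b)%N ->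
  (b%:R - 1) * ((fib n1)%:R + (fib n2)%:R + (fib n3)%:R) =
    d1%:R * (b%:R ^+ l1 - 1) * (b%:R ^+ l2 * b%:R ^+ l3) + d2%:R * (b%:R ^+ l2 - 1) * b%:R ^+ l3
     + d3%:R * (b%:R ^+ l3 - 1) :> R ->
  n1%:R < 309 * 10 ^+ 80 * ln b%:R ^+ 11 :> R.
Proof.
move=> b2 n32 n21 l10 l20 l30 d10 d1b d2b d3b.
set V := (X in _ = X) => EV; rewrite ltNge; apply/negP => NN.
set lb : R := ln b%:R in NN *.
have b2R : 2 <= b%:R :> R by rewrite ler_nat.
have lb68 : 17 / 25 <= lb.
  apply: le_trans (_ : ln 2 <= _); first by apply: le_trans (ln2_ge R); clear; lra.
  by rewrite ler_ln ?posrE //; clear - b2R; lra.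
have lb0 : 0 < lb by clear - lb68; lra.
have n16 : 10 ^+ 6 <= n1%:R :> R.
  apply: le_trans NN.
  have : (17 / 25) ^+ 11 <= lb ^+ 11 by apply: lerXn2r; rewrite ?nnegrE //; clear - lb0; lra.
  by move: (lb ^+ 11) => z; clear; lra.
have [lam200 nlam N1 N2] := parameter_bounds lb68 NN.
set lam := 5 / 4 * ln n1%:R in lam200 nlam N1 N2.
pose tau := 23 / 10 * 10 ^+ 6 * (lam * lam * (lam * lam)) * lb.
rewrite -/tau in N1 N2.
have a0 : 0 < ln al := ln_alpha_gt0 R.
have a1 : ln al <= 1 / 2 := ln_alpha_le R.
have a2 : 4 / 10 <= ln al := ln_alpha_ge R.
have al0 : 0 < al := alpha_gt0 R.
have h6 : 6 <= al ^+ n1.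
  rewrite -[al]lnK ?posrE // -expRM_natl; apply: le_trans (expR_ge1Dx _).
  have : n1%:R * (4 / 10) <= n1%:R * ln al by apply: ler_wpM2l.
  by clear - n16; lra.
have na : 4 / 10 * n1%:R <= n1%:R * ln al by rewrite mulrC; apply: ler_wpM2l.
pose W := Num.sqrt 5 * V.
have WE : W = (b%:R - 1) * (al ^+ n1 + al ^+ n2 + al ^+ n3 - (be ^+ n1 + be ^+ n2 + be ^+ n3)).
  have E1 := binet R n1; have E2 := binet R n2; have E3 := binet R n3.
  have -> : al ^+ n1 + al ^+ n2 + al ^+ n3 - (be ^+ n1 + be ^+ n2 + be ^+ n3) =
    (al ^+ n1 - be ^+ n1) + (al ^+ n2 - be ^+ n2) + (al ^+ n3 - be ^+ n3) by ring.
  by rewrite -E1 -E2 -E3 /W -EV; ring.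
have dle d : (d < b)%N -> d%:R <= b%:R - 1 :> R by move=> db; rewrite lerBrDr natr1 ler_nat.
have bp l : (0 < l)%N -> b%:R <= b%:R ^+ l :> R by move=> h; apply: ler_eXnr => //; clear - b2R; lra.
have d1R : 1 <= d1%:R :> R by rewrite ler1n.
have c0 : 0 <= b%:R - 1 :> R by clear - b2R; lra.
have c1 : 0 < b%:R - 1 :> R by clear - b2R; lra.
have bep k : `|be ^+ k| <= 1 by rewrite normrX exprn_ile1 // beta_le1.
have am m n : (m <= n)%N -> al ^+ m <= al ^+ n by move=> mn; apply: ler_weXn2l => //; exact: ltW (alpha_gt1 R).
have ap k : 1 <= al ^+ k by rewrite exprn_ege1 // ltW // alpha_gt1.
have [_ _ _ [W1 W2]] := left_errors c0 (bep n1) (bep n2) (bep n3) (ap n3) (am _ _ n32) (am _ _ n21) h6.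
rewrite -WE in W1 W2.
have [[_ _ _ [V1 V2]] _] := right_errors b2R d1R (dle _ d1b) (ler0n _ d2) (dle _ d2b)
  (ler0n _ d3) (dle _ d3b) (bp _ l10) (bp _ l20) (bp _ l30).
rewrite -/V in V1 V2.
pose L := (l1 + l2 + l3)%N.
have LE : b%:R ^+ L = b%:R ^+ l1 * b%:R ^+ l2 * b%:R ^+ l3 :> R by rewrite !exprD.
rewrite -LE in V1 V2.
have s0 : 0 < Num.sqrt 5 :> R by case: (sqrt5_bounds R) => s1 _; clear - s1; lra.
have W0 : 0 < W.
  by apply: lt_le_trans W1; rewrite mulr_gt0 //; clear - h6; lra.
have V0 : 0 < V by move: W0; rewrite /W pmulr_rgt0.
have [nL Ln] := size_relations b2 erefl n16 erefl V0 W1 W2 V1 V2.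
rewrite -/lb in nL.
have lam0 : 0 < lam by clear - lam200; lra.
have tauE : tau = 23 / 10 * 10 ^+ 6 * (lam * lam * (lam * lam)) * lb by [].
clearbody tau lam.
have tau0 : 0 < tau.
  have l4 : 0 < lam * lam * (lam * lam) * lb by rewrite !mulr_gt0.
  by rewrite tauE; clear - l4; lra.
have tau3 : 1 <= tau + 3 by clear - tau0; lra.
(* P and G are the logarithmic gaps on the two sides, H k bounds those reached after k
   steps. *)
pose P j : R := (n1 - exponents n1 n2 n3 j)%N%:R * ln al.
pose G i : R := (L - exponents L (l2 + l3) l3 i)%N%:R * lb.
(* After k steps the heights are at most H k + 3 lb = 3 lb (tau + 3)^k. This form starts at 0 and
   satisfies tau (H k + 3 lb) + 4 lb <= H (k + 1), the output of one application of
   [log_form_step]. *)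
pose H k : R := 3 * lb * ((tau + 3) ^+ k - 1).
have tk k : 1 <= (tau + 3) ^+ k by rewrite exprn_ege1.
have tS k : (tau + 3) ^+ k.+1 = tau * (tau + 3) ^+ k + 3 * (tau + 3) ^+ k by rewrite exprS mulrDl.
have lbt k : lb <= lb * (tau + 3) ^+ k by rewrite ler_peMr // ltW.
have lbtt k : 0 <= tau * (lb * (tau + 3) ^+ k) by rewrite !mulr_ge0 ?exprn_ge0 ?ltW // (lt_le_trans ltr01).
have h4E : H 4 + 3 * lb = 3 * lb * (tau + 3) ^+ 4 by rewrite /H; ring.
have Hm k : H k <= H k.+1.
  by rewrite /H tS; have := lbt k; have := lbtt k; clear - lb0; lra.
have H4 k : (k <= 4)%N -> 3 * lb * (tau + 3) ^+ k <= 3 * lb * (tau + 3) ^+ 4.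
  move=> k4; apply: ler_wpM2l; first by clear - lb0; lra.
  by apply: ler_weXn2l.
have ll0 : 200 * 200 <= lam * lam by apply: ler_pM => //; clear; lra.
set h4 := 3 * lb * (tau + 3) ^+ 4 in h4E H4 N2.
have h40 : 3 * lb <= h4 by rewrite /h4; have := lbt 4; clear - lb0; lra.
have h400 : 0 < h4 by clear - h40 lb0; lra.
clearbody h4.
have lbb : 17 / 25 * lb <= lb * lb by apply: ler_wpM2r => //; exact: ltW.
have Y1 : lam * lam * lb * h4 * (17 / 25) <= lam * lam * (lb * lb) * h4.
  have : lam * lam * h4 * (17 / 25 * lb) <= lam * lam * h4 * (lb * lb).
    by apply: ler_wpM2l => //; rewrite !mulr_ge0 // ltW.
  by clear; lra.
have Y2 : 200 * 200 * (17 / 25) * h4 <= lam * lam * lb * h4.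
  apply: ler_wpM2r; first exact: ltW.
  by apply: ler_pM => //; clear; lra.
have nf j : (exponents n1 n2 n3 j <= n1)%N by case: j => [|[|[|j]]] //=; exact: leq_trans n21.
have Lf i : (exponents L (l2 + l3) l3 i <= L)%N.
  by case: i => [|[|[|i]]] //=; rewrite /L ?leq_addl // -addnA leq_addl.
case: (@alternating_chain R P G H).
- by rewrite /P /H /= subnn mul0r expr0 subrr mulr0.
- by rewrite /G /H /= subnn mul0r expr0 subrr mulr0.
- exact: Hm.
- move=> j i k j3 i3 k4 hP hG.
  have [x /= [x1 x2 x3 x4]] := x_approx b2 n32 n21 h6 WE j3.
  have [y /= [y1 y2 y3 y4]] := y_approx b2 l10 l20 l30 d10 d1b d2b d3b V0 i3.
  rewrite -/V -/W in y4.
  pose h := 3 * lb * (tau + 3) ^+ k.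
  have hE : h = H k + 3 * lb by rewrite /h /H; ring.
  have hh4 : h <= h4 := H4 k k4.
  have Ph : 3 * lb + P j <= h by rewrite hE; clear - hP; lra.
  have Gh : 3 * lb + G i <= h by rewrite hE; clear - hG; lra.
  have le_h z e : z <= expR e -> e <= h -> z <= expR h.
    by move=> hz he; apply: le_trans hz _; rewrite ler_expR.
  have lbh : lb <= h by rewrite /h; have := lbt k; clear - lb0; lra.
  have llh : lam * lam * (lb * h) <= lam * lam * (lb * h4).
    by apply: ler_wpM2l; [rewrite mulr_ge0 // ltW | apply: ler_wpM2l => //; exact: ltW].
  (* The gap reached so far is at most h4, which N2 makes small against n1; the exponent kept is
     therefore still large enough for the lower bound. The same holds on the other side by [nL]. *)
  have QA : 100 * (10 ^+ 6 * (lam * lam * (lb * h))) <= (exponents n1 n2 n3 j)%:R.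
    have Pj : n1%:R * ln al - (exponents n1 n2 n3 j)%:R * ln al <= h4.
      rewrite -mulrBl -natrB //; apply: le_trans (_ : P j <= _) => //.
      by clear - Ph hh4 lb0; lra.
    have : (exponents n1 n2 n3 j)%:R * ln al <= (exponents n1 n2 n3 j)%:R * (1 / 2) by apply: ler_wpM2l.
    have e0 : 0 <= (exponents n1 n2 n3 j)%:R :> R := ler0n _ _.
    by clear - Pj na N2 Y1 Y2 llh e0; lra.
  have QB : 100 * (10 ^+ 6 * (lam * lam * (lb * h))) <= (exponents L (l2 + l3) l3 i)%:R.
    have Gi : L%:R * lb - (exponents L (l2 + l3) l3 i)%:R * lb <= h4.
      rewrite -mulrBl -natrB //; apply: le_trans (_ : G i <= _) => //.
      by clear - Gh hh4 lb0; lra.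
    rewrite -(ler_pM2r lb0).
    have llh' : lb * (lam * lam * (lb * h)) <= lb * (lam * lam * (lb * h4)).
      by apply: ler_wpM2l => //; exact: ltW.
    by clear - Gi nL na N2 Y1 Y2 llh' h40 h400; lra.
  case: (log_form_step (n := n1) (lam := lam) (h := h) (W := W) (p := P j.+1) (g := G i.+1) b2 x1 y1
    (le_h _ _ x2 Ph) (le_h _ _ y2 Gh) (le_h _ _ x3 Ph) (le_h _ _ y3 Gh) lam200 lbh QA QB (nf j)
    (leq_trans (Lf i) Ln) nlam W0 x4 y4) => hs; [left | right];
    by apply: le_trans hs _; rewrite -/lb -tauE /h /H tS; have := lbt k; have := lbtt k; clear - lb0; lra.
(* At index 3 the gap is the whole of n1 ln alpha or L ln b, both too large for H 5 by N1. *)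
- have -> : P 3 = n1%:R * ln al by rewrite /P /= subn0.
  by rewrite /H; clear - na N1 lb0; lra.
- have -> : G 3 = L%:R * lb by rewrite /G /= subn0.
  by rewrite /H; clear - na nL N1 lb0; lra.
Qed.
End Main.

(* Transfer to the integers and real logarithm of the statement *)
From mathcomp Require Import Rstruct Rstruct_topology.

Lemma Nat_powE b l : Nat.pow b l = (b ^ l)%N.
Proof. by elim: l => //= l ->; rewrite multE expnS. Qed.

Lemma repdigit_bound_Stdlib (b n1 n2 n3 l1 l2 l3 d1 d2 d3 : nat) :
  Peano.le 2 b -> Peano.le n3 n2 -> Peano.le n2 n1 ->
  Peano.le 1 l1 -> Peano.le 1 l2 -> Peano.le 1 l3 ->
  Peano.lt d1 b -> Peano.lt d2 b -> Peano.lt d3 b -> Peano.lt 0 d1 ->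
  Nat.mul (Nat.sub b 1) (Nat.add (Nat.add (fib n1) (fib n2)) (fib n3)) =
  Nat.add (Nat.add
    (Nat.mul (Nat.mul d1 (Nat.sub (Nat.pow b l1) 1)) (Nat.mul (Nat.pow b l2) (Nat.pow b l3)))
    (Nat.mul (Nat.mul d2 (Nat.sub (Nat.pow b l2) 1)) (Nat.pow b l3)))
    (Nat.mul d3 (Nat.sub (Nat.pow b l3) 1)) ->
  Rdefinitions.Rlt (Raxioms.INR n1) (Rdefinitions.Rmult
    (Rdefinitions.Rmult (Raxioms.INR 309%N) (Rpow_def.pow (Raxioms.INR 10%N) 80%N))
    (Rpow_def.pow (Rpower.ln (Raxioms.INR b)) 11%N)).
Proof.
move=> /ssrnat.leP b2 /ssrnat.leP n32 /ssrnat.leP n21 /ssrnat.leP l10 /ssrnat.leP l20 /ssrnat.leP l30 /ssrnat.ltP d1b /ssrnat.ltP d2b /ssrnat.ltP d3b /ssrnat.ltP d10.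
rewrite !Nat_powE !multE !plusE !minusE => E.
have bl l : (0 < b ^ l)%N by rewrite expn_gt0 (leq_trans _ b2).
apply/RltP; rewrite !RmultE !RpowE RlnE !INRE.
apply: (repdigit_bound b2 n32 n21 l10 l20 l30 d10 d1b d2b d3b).
have := congr1 (fun n => n%:R : Rdefinitions.R) E.
by rewrite !(natrD, natrM) !natrB ?(ltnW b2) // !natrX.
Qed.

End LinearForms.

From Stdlib Require Import Arith Reals Lia.

Lemma repdigit_mul (b d l : nat) : 2 <= b -> (b - 1) * repdigit b d l = d * (b ^ l - 1).
Proof.
intros hb; unfold repdigit.
assert (G : exists q, b ^ l - 1 = (b - 1) * q).
{ induction l as [|l [q IH]]; [exists 0; simpl; lia|].
  exists (b * q + 1); pose proof (Nat.pow_nonzero b l ltac:(lia)).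
  rewrite Nat.pow_succ_r'; nia. }
destruct G as [q ->].
rewrite (Nat.mul_comm (b - 1) q), Nat.div_mul; [nia | lia].
Qed.

Theorem theorem1 (b n1 n2 n3 l1 l2 l3 d1 d2 d3 : nat) :
  2 <= b ->
  n3 <= n2 -> n2 <= n1 ->
  1 <= l1 -> l1 <= l2 -> l2 <= l3 ->
  d1 < b -> d2 < b -> d3 < b -> 0 < d1 ->
  fib n1 + fib n2 + fib n3 =
    repdigit b d1 l1 * b ^ (l2 + l3) + repdigit b d2 l2 * b ^ l3 + repdigit b d3 l3 ->
  (INR n1 < 309 * 10 ^ 80 * (ln (INR b)) ^ 11)%R.
Proof.
intros b2 n32 n21 l11 l12 l23 d1b d2b d3b d10 E.
replace 309%R with (INR 309) by (rewrite INR_IZR_INZ; reflexivity).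
replace 10%R with (INR 10) by (rewrite INR_IZR_INZ; reflexivity).
apply (@LinearForms.repdigit_bound_Stdlib b n1 n2 n3 l1 l2 l3 d1 d2 d3); try (clear E; lia).
rewrite E, !Nat.mul_add_distr_l, !Nat.mul_assoc, !repdigit_mul by assumption.
rewrite Nat.pow_add_r; ring.
Qed.
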